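(* Reachability and Distance can be maintained in $\mathrm{DynFO{+}Maj}(+,\times)$ under changes that affect $\mathcal{O}(\log^c n)$ nodes of a graph, where $c \in \mathbb{N}$ is fixed and $n$ is the number of nodes of the graph.
   Context: Reachability is the query that, given a directed graph $G$, returns all pairs $(s,t)$ of nodes such that there is a path from $s$ to $t$; Distance returns, for each such reachable pair, the length of a shortest path from $s$ to $t$. Dynamic complexity framework: a dynamic program works over a fixed finite domain of size $n$ (the nodes) and stores auxiliary relations over this domain. Initially the input graph is empty and all auxiliary relations are empty, except that a linear order and the corresponding addition and multiplication relations on the whole domain are present at all times. A change consists of a set of edges to insert and a set of edges to delete; the elements affected by a change are the nodes occurring in its tuples. After each change, every auxiliary relation is replaced by the set of tuples satisfying a fixed formula of first-order logic extended with majority quantifiers (quantifiers expressing that more than half of all domain elements satisfy a formula), evaluated over the changed graph, the current auxiliary relations and the built-in arithmetic; this defines the class $\mathrm{DynFO{+}Maj}(+,\times)$. A query is maintained under changes affecting $k$ elements if a designated auxiliary relation equals the query result after every nonempty sequence of such changes starting from the empty graph. *)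

(* Defs.v *)
From mathcomp Require Import all_boot all_order.

Set Implicit Arguments.
Unset Strict Implicit.
Unset Printing Implicit Defensive.

(* A directed graph on the nodes 0, ..., n-1 is its set of edges. *)
Definition digraph (n : nat) := {set 'I_n * 'I_n}.

Definition edge (n : nat) (E : digraph n) : rel 'I_n :=
  fun x y => (x, y) \in E.

Definition has_path (n : nat) (E : digraph n) (s t : 'I_n) (l : nat) : bool :=
  [exists p : l.-tuple 'I_n, path (edge E) s p && (last s p == t)].

Definition query (k : nat) := forall n : nat, digraph n -> {set k.-tuple 'I_n}.

(* The path from a node to itself of length 0 counts, so the relation is
   reflexive. *)
Definition reachability : query 2 := fun n E =>
  [set v : 2.-tuple 'I_n | connect (edge E) (tnth v ord0) (tnth v ord_max)].

(* The triples (s, t, d) such that a shortest path from s to t has length d.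
   Such a length is at most n - 1, hence it is a domain element. *)
Definition distance : query 3 := fun n E =>
  [set v : 3.-tuple 'I_n |
    let s := tnth v (inord 0) in
    let t := tnth v (inord 1) in
    let d := tnth v (inord 2) in
    has_path E s t d && [forall d' : 'I_n, (d' < d) ==> ~~ has_path E s t d']].

(* FO+Maj formulas over the edge relation, the built-in linear order, addition
   and multiplication, and m auxiliary relations with arities ar.  The free
   variables of a [formula ar k] are numbered by 'I_k; a quantifier binds
   variable 0 of its body and shifts the other ones. *)
Inductive formula (m : nat) (ar : 'I_m -> nat) : nat -> Type :=
| FEq k of 'I_k & 'I_k : formula ar k
| FLe k of 'I_k & 'I_k : formula ar k
| FPlus k of 'I_k & 'I_k & 'I_k : formula ar k
| FTimes k of 'I_k & 'I_k & 'I_k : formula ar k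
| FEdge k of 'I_k & 'I_k : formula ar k
| FAux k (R : 'I_m) of (ar R).-tuple 'I_k : formula ar k
| FNot k of formula ar k : formula ar k
| FAnd k of formula ar k & formula ar k : formula ar k
| FOr k of formula ar k & formula ar k : formula ar k
| FEx k of formula ar k.+1 : formula ar k
| FAll k of formula ar k.+1 : formula ar k
| FMaj k of formula ar k.+1 : formula ar k.

Definition aux_structure (m : nat) (ar : 'I_m -> nat) (n : nat) :=
  forall R : 'I_m, {set (ar R).-tuple 'I_n}.

Fixpoint holds (m : nat) (ar : 'I_m -> nat) (n : nat) (E : digraph n)
    (A : aux_structure ar n) (k : nat) (phi : formula ar k) :
    k.-tuple 'I_n -> bool :=
  match phi in formula _ k return k.-tuple 'I_n -> bool with
  | FEq _ x y => fun v => tnth v x == tnth v y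
  | FLe _ x y => fun v => tnth v x <= tnth v y
  | FPlus _ x y z => fun v => tnth v x + tnth v y == tnth v z :> nat
  | FTimes _ x y z => fun v => tnth v x * tnth v y == tnth v z :> nat
  | FEdge _ x y => fun v => (tnth v x, tnth v y) \in E
  | FAux _ R xs => fun v => [tuple of map (tnth v) xs] \in A R
  | FNot _ psi => fun v => ~~ holds E A psi v
  | FAnd _ psi chi => fun v => holds E A psi v && holds E A chi v
  | FOr _ psi chi => fun v => holds E A psi v || holds E A chi v
  | FEx _ psi => fun v => [exists a : 'I_n, holds E A psi [tuple of a :: v]]
  | FAll _ psi => fun v => [forall a : 'I_n, holds E A psi [tuple of a :: v]]
  | FMaj _ psi => fun v =>
      n < 2 * #|[set a : 'I_n | holds E A psi [tuple of a :: v]]|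
  end.

Record dynprog := DynProg {
  nb_aux : nat;
  arity : 'I_nb_aux -> nat;
  update : forall R : 'I_nb_aux, formula arity (arity R)
}.

Record change (n : nat) := Change {
  inserted : {set 'I_n * 'I_n};
  deleted : {set 'I_n * 'I_n}
}.

Definition affected (n : nat) (d : change n) : {set 'I_n} :=
  [set x | [exists e in inserted d :|: deleted d, (x == e.1) || (x == e.2)]].

Definition apply_change (n : nat) (E : digraph n) (d : change n) : digraph n :=
  (E :|: inserted d) :\: deleted d.

Definition state (P : dynprog) (n : nat) : Type :=
  (digraph n * aux_structure (@arity P) n)%type.

Definition init (P : dynprog) (n : nat) : state P n :=
  (set0, fun R => set0).

(* The update formulas see the changed graph and the auxiliary relations as
   they were before the change; they are all evaluated simultaneously. *)
Definition step (P : dynprog) (n : nat) (st : state P n) (d : change n) :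
    state P n :=
  let E := apply_change st.1 d in
  (E, fun R => [set v | holds E st.2 (update R) v]).

Definition run (P : dynprog) (n : nat) (ds : seq (change n)) : state P n :=
  foldl (@step P n) (init P n) ds.

(* The relation Q of the program P is the designated one; the cast only
   identifies its arity with that of the query. *)
Definition maintains (P : dynprog) (Q : 'I_(nb_aux P)) (k : nat)
    (eqk : k = arity Q) (q : query k) (f : nat -> nat) : Prop :=
  forall (n : nat) (ds : seq (change n)),
    0 < size ds ->
    all (fun d => #|affected d| <= f n) ds ->
    forall v : k.-tuple 'I_n,
      (tcast eqk v \in (run P ds).2 Q) = (v \in q n (run P ds).1).

(* Membership of q in DynFO+Maj(+,x) under changes affecting at most f(n)
   elements: one program serves all domain sizes n. *)
Definition in_DynFOMaj (k : nat) (q : query k) (f : nat -> nat) : Prop :=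
  exists (P : dynprog) (Q : 'I_(nb_aux P)) (eqk : k = arity Q),
    maintains eqk q f.

(* f(n) = O(log^c n); [up_log 2 n] is the logarithm to base 2 rounded up. *)
Definition O_log_pow (c : nat) (f : nat -> nat) : Prop :=
  exists C N : nat, forall n : nat, N <= n -> f n <= C * up_log 2 n ^ c.

(* Main.v *)
Require Import Defs.
From mathcomp Require Import all_boot all_order all_algebra all_fingroup all_solvable all_field.
From mathcomp Require Import ring zify.
From Stdlib Require Import FunctionalExtensionality.

Set Implicit Arguments.
Unset Strict Implicit.
Unset Printing Implicit Defensive.

(** The program maintains, for all primes p in a polynomial range, the numbers of
walks of each length l < n between any two nodes, modulo p.  With generating
functions modulo x^n, a change A' = A + U delta U^T of the adjacency matrix on k
nodes turns M = (1 - x A)^-1 into M + M U (1 - K)^-1 x delta U^T M, where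
K = x delta U^T M U is a k x k matrix.  The inverse is adj(1 - K) / det(1 - K);
it is evaluated at all points of F_p^* and interpolated.  Over F_p, Chistov's
formula reduces the adjugate and the determinant to entries of powers K^i with
i <= k.  Since k is polylogarithmic, a constant number of rounds suffices for
these, each round being a sum over polynomially many products of
about sqrt(log n) entries; products become sums of discrete logarithms.
The discrete logarithms need a table of powers modulo p, which is built by one
squaring per step; it is complete after O(log n) steps.  Until then only
polylogarithmically many nodes have an edge, and the answer comes from powers
of a Boolean matrix of that size, computed in the same way.
A walk count is at most n^n, so when it is nonzero some prime in the range does
not divide it, and the distance is the least l with a nonzero count.

On the logical side, FO+Maj counts domain elements, hence sums residues modulo
all q <= sqrt n, and a number of polynomial size is determined by these
residues.  So every term built from +, *, <= and bounded sums is definable for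
large n; for the finitely many other n the queries are first-order. *)

(** * Central binomial coefficients and residues *)

(** Three obstacles shape the construction. A walk count has about n log n bits and a generating
    function has polynomially many coefficients, whereas a formula handles single numbers of
    polynomial size; hence the residues, and hence the representation of a polynomial by its values
    at single points. Interpolation over F_p recovers coefficients only below degree p - 1, so the
    primes must exceed all degrees that occur, which are polynomial in n. The determinant of 1 - K
    may vanish at some of the points, so its values cannot be inverted there; as its constant term
    is 1, a geometric series, which is again a polynomial, inverts it modulo x^n. During startup the
    tables describe the empty graph. The first update after startup treats the whole current graph
    as one change to the empty graph. This is possible because the O(log n) changes made by then
    touch only polylogarithmically many nodes. *)

Lemma logn_central_bin p k : prime p -> 0 < k ->
  p ^ logn p 'C(k.*2, k) <= k.*2.
Proof.
move=> pp k_gt0; set c := logn p _.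
have p1 := prime_gt1 pp.
suff : c <= trunc_log p k.*2.
  move=> h; apply: leq_trans (leq_pexp2l (prime_gt0 pp) h) _.
  by apply: trunc_logP => //; rewrite double_gt0.
have E : c + (logn p k`! + logn p k`!) = logn p k.*2`!.
  have le : k <= k.*2 by lia.
  rewrite -(bin_fact le) (_ : k.*2 - k = k); last by lia.
  by rewrite !lognM ?muln_gt0 ?fact_gt0 ?bin_gt0.
move: E; rewrite !logn_fact // => E.
have ext : \sum_(1 <= i < k.*2.+1) k %/ p ^ i = \sum_(1 <= i < k.+1) k %/ p ^ i.
  rewrite (@big_cat_nat _ _ _ k.+1 1 k.*2.+1) //=; last by lia.
  rewrite [X in _ + X](_ : _ = 0) ?addn0 //.
  rewrite big_nat_cond big1 // => i /andP[/andP[h _] _].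
  by apply: divn_small; apply: ltn_trans h (ltn_expl _ p1).
rewrite -ext in E.
set t := trunc_log p k.*2 in E *.
(* By Legendre's formula the exponent c is the sum of floor(2k / p^i) - 2 floor(k / p^i). Each term
   is at most 1, and it vanishes once p^i > 2k, that is, for i > t. *)
have step i : k.*2 %/ p ^ i <= (i <= t) + (k %/ p ^ i + k %/ p ^ i).
  case: (leqP i t) => h.
    have pi0 : 0 < p ^ i by rewrite expn_gt0 prime_gt0.
    have := divn_eq k (p ^ i); have := ltn_pmod k pi0.
    set q := k %/ _; set r := k %% _ => hr hk.
    rewrite -ltnS ltn_divLR //; nia.
  rewrite divn_small //; apply: (@leq_trans (p ^ t.+1)).
    by apply: trunc_log_ltn.
  by rewrite leq_exp2l.
have H : \sum_(1 <= i < k.*2.+1) k.*2 %/ p ^ i <=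
  \sum_(1 <= i < k.*2.+1) ((i <= t) + (k %/ p ^ i + k %/ p ^ i)).
  by apply: leq_sum => i _; apply: step.
rewrite !big_split /= -E in H.
have H2 : \sum_(1 <= i < k.*2.+1) (i <= t : nat) <= t.
  have aux n : \sum_(1 <= i < n.+1) (i <= t : nat) <= minn n t.
    elim: n => [|n IH]; first by rewrite big_geq.
    by rewrite big_nat_recr //=; lia.
  by apply: leq_trans (aux _) _; apply: geq_minr.
lia.
Qed.

(** Each prime power in the factorisation of the binomial is at most 2k, hence itself one of the
    moduli. *)
Lemma central_bin_dvd k X : 0 < k ->
  (forall q, 0 < q -> q <= k.*2 -> q %| X) -> 'C(k.*2, k) %| X.
Proof.
move=> k0 h; apply/dvdn_partP; first by rewrite bin_gt0; lia.
move=> p; rewrite mem_primes => /and3P[pp _ _]; rewrite p_part.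
by apply: h; [rewrite expn_gt0 prime_gt0|apply: logn_central_bin].
Qed.

Lemma central_bin_ge k : 2 ^ k <= 'C(k.*2, k).
Proof.
elim: k => [|k IH]; first by rewrite bin0.
have E : 'C(k.+1.*2, k.+1) = 'C(k.*2.+1, k.+1).*2.
  rewrite doubleS [LHS]binS -(addnn (binomial _ _)); congr addn.
  by rewrite -(@bin_sub k.*2.+1 k); [congr 'C(_, _); lia|lia].
by rewrite E expnS mul2n leq_double binS; apply: leq_trans IH (leq_addl _ _).
Qed.

(** Every common multiple of the moduli is divisible by C(2k, k) >= 2^k, so a difference below 2^k
    that all of them divide is 0. *)
Lemma residues_inj k X Y : 0 < k -> X < 2 ^ k -> Y < 2 ^ k ->
  (forall q, 0 < q -> q <= k.*2 -> X = Y %[mod q]) -> X = Y.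
Proof.
move=> k0; wlog le : X Y / X <= Y => [H|] hX hY h.
  by case/orP: (leq_total X Y) => le; [|apply/esym]; apply: H => // q q0 qk;
    rewrite h.
have : 'C(k.*2, k) %| Y - X.
  by apply: central_bin_dvd => // q q0 qk; rewrite -eqn_mod_dvd // h.
case: (posnP (Y - X)) => [|gt0]; first by lia.
move/(dvdn_leq gt0); have := central_bin_ge k; lia.
Qed.

Lemma exp_dominates C a d : exists b0, forall b, b0 <= b -> C * (b + a) ^ d < 2 ^ b.
Proof.
have base e : exists b0, forall b, b0 <= b -> b ^ e <= 2 ^ b.
  (* With 2^t <= b < 2^(t + 1) the claim reduces to (t + 1) e <= 2^t. This holds from t >= 2 (e + 1)
     on, because (t - 1)^2 <= 2^t. *)
  exists (2 ^ (2 * e.+1)) => b hb; have b0 : 0 < b by apply: leq_trans hb; rewrite expn_gt0.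
  set t := trunc_log 2 b.
  have ht : 2 ^ t <= b by apply: trunc_logP.
  have ht' : b < 2 ^ t.+1 by apply: trunc_log_ltn.
  have le : 2 * e.+1 <= t by apply: trunc_log_max.
  apply: (@leq_trans ((2 ^ t.+1) ^ e)); first by case: (e) => // e1; rewrite leq_exp2r // ltnW.
  rewrite -expnM leq_exp2l //; apply: leq_trans ht.
  have sq n : n * n <= 2 ^ n.+1.
    elim: n => // n IH; have := ltn_expl n (isT : 1 < 2).
    by rewrite expnS; move: IH; rewrite expnS; nia.
  have := sq t.-1; rewrite (ltn_predK le).
  case: (t) le => // t' le; rewrite /=; nia.
have [b0 hb0] := base d.+2.
exists (maxn b0 (maxn (C * 2 ^ d).+2 (maxn a 2))) => b; rewrite !geq_max.
case/and4P=> /hb0 h1 h2 h3 h4.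
apply: leq_trans h1; rewrite !expnS.
have : (b + a) ^ d <= 2 ^ d * b ^ d.
  by rewrite -expnMn; case: d {h2 hb0} => // d; rewrite leq_exp2r //; lia.
have : 0 < b ^ d by rewrite expn_gt0; lia.
set x := b ^ d; set y := _ ^ d; set z := 2 ^ d in h2 * => x0 yx.
apply: (@leq_ltn_trans (C * z * x)); first by rewrite -mulnA leq_mul2l yx orbT.
apply: (@leq_trans (b * x)); first by rewrite ltn_mul2r x0; lia.
by rewrite leq_mul2l leq_pmull ?orbT //; lia.
Qed.

Lemma sum_ord_mul a b (F : nat -> nat) :
  \sum_(z < a * b) F z = \sum_(r < a) \sum_(s < b) F (r * b + s).
Proof.
elim: a => [|a IH]; first by rewrite !big_ord0.
rewrite big_ord_recr -IH mulSnr big_split_ord /=; congr (_ + _).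
Qed.

Lemma sum_ord_ltn b c : \sum_(s < b) (s < c : nat) = minn c b.
Proof. by elim: b => [|b IH]; rewrite ?big_ord0 ?big_ord_recr /= ?IH; lia. Qed.

Lemma sum_ord_eq n c (F : nat -> nat) :
  c < n -> \sum_(i < n) (i == c :> nat) * F i = F c.
Proof.
move=> cn; rewrite (bigD1 (Ordinal cn)) //= eqxx mul1n big1 ?addn0 // => i.
by rewrite -val_eqE /= => /negbTE->.
Qed.

Lemma sum_modn (I : finType) (q : nat) (F : I -> nat) :
  (\sum_i F i) %% q = (\sum_i F i %% q) %% q.
Proof. by rewrite modn_summ. Qed.

(* A sum modulo q <= sqrt n of n terms is a number of domain elements: group the
   terms by their residue r; the residues of the q contributions of the groups
   are then counted by the elements y < q * q, written as y = r * q + s. *)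
Lemma sum_mod_card n q (f : 'I_n -> nat) : 0 < q -> q * q <= n ->
  (\sum_a f a) %% q =
  #|[set y : 'I_n | (y < q * q) &&
      (y %% q < (y %/ q * #|[set a | f a %% q == y %/ q]|) %% q)]| %% q.
Proof.
move=> q0 qn.
pose c r := #|[set a | f a %% q == r]|.
have -> : #|[set y : 'I_n | (y < q * q) && (y %% q < (y %/ q * c (y %/ q)) %% q)]|
   = \sum_(r < q) (r * c r) %% q.
  rewrite -sum1dep_card big_mkcond /=.
  pose G (y : nat) : nat := y %% q < (y %/ q * c (y %/ q)) %% q.
  have -> : \sum_(y < n) (if (y < q * q) && (y %% q < (y %/ q * c (y %/ q)) %% q)
     then 1 else 0) = \sum_(y < q * q) G y.
    rewrite (big_ord_widen n G qn) [RHS]big_mkcond; apply: eq_bigr => y _.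
    by rewrite /G; case: ltnP; case: ltnP.
  rewrite sum_ord_mul; apply: eq_bigr => r _.
  rewrite (eq_bigr (fun s : 'I_q => (s < (r * c r) %% q : nat))).
    by rewrite sum_ord_ltn; apply/minn_idPl/ltnW/ltn_pmod.
  by move=> s _; rewrite /G divnMDl // divn_small ?ltn_ord // addn0 modnMDl modn_small.
rewrite -sum_modn sum_modn; congr (_ %% q).
transitivity (\sum_(r < q) \sum_(a | f a %% q == r) f a %% q).
  rewrite [RHS](exchange_big_dep xpredT) //=; apply: eq_bigr => a _.
  have h := ltn_pmod (f a) q0.
  by rewrite (big_pred1 (Ordinal h)) // => r; rewrite -val_eqE /= eq_sym.
apply: eq_bigr => r _; rewrite /c -sum1dep_card big_distrr /=.
by apply: eq_bigr => a /eqP->; rewrite muln1.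
Qed.

(** * Definable predicates and counting *)

Section Definability.
Variables (m : nat) (ar : 'I_m -> nat).

Record world := World {
  dsize : nat; wE : digraph dsize; wA : aux_structure ar dsize }.

Definition env (w : world) := nat -> 'I_(dsize w).

Definition scons T (a : T) (e : nat -> T) : nat -> T :=
  fun i => if i is j.+1 then e j else a.

Definition etup (w : world) (k : nat) (e : env w) : k.-tuple 'I_(dsize w) :=
  [tuple e i | i < k].

(* Quantifying over all renamings [s] of the variables builds weakening into
   the notion; [n0] is a lower bound on the domain size. *)
Definition definable (n0 : nat) (P : forall w, env w -> bool) : Prop :=
  forall (s : nat -> nat) k, (forall i, s i < k) ->
  exists phi : formula ar k, forall w (e : env w), n0 <= dsize w ->
    holds (wE w) (wA w) phi (etup k e) = P w (fun i => e (s i)).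

Definition fex (w : world) (P : 'I_(dsize w) -> bool) := [exists a, P a].
Definition fall (w : world) (P : 'I_(dsize w) -> bool) := [forall a, P a].
Definition fcount (w : world) (P : 'I_(dsize w) -> bool) := #|[set a | P a]|.

Lemma etup_cons w k (e : env w) a :
  [tuple of a :: etup k e] = etup k.+1 (scons a e).
Proof.
apply: eq_from_tnth => i; rewrite tnth_mktuple.
case: (unliftP ord0 i) => [j ->|->].
  by rewrite tnthS tnth_mktuple.
by rewrite tnth0.
Qed.

Definition up (s : nat -> nat) : nat -> nat := scons 0 (fun i => (s i).+1).

Lemma up_lt s k : (forall i, s i < k) -> forall i, up s i < k.+1.
Proof. by move=> hs []. Qed.

Lemma def_ext n0 P Q :
  (forall w (e : env w), n0 <= dsize w -> P w e = Q w e) ->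
  definable n0 Q -> definable n0 P.
Proof.
move=> PQ dQ s k /dQ[phi hphi].
by exists phi => w e le; rewrite hphi // PQ.
Qed.

Lemma def_mono n0 n1 P : n0 <= n1 -> definable n0 P -> definable n1 P.
Proof.
move=> le dP s k /dP[phi hphi].
by exists phi => w e le1; apply: hphi; apply: leq_trans le1.
Qed.

Lemma def_ren n0 P (t : nat -> nat) :
  definable n0 P -> definable n0 (fun w e => P w (fun i => e (t i))).
Proof. by move=> dP s k hs; apply: (dP (fun i => s (t i))) => i. Qed.

Lemma def_not n0 P : definable n0 P -> definable n0 (fun w e => ~~ P w e).
Proof.
move=> dP s k /dP[phi hphi].
by exists (FNot phi) => w e le /=; rewrite hphi.
Qed.

Lemma def_and n0 P Q :
  definable n0 P -> definable n0 Q -> definable n0 (fun w e => P w e && Q w e).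
Proof.
move=> dP dQ s k hs; have [phi hphi] := dP s k hs; have [psi hpsi] := dQ s k hs.
by exists (FAnd phi psi) => w e le /=; rewrite hphi // hpsi.
Qed.

Lemma def_or n0 P Q :
  definable n0 P -> definable n0 Q -> definable n0 (fun w e => P w e || Q w e).
Proof.
move=> dP dQ s k hs; have [phi hphi] := dP s k hs; have [psi hpsi] := dQ s k hs.
by exists (FOr phi psi) => w e le /=; rewrite hphi // hpsi.
Qed.

Lemma def_imp n0 P Q :
  definable n0 P -> definable n0 Q -> definable n0 (fun w e => P w e ==> Q w e).
Proof.
move=> dP dQ; apply: (@def_ext _ _ (fun w e => ~~ P w e || Q w e)).
  by move=> w e _; rewrite implybE.
by apply: def_or dQ; apply: def_not.
Qed.

Lemma def_ex n0 (P : forall w, env w -> 'I_(dsize w) -> bool) :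
  definable n0 (fun w e => P w (fun i => e i.+1) (e 0)) ->
  definable n0 (fun w e => fex (P w e)).
Proof.
move=> dP s k hs; have [phi hphi] := dP (up s) k.+1 (up_lt hs).
exists (FEx phi) => w e le /=; apply: eq_existsb => a.
by rewrite etup_cons hphi.
Qed.

Lemma def_all n0 (P : forall w, env w -> 'I_(dsize w) -> bool) :
  definable n0 (fun w e => P w (fun i => e i.+1) (e 0)) ->
  definable n0 (fun w e => fall (P w e)).
Proof.
move=> dP s k hs; have [phi hphi] := dP (up s) k.+1 (up_lt hs).
exists (FAll phi) => w e le /=; apply: eq_forallb => a.
by rewrite etup_cons hphi.
Qed.

Lemma def_maj n0 (P : forall w, env w -> 'I_(dsize w) -> bool) :
  definable n0 (fun w e => P w (fun i => e i.+1) (e 0)) ->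
  definable n0 (fun w e => dsize w < 2 * fcount (P w e)).
Proof.
move=> dP s k hs; have [phi hphi] := dP (up s) k.+1 (up_lt hs).
exists (FMaj phi) => w e le /=; congr (_ < 2 * _).
by apply: eq_card => a; rewrite !inE etup_cons hphi.
Qed.

Lemma def_le n0 x y : definable n0 (fun w e => e x <= e y).
Proof.
move=> s k hs.
by exists (FLe _ (Ordinal (hs x)) (Ordinal (hs y))) => w e _ /=; rewrite !tnth_mktuple.
Qed.

Lemma def_eq n0 x y : definable n0 (fun w e => e x == e y :> nat).
Proof.
move=> s k hs.
by exists (FEq _ (Ordinal (hs x)) (Ordinal (hs y))) => w e _ /=; rewrite !tnth_mktuple.
Qed.

Lemma def_edge n0 x y : definable n0 (fun w e => (e x, e y) \in wE w).
Proof.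
move=> s k hs.
by exists (FEdge _ (Ordinal (hs x)) (Ordinal (hs y))) => w e _ /=; rewrite !tnth_mktuple.
Qed.

Lemma def_plus n0 x y z : definable n0 (fun w e => e x + e y == e z :> nat).
Proof.
move=> s k hs.
exists (FPlus _ (Ordinal (hs x)) (Ordinal (hs y)) (Ordinal (hs z))) => w e _ /=.
by rewrite !tnth_mktuple.
Qed.

Lemma def_times n0 x y z : definable n0 (fun w e => e x * e y == e z :> nat).
Proof.
move=> s k hs.
exists (FTimes _ (Ordinal (hs x)) (Ordinal (hs y)) (Ordinal (hs z))) => w e _ /=.
by rewrite !tnth_mktuple.
Qed.

Lemma def_aux n0 (R : 'I_m) (x : 'I_(ar R) -> nat) :
  definable n0 (fun w e => [tuple e (x i) | i < ar R] \in wA w R).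
Proof.
move=> s k hs.
exists (@FAux _ ar _ R [tuple Ordinal (hs (x i)) | i < ar R]) => w e _ /=.
apply: (congr1 (fun v => v \in wA w R)); apply: eq_from_tnth => i.
by rewrite tnth_map !tnth_mktuple.
Qed.

Lemma def_lt n0 x y : definable n0 (fun w e => e x < e y).
Proof.
apply: (@def_ext _ _ (fun w e => ~~ (e y <= e x))); last exact/def_not/def_le.
by move=> w e _; rewrite ltnNge.
Qed.

Lemma def_bool n0 (b : bool) : definable n0 (fun w e => b).
Proof.
apply: (@def_ext _ _ (fun w e => if b then e 0 <= e 0 else ~~ (e 0 <= e 0))).
  by move=> w e _; case: b; rewrite leqnn.
by case: b; last apply: def_not; apply: def_le.
Qed.

Lemma def_const n0 c x : definable n0 (fun w e => e x == c :> nat).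
Proof.
elim: c x => [|c IH] x.
  apply: (@def_ext _ _ (fun w e => fall (fun a => e x <= a))).
    move=> w e _; apply/idP/forallP => [/eqP->//|h].
    have n_gt0 : 0 < dsize w by apply: leq_ltn_trans (ltn_ord (e x)).
    by have := h (Ordinal n_gt0); rewrite leqn0.
  by apply: def_all; apply: def_le.
apply: (@def_ext _ _ (fun w e => fex (fun a =>
    [&& a == c :> nat, a < e x & fall (fun b : 'I__ => (a < b) ==> (e x <= b))]))).
  move=> w e _; apply/eqP/existsP => [h|[a /and3P[/eqP ha lt /forallP h]]].
    have hc : c < dsize w by apply: ltn_trans (ltn_ord (e x)); rewrite h.
    exists (Ordinal hc); rewrite /= eqxx h leqnn /=.
    by apply/forallP => b; apply/implyP.
  have hc : c.+1 < dsize w by apply: leq_ltn_trans (ltn_ord (e x)); rewrite -ha.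
  have /implyP/= := h (Ordinal hc); rewrite ha ltnSn => /(_ isT) le.
  by apply/eqP; rewrite eqn_leq le -ha.
apply: def_ex; apply: def_and (IH 0) _; apply: def_and; first exact: def_lt.
by apply: def_all; apply: def_imp; [apply: def_lt|apply: def_le].
Qed.


Definition definable1 n0 (P : forall w, env w -> 'I_(dsize w) -> bool) :=
  definable n0 (fun w e => P w (fun i => e i.+1) (e 0)).

Lemma def1_ren n0 P (t : nat -> nat) :
  definable1 n0 P -> definable1 n0 (fun w e a => P w (fun i => e (t i)) a).
Proof. by move=> dP; apply: (def_ren (up t) dP). Qed.

Lemma fcountE w (P : 'I_(dsize w) -> bool) : fcount P = \sum_a P a.
Proof. by rewrite /fcount -sum1dep_card big_mkcond. Qed.

Lemma sum_itv n i j : \sum_(a < n) ((i <= a < j) : nat) = minn j n - i.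
Proof.
elim: n => [|n IH]; first by rewrite big_ord0; lia.
by rewrite big_ord_recr /= IH; lia.
Qed.

(** [dsize w] is not the value of any variable. That x is below half of it is expressed by 2x being
    an element other than the last one. *)
Lemma def_lt_half n0 x : definable n0 (fun w e => e x < (dsize w)./2).
Proof.
apply: (@def_ext _ _ (fun w e => fex (fun y : 'I__ =>
  (e x + e x == y :> nat) && fex (fun z : 'I__ => y < z)))).
  move=> w e _; apply/idP/existsP => [h|[y /andP[/eqP hy /existsP[z hz]]]].
    have h1 : e x + e x < dsize w by lia.
    have h2 : (e x + e x).+1 < dsize w by lia.
    exists (Ordinal h1); rewrite eqxx; apply/existsP.
    by exists (Ordinal h2) => /=.
  have := ltn_ord z; lia.
apply: def_ex; apply: def_and; first exact: def_plus.
by apply: def_ex; apply: def_lt.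
Qed.

(** The only exception is the last element n - 1 for odd n: it is maximal and even. *)
Lemma def_lt_dhalf n0 x : definable n0 (fun w e => e x < (dsize w)./2.*2).
Proof.
apply: (@def_ext _ _ (fun w e => fex (fun z : 'I__ => e x < z) ||
  ~~ fex (fun c : 'I__ => c + c == e x :> nat))).
  move=> w e _; have xn := ltn_ord (e x); apply/idP/orP => [h|[|]].
  - case: (ltnP (e x).+1 (dsize w)) => h1; [left|right].
      by apply/existsP; exists (Ordinal h1) => /=.
    by apply/existsP => -[c /eqP]; lia.
  - by case/existsP=> z; have := ltn_ord z; lia.
  - move=> /existsP h; case: (ltnP (e x) (dsize w)./2.*2) => // h1; case: h.
    have h2 : (dsize w)./2 < dsize w by lia.
    by exists (Ordinal h2) => /=; lia.
apply: def_or; first by apply: def_ex; apply: def_lt.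
by apply: def_not; apply: def_ex; apply: def_plus.
Qed.

Section Halves.
Variables (w : world) (P : 'I_(dsize w) -> bool).
Let h := (dsize w)./2.
Definition count_lo := fcount (fun a => (a < h) && P a).
Definition count_hi := fcount (fun a => [&& h <= a, a < h.*2 & P a]).
(** The two halves must have equal size for the padding to work; for odd n the element n - 1 lies in
    neither. *)
Definition count_top := fex (fun a => ~~ (a < h.*2) && P a).

Lemma count_split : fcount P = count_lo + count_hi + count_top.
Proof.
rewrite /count_lo /count_hi /count_top !fcountE.
have -> : fex (fun a => ~~ (a < h.*2) && P a) =
          \sum_(a : 'I_(dsize w)) (~~ (a < h.*2) && P a) :> nat.
  rewrite -fcountE /fcount; apply/esym.
  rewrite /fex; case: existsP => [[a ha]|hn].
    apply/eqP/cards1P; exists a; apply/setP => b; rewrite !inE.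
    apply/idP/eqP => [hb|->//]; apply: val_inj => /=.
    move: (ltn_ord a) (ltn_ord b); rewrite /h in ha hb; case/andP: ha => + _.
    by case/andP: hb => + _; lia.
  by apply/eqP; rewrite cards_eq0 -subset0; apply/subsetP => a; rewrite inE =>
    ha; case: hn; exists a.
rewrite -!big_split; apply: eq_bigr => a _ /=.
by case: (P a); rewrite ?andbT ?andbF //; lia.
Qed.

Lemma count_lo_le : count_lo <= h.
Proof.
have := sum_itv (dsize w) 0 h; rewrite /count_lo fcountE /h => H.
apply: (@leq_trans (minn (dsize w)./2 (dsize w) - 0)); last by lia.
by rewrite -H; apply: leq_sum => a _; case: (P a); lia.
Qed.

Lemma count_hi_le : count_hi <= h.
Proof.
have := sum_itv (dsize w) h h.*2; rewrite /count_hi fcountE /h => H.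
apply: (@leq_trans (minn (dsize w)./2.*2 (dsize w) - (dsize w)./2)); last by lia.
by rewrite -H; apply: leq_sum => a _; case: (P a); lia.
Qed.

(* The half of the domain that is not counted is padded, so that the majority
   quantifier tests an arbitrary threshold. *)
Lemma count_lo_gt (u : nat) : (u < count_lo) =
  (u < h) && (dsize w < 2 * fcount (fun a : 'I_(dsize w) =>
     ((a < h) && P a) || ((h <= a) && (a + u < h.*2)))).
Proof.
have le := count_lo_le; case: (ltnP u h) => [lt_uh|le_hu] /=; last first.
  by apply/negbTE; rewrite -leqNgt; apply: leq_trans le _.
rewrite (_ : fcount _ = count_lo + (h - u)); first by rewrite /h in le lt_uh *; lia.
have -> : h - u = \sum_(a < dsize w) ((h <= a < h.*2 - u) : nat).
  by rewrite sum_itv /h; rewrite /h in lt_uh; lia.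
rewrite /count_lo !fcountE -big_split; apply: eq_bigr => a _ /=.
by case: (P a); rewrite ?andbT ?andbF; lia.
Qed.

Lemma count_hi_gt (u : nat) : (u < count_hi) =
  (u < h) && (dsize w < 2 * fcount (fun a : 'I_(dsize w) =>
     [&& h <= a, a < h.*2 & P a] || ((a < h) && (a + u < h)))).
Proof.
have le := count_hi_le; case: (ltnP u h) => [lt_uh|le_hu] /=; last first.
  by apply/negbTE; rewrite -leqNgt; apply: leq_trans le _.
rewrite (_ : fcount _ = count_hi + (h - u)); first by rewrite /h in le lt_uh *; lia.
have -> : h - u = \sum_(a < dsize w) ((0 <= a < h - u) : nat).
  by rewrite sum_itv /h; rewrite /h in lt_uh; lia.
rewrite /count_hi !fcountE -big_split; apply: eq_bigr => a _ /=.
by case: (P a); rewrite ?andbT ?andbF; lia.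
Qed.
End Halves.

Lemma def_count_lo n0 P x :
  definable1 n0 P -> definable n0 (fun w e => e x < count_lo (P w e)).
Proof.
move=> dP; apply: (@def_ext _ _ (fun w e => (e x < (dsize w)./2) &&
  (dsize w < 2 * fcount (fun a : 'I_(dsize w) =>
    ((a < (dsize w)./2) && P w e a) || (~~ (a < (dsize w)./2) &&
      fex (fun y : 'I__ => (a + e x == y :> nat) && (y < (dsize w)./2.*2))))))).
  move=> w e _; rewrite count_lo_gt; congr (_ && (_ < 2 * _)).
  apply: eq_card => a; rewrite !inE -leqNgt; congr (_ || (_ && _)).
  apply/idP/existsP => [h|[y /andP[/eqP->]]//].
  have h1 : a + e x < dsize w by lia.
  by exists (Ordinal h1); rewrite /= eqxx.
apply: def_and; first exact: def_lt_half.
apply: def_maj; apply: def_or; apply: def_and => //; first exact: def_lt_half.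
  by apply: def_not; apply: def_lt_half.
apply: def_ex; apply: def_and; first exact: def_plus.
exact: def_lt_dhalf.
Qed.

Lemma def_count_hi n0 P x :
  definable1 n0 P -> definable n0 (fun w e => e x < count_hi (P w e)).
Proof.
move=> dP; apply: (@def_ext _ _ (fun w e => (e x < (dsize w)./2) &&
  (dsize w < 2 * fcount (fun a : 'I_(dsize w) =>
    (~~ (a < (dsize w)./2) && ((a < (dsize w)./2.*2) && P w e a)) ||
    ((a < (dsize w)./2) &&
      fex (fun y : 'I__ => (a + e x == y :> nat) && (y < (dsize w)./2))))))).
  move=> w e _; rewrite count_hi_gt; congr (_ && (_ < 2 * _)).
  apply: eq_card => a; rewrite !inE -leqNgt; congr (_ || (_ && _)).
  apply/idP/existsP => [h|[y /andP[/eqP->]]//].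
  have h1 : a + e x < dsize w by lia.
  by exists (Ordinal h1); rewrite /= eqxx.
apply: def_and; first exact: def_lt_half.
apply: def_maj; apply: def_or; apply: def_and.
- by apply: def_not; apply: def_lt_half.
- by apply: def_and => //; apply: def_lt_dhalf.
- exact: def_lt_half.
apply: def_ex; apply: def_and; first exact: def_plus.
exact: def_lt_half.
Qed.

(** The full count may be as large as the domain, so it need not be an element. The comparison goes
    through the difference of [e x] and [count_lo], which is one. The predicate [isc] identifies an
    element with a count through the elements below it. *)
Lemma def_count_gt n0 P x :
  definable1 n0 P -> definable n0 (fun w e => e x < fcount (P w e)).
Proof.
move=> dP.
pose isc (c : forall w, ('I_(dsize w) -> bool) -> nat) w e (y : 'I_(dsize w)) :=
  ~~ (y < c w (P w e)) && @fall w (fun b => (b < y) ==> (b < c w (P w e))).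
have iscE c w e (y : 'I_(dsize w)) : isc c w e y = (y == c w (P w e) :> nat).
  rewrite /isc -leqNgt eqn_leq andbC; case: (leqP (c w (P w e)) y) => h;
    rewrite ?andbT ?andbF //=.
  apply/forallP/idP => [H|H b]; last by apply/implyP => lt; lia.
  case: leqP => // lt; have hl := ltn_trans lt (ltn_ord y).
  by have := implyP (H (Ordinal hl)) lt; rewrite /= ltnn.
apply: (@def_ext _ _ (fun w e => (e x < count_lo (P w e)) ||
  fex (fun y : 'I__ => isc count_lo w e y && fex (fun v : 'I__ =>
   (y + v == e x :> nat) && ((v < count_hi (P w e)) ||
     (isc count_hi w e v && count_top (P w e))))))).
  move=> w e _; rewrite count_split.
  case: (ltnP (e x) (count_lo (P w e))) => [lt|le] /=; first by lia.
  apply/idP/existsP => [h|[y]]; last first.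
    rewrite iscE => /andP[/eqP hy /existsP[v /andP[/eqP hv]]].
    by rewrite iscE; case: (count_top _); lia.
  have h1 := leq_ltn_trans le (ltn_ord (e x)).
  have h2 := leq_ltn_trans (leq_subr (count_lo (P w e)) (e x)) (ltn_ord (e x)).
  exists (Ordinal h1); rewrite iscE eqxx /=; apply/existsP.
  exists (Ordinal h2); rewrite iscE /= subnKC // eqxx /=.
  by move: h; case: (count_top _); lia.
have dP1 := def1_ren S dP; have dP2 := def1_ren S dP1; have dP3 := def1_ren S dP2.
have dlo : definable n0 (fun w e => isc count_lo w (fun i => e i.+1) (e 0)).
  apply: def_and; first exact/def_not/(def_count_lo 0 dP1).
  apply: def_all; apply: def_imp; first exact: def_lt.
  exact: (def_count_lo 0 dP2).
have dhi : definable n0 (fun w e => isc count_hi w (fun i => e i.+2) (e 0)).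
  apply: def_and; first exact/def_not/(def_count_hi 0 dP2).
  apply: def_all; apply: def_imp; first exact: def_lt.
  exact: (def_count_hi 0 dP3).
apply: def_or; first exact: def_count_lo.
apply: def_ex; apply: def_and => //.
apply: def_ex; apply: def_and; first exact: def_plus.
apply: def_or; first exact: (def_count_hi 0 dP2).
apply: def_and => //; apply: def_ex; apply: def_and; last exact: dP2.
by apply: def_not; apply: def_lt_dhalf.
Qed.

End Definability.

(** * Residues of definable sums *)

Section Residues.
Variables (m : nat) (ar : 'I_m -> nat).
Local Notation world := (world ar).
Local Notation env := (@env m ar).

(** The bound on q keeps sums and products of two residues inside the domain, and it leaves room for
    the q * q elements counted in [sum_mod_card]. *)
Definition small_mod (w : world) (q : nat) := (0 < q) && (q * q <= dsize w).

Lemma def_mod n0 x q y :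
  definable n0 (fun (w : world) e => (0 < e q) && (e x %% e q == e y)).
Proof.
apply: (@def_ext _ _ _ _ (fun w e => fex (fun k : 'I__ => fex (fun c : 'I__ =>
   [&& k * e q == c :> nat, c + e y == e x :> nat & e y < e q])))).
  move=> w e _; apply/andP/existsP => [[q0 /eqP h]|[k /existsP[c /and3P[]]]].
    have hk : e x %/ e q < dsize w.
      by apply: leq_ltn_trans (ltn_ord (e x)); apply: leq_div.
    have hc : e x %/ e q * e q < dsize w.
      by apply: leq_ltn_trans (ltn_ord (e x)); apply: leq_trunc_div.
    exists (Ordinal hk); apply/existsP; exists (Ordinal hc).
    by rewrite /= eqxx -h -divn_eq eqxx ltn_mod.
  move=> /eqP h1 /eqP h2 h3; split; first exact: leq_ltn_trans h3.
  by rewrite -h2 -h1 modnMDl modn_small.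
apply: def_ex; apply: def_ex; apply: def_and; first exact: def_times.
by apply: def_and; [exact: def_plus|exact: def_lt].
Qed.

Lemma def_small_mod n0 x : definable n0 (fun (w : world) e => small_mod w (e x)).
Proof.
(* Here c = q - 1, and p = c q + c = q^2 - 1 is an element exactly if q^2 <= n. The square itself
   may equal n and is then no element. *)
apply: (@def_ext _ _ _ _ (fun w e =>
  fex (fun c : 'I__ => fex (fun o : 'I__ => [&& o == 1 :> nat, c + o == e x :> nat &
    fex (fun d : 'I__ => (c * e x == d :> nat) &&
      fex (fun p : 'I__ => (d + c == p :> nat)))]))
  || (e x == 1 :> nat))).
  move=> w e _; rewrite /small_mod; apply/andP/orP.
    case=> x0 h; have xn := ltn_ord (e x).
    case: (ltnP 1 (dsize w)) => n1; last by right; lia.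
    left; apply/existsP.
    have hc : (e x).-1 < dsize w by lia.
    have hd : (e x).-1 * e x < dsize w by nia.
    have hp : (e x).-1 * e x + (e x).-1 < dsize w by nia.
    exists (Ordinal hc); apply/existsP; exists (Ordinal n1).
    rewrite /= addn1 prednK // eqxx; apply/existsP.
    exists (Ordinal hd); rewrite /= eqxx; apply/existsP.
    by exists (Ordinal hp); rewrite /= eqxx.
  case=> [/existsP[c /existsP[o /and3P[/eqP h1 /eqP h2]]]|/eqP h]; last first.
    by have := ltn_ord (e x); rewrite h; lia.
  case/existsP=> d /andP[/eqP h3 /existsP[p /eqP h4]].
  by have := ltn_ord p; nia.
apply: def_or; last exact: def_const.
apply: def_ex; apply: def_ex; apply: def_and; first exact: def_const.
apply: def_and; first exact: def_plus.
apply: def_ex; apply: def_and; first exact: def_times.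
by apply: def_ex; apply: def_plus.
Qed.

(* Renamings are built in as in [definable], because the modulus and the residue
   are variables that may lie outside the image of the renaming. *)
Definition res_def n0 (f : forall w : world, env w -> nat) : Prop :=
  forall (s : nat -> nat) x y, definable n0 (fun w e =>
    small_mod w (e x) && (f w (fun i => e (s i)) %% e x == e y)).

Lemma res_ext n0 f g : (forall w (e : env w), n0 <= dsize w -> f w e = g w e) ->
  res_def n0 g -> res_def n0 f.
Proof.
move=> fg dg s x y; apply: def_ext (dg s x y) => w e h.
by rewrite fg.
Qed.

Lemma res_mono n0 n1 f : n0 <= n1 -> res_def n0 f -> res_def n1 f.
Proof. by move=> le df s x y; apply: def_mono (df s x y). Qed.

Lemma res_ren n0 f (t : nat -> nat) :
  res_def n0 f -> res_def n0 (fun w e => f w (fun i => e (t i))).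
Proof. by move=> df s x y; apply: (df (fun i => s (t i))). Qed.

Lemma res_var n0 i : res_def n0 (fun w e => e i).
Proof.
move=> s x y; apply: (@def_ext _ _ _ _ (fun w e => small_mod w (e x) &&
   ((0 < e x) && (e (s i) %% e x == e y)))).
  by move=> w e _; rewrite /small_mod; case: (0 < e x).
by apply: def_and; [apply: def_small_mod | apply: def_mod].
Qed.

Lemma res_bool n0 P : 1 < n0 -> definable n0 P -> res_def n0 (fun w e => P w e).
Proof.
move=> n1 dP s x y.
(* The modulus may be 1, so the residue of the element o = 1 is taken instead of 1 itself. *)
apply: (@def_ext _ _ _ _ (fun w e => small_mod w (e x) &&
  fex (fun o : 'I__ => [&& o == 1 :> nat & (0 < e x) &&
    (o %% e x == e y)] && P w (fun i => e (s i)) ||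
    (~~ P w (fun i => e (s i)) && (e y == 0 :> nat))))).
  move=> w e n0w; case sm: (small_mod _ _) => //=.
  have x0 : 0 < e x by case/andP: sm.
  have nw : 1 < dsize w by apply: leq_trans n0w.
  apply/idP/existsP => [h|[o]].
    exists (Ordinal nw) => /=; rewrite x0 /=.
    case: (P w _) h => /= h; first by rewrite h.
    by rewrite andbF /= eq_sym -(mod0n (e x)).
  case: (P w _); rewrite /= ?andbT ?andbF ?orbF ?mod0n; last by rewrite eq_sym.
  by case/and3P=> /eqP->.
apply: def_and; first exact: def_small_mod.
apply: def_ex; apply: def_or; apply: def_and.
- by apply: def_and; [apply: def_const | apply: def_mod].
- exact: (def_ren (fun i => (s i).+1)).
- by apply: def_not; apply: (def_ren (fun i => (s i).+1)).
- exact: def_const.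
Qed.

Lemma small_mod_lt (w : world) q a b : small_mod w q -> a < q -> b < q ->
  (a + b < dsize w) && (a * b < dsize w).
Proof. by case/andP=> q0 qn aq bq; apply/andP; split; nia. Qed.

Lemma res_add n0 f g :
  res_def n0 f -> res_def n0 g -> res_def n0 (fun w e => f w e + g w e).
Proof.
move=> df dg s x y.
apply: (@def_ext _ _ _ _ (fun w e => fex (fun a : 'I__ =>
  (small_mod w (e x) && (f w (fun i => e (s i)) %% e x == a)) && fex (fun b : 'I__ =>
  (small_mod w (e x) && (g w (fun i => e (s i)) %% e x == b)) && fex (fun c : 'I__ =>
  (a + b == c :> nat) && ((0 < e x) && (c %% e x == e y))))))).
  move=> w e _; apply/idP/existsP.
    case/andP=> sm h; have /andP[x0 _] := sm.
    have [fx gx] := (ltn_pmod (f w (fun i => e (s i))) x0,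
                     ltn_pmod (g w (fun i => e (s i))) x0).
    have /andP[hc _] := small_mod_lt sm fx gx.
    exists (Ordinal (ltn_trans fx (ltn_ord _))); rewrite sm eqxx; apply/existsP.
    exists (Ordinal (ltn_trans gx (ltn_ord _))); rewrite eqxx; apply/existsP.
    by exists (Ordinal hc); rewrite /= eqxx x0 modnDm.
  case=> a /andP[/andP[sm /eqP ha] /existsP[b /andP[/andP[_ /eqP hb]]]].
  case/existsP=> c /and3P[/eqP hc x0 h]; rewrite sm /=.
  by rewrite -modnDm ha hb hc.
apply: def_ex; apply: def_and; first exact: (df (fun i => (s i).+1)).
apply: def_ex; apply: def_and; first exact: (dg (fun i => (s i).+2)).
by apply: def_ex; apply: def_and; [exact: def_plus|exact: def_mod].
Qed.

Lemma res_mul n0 f g :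
  res_def n0 f -> res_def n0 g -> res_def n0 (fun w e => f w e * g w e).
Proof.
move=> df dg s x y.
apply: (@def_ext _ _ _ _ (fun w e => fex (fun a : 'I__ =>
  (small_mod w (e x) && (f w (fun i => e (s i)) %% e x == a)) && fex (fun b : 'I__ =>
  (small_mod w (e x) && (g w (fun i => e (s i)) %% e x == b)) && fex (fun c : 'I__ =>
  (a * b == c :> nat) && ((0 < e x) && (c %% e x == e y))))))).
  move=> w e _; apply/idP/existsP.
    case/andP=> sm h; have /andP[x0 _] := sm.
    have [fx gx] := (ltn_pmod (f w (fun i => e (s i))) x0,
                     ltn_pmod (g w (fun i => e (s i))) x0).
    have /andP[_ hc] := small_mod_lt sm fx gx.
    exists (Ordinal (ltn_trans fx (ltn_ord _))); rewrite sm eqxx; apply/existsP.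
    exists (Ordinal (ltn_trans gx (ltn_ord _))); rewrite eqxx; apply/existsP.
    by exists (Ordinal hc); rewrite /= eqxx x0 modnMm.
  case=> a /andP[/andP[sm /eqP ha] /existsP[b /andP[/andP[_ /eqP hb]]]].
  case/existsP=> c /and3P[/eqP hc x0 h]; rewrite sm /=.
  by rewrite -modnMm ha hb hc.
apply: def_ex; apply: def_and; first exact: (df (fun i => (s i).+1)).
apply: def_ex; apply: def_and; first exact: (dg (fun i => (s i).+2)).
by apply: def_ex; apply: def_and; [exact: def_times|exact: def_mod].
Qed.

(* The count of all elements but one is below the domain size, hence is the
   value of a variable. *)
Lemma res_count n0 P : 1 < n0 -> definable1 n0 P ->
  res_def n0 (fun w e => fcount (P w e)).
Proof.
move=> n1 dP.
pose P' w (e : env w) (a : 'I_(dsize w)) := ~~ (a == 0 :> nat) && P w e a.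
have dP' : definable1 n0 P'.
  by apply: def_and => //; apply: def_not; apply: def_const.
pose Q w (e : env w) := fex (fun a : 'I_(dsize w) => (a == 0 :> nat) && P w e a).
have dQ : definable n0 Q.
  by apply: def_ex; apply: def_and => //; apply: def_const.
have split_count w (e : env w) : fcount (P w e) = fcount (P' w e) + Q w e.
  rewrite /Q; have -> : fex (fun a : 'I_(dsize w) => (a == 0 :> nat) && P w e a) =
     \sum_(a : 'I_(dsize w)) ((a == 0 :> nat) && P w e a) :> nat.
    rewrite -fcountE /fcount; apply/esym; rewrite /fex.
    case: existsP => [[a ha]|hn].
      apply/eqP/cards1P; exists a; apply/setP => b; rewrite !inE.
      apply/idP/eqP => [hb|->//]; apply: val_inj => /=.
      by case/andP: ha => /eqP-> _; case/andP: hb => /eqP-> _.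
    by apply/eqP; rewrite cards_eq0 -subset0; apply/subsetP => a; rewrite inE =>
      ha; case: hn; exists a.
  rewrite !fcountE -big_split; apply: eq_bigr => a _ /=.
  by rewrite /P'; case: (P w e a); case: (_ == 0).
have count_lt w (e : env w) : n0 <= dsize w -> fcount (P' w e) < dsize w.
  move=> nw; have n_gt0 : 0 < dsize w by lia.
  have : fcount (fun a : 'I_(dsize w) => ~~ (a == 0 :> nat)) < dsize w.
    rewrite -[X in _ < X]card_ord /fcount; apply: proper_card.
    by apply/properP; split; [apply/subsetP|exists (Ordinal n_gt0); rewrite ?inE].
  apply: leq_ltn_trans; apply: subset_leq_card; apply/subsetP => a.
  by rewrite !inE; case/andP.
apply: res_ext (fun w e _ => split_count w e) _.
apply: res_add; last exact: res_bool.
move=> s x y.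
apply: (@def_ext _ _ _ _ (fun w e => small_mod w (e x) && fex (fun v : 'I__ =>
   [&& ~~ (v < fcount (P' w (fun i => e (s i)))),
      fall (fun b : 'I__ => (b < v) ==> (b < fcount (P' w (fun i => e (s i))))) &
      (0 < e x) && (v %% e x == e y)]))).
  move=> w e nw; case sm: (small_mod _ _) => //=.
  have x0 : 0 < e x by case/andP: sm.
  have hc := count_lt w (fun i => e (s i)) nw; rewrite x0 /=.
  apply/idP/existsP => [h|[v /and3P[]]].
    exists (Ordinal hc) => /=; rewrite ltnn h andbT /=; apply/forallP => b.
    exact/implyP.
  rewrite -leqNgt => h1 /forallP h2; suff -> : v = Ordinal hc by [].
  apply: val_inj; apply/eqP; rewrite /= eqn_leq h1 andbT.
  case: leqP => // lt.
  by have := implyP (h2 (Ordinal hc)) lt; rewrite /= ltnn.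
have dP1 := def1_ren (fun i => (s i).+1) dP'.
have dP2 := def1_ren (fun i => (s i).+2) dP'.
apply: def_and; first exact: def_small_mod.
apply: def_ex; apply: def_and.
  by apply: def_not; exact: (def_count_gt 0 dP1).
apply: def_and; last exact: def_mod.
apply: def_all; apply: def_imp; first exact: def_lt.
exact: (def_count_gt 0 dP2).
Qed.

(** The identity [sum_mod_card] as a formula: [c] counts the terms with residue r, and [Y] holds for
    the elements y = r q + d counted by the identity. The inner count enters only modulo q, which
    keeps its product with r in the domain. *)
Lemma res_sum n0 (F : forall w : world, env w -> 'I_(dsize w) -> nat) : 1 < n0 ->
  res_def n0 (fun w e => F w (fun i => e i.+1) (e 0)) ->
  res_def n0 (fun w e => \sum_a F w e a).
Proof.
move=> n1 dF s x y.
pose c w (e : env w) q r := fcount (fun a : 'I_(dsize w) =>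
   small_mod w q && (F w e a %% q == r)).
pose Y w (e : env w) (q : 'I_(dsize w)) (y : 'I_(dsize w)) :=
  fex (fun r : 'I_(dsize w) => (r < q) && fex (fun t : 'I_(dsize w) => (r * q == t :> nat) &&
   fex (fun d : 'I_(dsize w) => ((t + d == y :> nat) && (d < q)) &&
    fex (fun g : 'I_(dsize w) => (small_mod w q && (c w e q r %% q == g)) &&
     fex (fun h : 'I_(dsize w) => (r * g == h :> nat) &&
      fex (fun l : 'I_(dsize w) => ((0 < q) && (h %% q == l)) && (d < l))))))).
have YE w (e : env w) (q z : 'I_(dsize w)) : small_mod w q ->
   Y w e q z = (z < q * q) && (z %% q < (z %/ q * c w e q (z %/ q)) %% q).
  move=> sm; have /andP[q0 qn] := sm; apply/existsP/andP.
    case=> r /andP[rq] /existsP[t] /andP[/eqP ht] /existsP[d] /andP[/andP[/eqP hd dq]].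
    case/existsP=> g /andP[/andP[_ /eqP hg]] /existsP[h] /andP[/eqP hh].
    case/existsP=> l /andP[/andP[_ /eqP hl] dl].
    rewrite -hd -ht divnMDl // divn_small // addn0 modnMDl (modn_small dq).
    split; first by nia.
    by rewrite -modnMmr hg hh hl.
  case=> zq h.
  have hr : z %/ q < q by rewrite ltn_divLR.
  have hr' := ltn_trans hr (ltn_ord q).
  have ht : z %/ q * q < dsize w by apply: leq_ltn_trans (leq_trunc_div _ _) (ltn_ord z).
  have hd : z %% q < q by rewrite ltn_mod.
  have hg : c w e q (z %/ q) %% q < q by rewrite ltn_mod.
  have /andP[_ hh] := small_mod_lt sm hr hg.
  exists (Ordinal hr'); rewrite hr; apply/existsP.
  exists (Ordinal ht); rewrite eqxx; apply/existsP.
  exists (Ordinal (ltn_trans hd (ltn_ord q))); rewrite /= -divn_eq eqxx hd; apply/existsP.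
  exists (Ordinal (ltn_trans hg (ltn_ord q))); rewrite sm eqxx; apply/existsP.
  exists (Ordinal hh); rewrite eqxx; apply/existsP.
  have hl : (z %/ q * (c w e q (z %/ q) %% q)) %% q < q by rewrite ltn_mod.
  exists (Ordinal (ltn_trans hl (ltn_ord q))); rewrite /= q0 eqxx.
  by rewrite modnMmr.
apply: (@def_ext _ _ _ _ (fun w e => small_mod w (e x) &&
   (fcount (Y w (fun i => e (s i)) (e x)) %% e x == e y))).
  move=> w e _; case sm: (small_mod _ _) => //=.
  have /andP[q0 qn] := sm; rewrite sum_mod_card //; congr (_ %% _ == _).
  apply: eq_card => z; rewrite !inE YE //; congr (_ && (_ < (_ * _) %% _)).
  by apply: eq_card => a; rewrite !inE sm.
suff dY : definable1 n0 (fun w e => Y w (fun i => e (s i)) (e x)).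
  exact: (res_count n1 dY id x y).
rewrite /definable1 /Y.
apply: def_ex; apply: def_and; first exact: def_lt.
apply: def_ex; apply: def_and; first exact: def_times.
apply: def_ex; apply: def_and.
  by apply: def_and; [exact: def_plus|exact: def_lt].
apply: def_ex; apply: def_and.
  pose P w (e : env w) (a : 'I_(dsize w)) := small_mod w (e x.+4.+1) &&
     (F w (fun i => e (s i).+4.+1) a %% e x.+4.+1 == e 3).
  have dP : definable1 n0 P.
    exact: (dF (up (fun i => (s i).+4.+1)) x.+4.+2 4).
  exact: (res_count n1 dP id x.+4.+1 0).
apply: def_ex; apply: def_and; first exact: def_times.
apply: def_ex; apply: def_and; last exact: def_lt.
exact: def_mod.
Qed.
End Residues.

(** * Arithmetic terms with bounded sums *)

Lemma sqrt_exists n : exists s, s * s <= n < s.+1 * s.+1.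
Proof.
elim: n => [|n [s /andP[h1 h2]]]; first by exists 0.
case: (leqP (s.+1 * s.+1) n.+1) => h; last by exists s; apply/andP; split; lia.
by exists s.+1; apply/andP; split; nia.
Qed.

(** Here k is about sqrt(n) / 2: all moduli up to 2k are small in the sense of [small_mod], and yet
    k bits suffice for numbers below n^D. *)
Lemma poly_lt_exp_sqrt D : exists n1, forall n, n1 <= n ->
  exists k, [/\ 0 < k, k.*2 * k.*2 <= n, k.*2 < n & n ^ D < 2 ^ k].
Proof.
(* For the integer square root s of n and b = s./2, n < 4 (b + 1)^2; so n^D is at most 4^D (b +
   1)^(2 D). *)
have [k0 hk0] := exp_dominates (4 ^ D) 1 (2 * D).
exists (4 * (k0 + 4) * (k0 + 4)) => n hn.
have [s /andP[h1 h2]] := sqrt_exists n.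
have sk : 2 * (k0 + 2) <= s by nia.
exists s./2; have E := odd_double_half s.
have b : (odd s : nat) <= 1 by case: odd.
have h3 : k0 + 2 <= s./2 by lia.
split; [lia | nia | nia |].
apply: leq_ltn_trans (hk0 s./2 _); last by lia.
rewrite expnM -expnMn; case: (D) => // d; rewrite leq_exp2r //; nia.
Qed.

Section Compile.
Variables (m : nat) (ar : 'I_m -> nat).
Local Notation world := (world ar).
Local Notation env := (@env m ar).

(** For large n the residues modulo the small q determine a number below n^D, by [residues_inj].
    This is the origin of the growing thresholds on the domain size. *)
Lemma res_eq n0 D (f g : forall w : world, env w -> nat) :
  (forall w e, n0 <= dsize w -> f w e < dsize w ^ D) ->
  (forall w e, n0 <= dsize w -> g w e < dsize w ^ D) ->
  res_def n0 f -> res_def n0 g ->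
  exists n1, n0 <= n1 /\ definable n1 (fun w e => f w e == g w e).
Proof.
move=> hf hg df dg; have [n2 hn2] := poly_lt_exp_sqrt D.
exists (maxn n0 n2); split; first exact: leq_maxl.
apply: (@def_ext _ _ _ _ (fun w e => fall (fun q : 'I_(dsize w) =>
   small_mod w q ==> fex (fun r : 'I_(dsize w) =>
    (small_mod w q && (f w e %% q == r)) && (small_mod w q && (g w e %% q == r)))))).
  move=> w e; rewrite geq_max => /andP[w0 w2]; apply/eqP/forallP.
    move=> fg q; apply/implyP => sm; apply/existsP.
    have /andP[q0 _] := sm; have h := ltn_trans (ltn_pmod (f w e) q0) (ltn_ord q).
    by exists (Ordinal h); rewrite sm -fg /= eqxx.
  move=> H; have [k [k0 k1 kn hk]] := hn2 _ w2.
  apply: (residues_inj k0); [exact: ltn_trans (hf _ _ w0) hk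
    |exact: ltn_trans (hg _ _ w0) hk|move=> q q0 qk].
  have qn := leq_ltn_trans qk kn.
  have /implyP/= := H (Ordinal qn); rewrite /small_mod /= q0 /=.
  rewrite (leq_trans (leq_mul qk qk) k1) => /(_ isT)/existsP[r].
  by case/andP=> /eqP-> /eqP->.
apply: (@def_mono _ _ n0); first exact: leq_maxl.
apply: def_all; apply: def_imp; first exact: def_small_mod.
apply: def_ex; apply: def_and; first exact: (df (fun i => i.+2) 1 0).
exact: (dg (fun i => i.+2) 1 0).
Qed.

Lemma res_const n0 c : 1 < n0 -> res_def n0 (fun (w : world) e => c).
Proof.
move=> n1; elim: c => [|c IH]; first exact: (res_bool n1 (@def_bool _ _ _ false)).
apply: (@res_ext _ _ _ _ (fun w e => c + true)); first by move=> *; rewrite addn1.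
by apply: res_add => //; apply: res_bool => //; apply: def_bool.
Qed.

Lemma res_size n0 : 1 < n0 -> res_def n0 (fun (w : world) e => dsize w).
Proof.
move=> n1; apply: (@res_ext _ _ _ _ (fun w e => \sum_(a : 'I_(dsize w)) 1)).
  by move=> w e _; rewrite sum_nat_const card_ord muln1.
by apply: res_sum => //; apply: res_const.
Qed.

(** Base-n digits, least significant first: a number of polynomial size is carried by several
    first-order variables. *)
Definition digs (w : world) (e : env w) (l : seq nat) : nat :=
  foldr (fun i acc => e i + dsize w * acc) 0 l.

Lemma digs_ltn w (e : env w) l : digs e l < dsize w ^ size l.
Proof.
elim: l => //= i l IH; rewrite expnS; have := ltn_ord (e i); nia.
Qed.

Lemma digs_rcons w (e : env w) l i :
  digs e (rcons l i) = digs e l + dsize w ^ size l * e i.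
Proof. by elim: l => /= [|j l ->]; rewrite ?expnS; lia. Qed.

Lemma digs_map w (e : env w) (t : nat -> nat) l :
  digs (fun i => e (t i)) l = digs e (map t l).
Proof. by elim: l => //= i l ->. Qed.

Lemma res_digs n0 l : 1 < n0 -> res_def n0 (fun (w : world) e => digs e l).
Proof.
move=> n1; elim: l => /= [|i l IH]; first exact: res_const.
by apply: res_add; [apply: res_var|apply: res_mul => //; apply: res_size].
Qed.

Fixpoint exn D (P : forall w : world, env w -> bool) (w : world) (e : env w) : bool :=
  if D is D'.+1 then fex (fun a => exn D' P (scons a e)) else P w e.

Lemma scons_eta T (e : nat -> T) : scons (e 0) (fun i => e i.+1) = e.
Proof. by apply: functional_extensionality => -[]. Qed.

Lemma def_exn n0 D P : definable n0 P -> definable n0 (fun w e => exn D P e).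
Proof.
move=> dP; elim: D => //= D IH; apply: def_ex.
by apply: def_ext IH => w e _; rewrite scons_eta.
Qed.

Lemma exnP D (P : forall w : world, env w -> bool) w (e : env w) :
  reflect (exists e' : env w, (forall i, e' (i + D) = e i) /\ P w e') (exn D P e).
Proof.
elim: D e => [|D IH] e /=.
  apply: (iffP idP) => [h|[e' [h]]]; first by exists e; split=> // i; rewrite addn0.
  suff -> : e' = e by []; apply: functional_extensionality => i.
  by rewrite -h addn0.
apply: (iffP existsP) => [[a /IH[e' [h1 h2]]]|[e' [h1 h2]]].
  by exists e'; split=> // i; rewrite addnS -addSn h1.
by exists (e' D); apply/IH; exists e'; split=> // -[|i] //=; rewrite -h1 addSnnS.
Qed.

Fixpoint sumd D (F : forall w : world, env w -> nat) (w : world) (e : env w) : nat :=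
  if D is D'.+1 then \sum_a sumd D' F (scons a e) else F w e.

Lemma res_sumd n0 D F : 1 < n0 -> res_def n0 F -> res_def n0 (fun w e => sumd D F e).
Proof.
move=> n1 dF; elim: D => //= D IH; apply: res_sum => //.
by apply: res_ext IH => w e _; rewrite scons_eta.
Qed.

Lemma sumdE D (F : forall w : world, env w -> nat) w (e : env w) (G : nat -> nat) :
  (forall e' : env w, (forall i, e' (i + D) = e i) ->
     F w e' = G (digs e' (iota 0 D))) ->
  sumd D F e = \sum_(v < dsize w ^ D) G v.
Proof.
elim: D e G => [|D IH] e G h.
  by rewrite /= (h e) ?big_ord1 // => i; rewrite addn0.
rewrite /= expnS sum_ord_mul; apply: eq_bigr => a _.
rewrite (IH _ (fun v => G (v + dsize w ^ D * a))).
  by apply: eq_bigr => v _; congr (G _); lia.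
move=> e' he; rewrite (h e') => [|i]; last by rewrite addnS -addSn he.
rewrite -[D.+1]addn1 iotaD cats1 digs_rcons size_iota add0n.
by have := he 0; rewrite add0n /= => ->.
Qed.

Lemma digits_exist w (e : env w) D v : v < dsize w ^ D ->
  exists e' : env w, (forall i, e' (i + D) = e i) /\ digs e' (iota 0 D) = v.
Proof.
elim: D e v => [|D IH] e v.
  by rewrite expn0 ltnS leqn0 => /eqP->; exists e; split=> // i; rewrite addn0.
have n0 : 0 < dsize w by apply: leq_ltn_trans (ltn_ord (e 0)).
have nD : 0 < dsize w ^ D by rewrite expn_gt0 n0.
rewrite expnS => hv; have ha : v %/ dsize w ^ D < dsize w by rewrite ltn_divLR.
have [e' [h1 h2]] := IH (scons (Ordinal ha) e) _ (ltn_pmod v nD).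
exists e'; split=> [i|]; first by rewrite addnS -addSn h1.
rewrite -[D.+1]addn1 iotaD cats1 digs_rcons h2 size_iota add0n.
have := h1 0; rewrite add0n /= => ->; rewrite /= [RHS](divn_eq v (dsize w ^ D)); lia.
Qed.

(** The difference of the two values is guessed through its D digits, which turns the comparison
    into an equality. The sum in it may need one digit more. *)
Lemma res_le n0 D (f g : forall w : world, env w -> nat) : 1 < n0 ->
  (forall w e, n0 <= dsize w -> f w e < dsize w ^ D) ->
  (forall w e, n0 <= dsize w -> g w e < dsize w ^ D) ->
  res_def n0 f -> res_def n0 g ->
  exists n1, n0 <= n1 /\ definable n1 (fun w e => f w e <= g w e).
Proof.
move=> n01 hf hg df dg.
have [n1 [n0n1 h]] : exists n1, n0 <= n1 /\ definable n1 (fun w e =>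
    f w (fun i => e (i + D)) + digs e (iota 0 D) == g w (fun i => e (i + D))).
  apply: (@res_eq n0 D.+1).
  - move=> w e w0; rewrite expnS; have := hf w (fun i => e (i + D)) w0.
    by have := digs_ltn e (iota 0 D); rewrite size_iota; nia.
  - move=> w e w0; rewrite expnS; have := hg w (fun i => e (i + D)) w0.
    by set x := g _ _; set y := _ ^ D; nia.
  - by apply: res_add; [apply: (res_ren (fun i => i + D))|apply: res_digs].
  - exact: (res_ren (fun i => i + D)).
exists n1; split=> //; apply: def_ext (def_exn D h) => w e w1.
have w0 := leq_trans n0n1 w1.
apply/idP/exnP => [le|[e' [h1 /eqP h2]]].
  have hv : g w e - f w e < dsize w ^ D by apply: leq_ltn_trans (leq_subr _ _) (hg _ _ w0).
  have [e' [h1 h2]] := digits_exist e hv; exists e'; split=> //.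
  have -> : (fun i => e' (i + D)) = e by apply: functional_extensionality.
  by rewrite h2 subnKC.
have E : (fun i => e' (i + D)) = e by apply: functional_extensionality.
by rewrite E in h2; rewrite -h2 leq_addr.
Qed.

(** Variables of terms stand for numbers, not for domain elements; the index of a [TSum] ranges
    below a value that may exceed n. [TEdge] and [TAux] have value 0 at arguments outside the
    domain. *)
Inductive tm : Type :=
| TVar of nat
| TSize
| TOne
| TAdd of tm & tm
| TMul of tm & tm
| TLe of tm & tm
| TSum of tm & tm
| TEdge of tm & tm
| TAux (R : 'I_m) of ('I_(ar R) -> tm).

Definition edge_val (w : world) (x y : nat) : bool :=
  [exists a : 'I_(dsize w), exists b : 'I_(dsize w),
     [&& a == x :> nat, b == y :> nat & (a, b) \in wE w]].

Definition aux_val (w : world) (R : 'I_m) (x : 'I_(ar R) -> nat) : bool :=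
  [exists v : (ar R).-tuple 'I_(dsize w),
     [forall i, tnth v i == x i :> nat] && (v \in wA w R)].

Fixpoint eval (w : world) (e : nat -> nat) (t : tm) : nat :=
  match t with
  | TVar i => e i
  | TSize => dsize w
  | TOne => 1
  | TAdd s t => eval w e s + eval w e t
  | TMul s t => eval w e s * eval w e t
  | TLe s t => eval w e s <= eval w e t
  | TSum b s => \sum_(i < eval w e b) eval w (scons (i : nat) e) s
  | TEdge s t => edge_val w (eval w e s) (eval w e t)
  | TAux R ts => aux_val w (fun i : 'I_(ar R) => eval w e (ts i))
  end.

Definition denv (rho : nat -> seq nat) w (e : env w) : nat -> nat :=
  fun i => digs e (rho i).

(** The polynomial bound is carried along because residues determine a value only below such a
    bound. *)
Definition compiles_at (n0 D : nat) (f : forall w : world, env w -> nat) :=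
  [/\ 1 < n0, forall w e, n0 <= dsize w -> f w e < dsize w ^ D & res_def n0 f].

Lemma compiles_mono n0 D f n1 D1 : n0 <= n1 -> D <= D1 ->
  compiles_at n0 D f -> compiles_at n1 D1 f.
Proof.
move=> hn hD [h1 h2 h3]; split; first exact: leq_trans hn.
  move=> w e hw; have h := leq_trans hn hw; apply: leq_trans (h2 w e h) _.
  by apply: leq_pexp2l => //; lia.
exact: res_mono h3.
Qed.

Lemma compiles_bool n0 P : definable n0 P ->
  exists n1 D, compiles_at n1 D (fun w e => P w e).
Proof.
move=> dP; exists (maxn n0 2), 1; split; first by rewrite leq_max orbT.
  by move=> w e; rewrite geq_max expn1 => /andP[_]; case: (P w e); lia.
by apply: res_bool; [rewrite leq_max orbT|apply: def_mono dP; rewrite leq_maxl].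
Qed.

Lemma def_forall_ord n0 k (P : 'I_k -> forall w : world, env w -> bool) :
  (forall i, definable n0 (P i)) -> definable n0 (fun w e => [forall i, P i w e]).
Proof.
elim: k P => [|k IH] P dP.
  apply: def_ext (@def_bool _ _ n0 true) => w e _.
  by apply/forallP => -[].
apply: def_ext (def_and (dP ord0) (IH (fun i => P (lift ord0 i)) (fun i => dP _))).
move=> w e _; apply/forallP/andP => [h|[h0 /forallP h] i].
  by split=> //; apply/forallP => i.
by case: (unliftP ord0 i) => [j|] ->.
Qed.

Lemma compiles_eq n0 D f g n1 D1 : compiles_at n0 D f -> compiles_at n1 D1 g ->
  exists n2, definable n2 (fun w e => f w e == g w e).
Proof.
move=> cf cg.
have [h1 h2 h3] := compiles_mono (leq_maxl n0 n1) (leq_maxl D D1) cf.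
have [_ h5 h6] := compiles_mono (leq_maxr n0 n1) (leq_maxr D D1) cg.
by have [n2 [_ ?]] := res_eq h2 h5 h3 h6; exists n2.
Qed.

Lemma compiles_le n0 D f g n1 D1 : compiles_at n0 D f -> compiles_at n1 D1 g ->
  exists n2, definable n2 (fun w e => f w e <= g w e).
Proof.
move=> cf cg.
have [h1 h2 h3] := compiles_mono (leq_maxl n0 n1) (leq_maxl D D1) cf.
have [_ h5 h6] := compiles_mono (leq_maxr n0 n1) (leq_maxr D D1) cg.
by have [n2 [_ ?]] := res_le h1 h2 h5 h3 h6; exists n2.
Qed.

Lemma compiles_var n0 x : 1 < n0 -> compiles_at n0 1 (fun (w : world) e => e x).
Proof. by move=> n1; split=> //; apply: res_var. Qed.

(** [rho] assigns to each term variable the formula variables that hold its digits. It varies in the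
    induction, since a sum adds digits for its index and shifts all others. *)
Lemma compile_tm (t : tm) (rho : nat -> seq nat) :
  exists n0 D, compiles_at n0 D (fun w e => eval w (denv rho e) t).
Proof.
elim: t rho => [i|||s IHs t IHt|s IHs t IHt|s IHs t IHt|b IHb s IHs|s IHs t IHt|R ts IH] rho /=.
- exists 2, (size (rho i)); split=> // [w e _|]; first exact: digs_ltn.
  exact: res_digs.
- exists 2, 2; split=> // [w e hw|]; last exact: res_size.
  by rewrite -[X in X < _]expn1 ltn_exp2l.
- by exists 2, 1; split=> //; apply: res_const.
- have [n0 [D cs]] := IHs rho; have [n1 [D1 ct]] := IHt rho.
  have [h1 h2 h3] := compiles_mono (leq_maxl n0 n1) (leq_maxl D D1) cs.
  have [_ h5 h6] := compiles_mono (leq_maxr n0 n1) (leq_maxr D D1) ct.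
  exists (maxn n0 n1), (maxn D D1).+1; split=> // [w e hw|]; last exact: res_add.
  have := h2 w e hw; have := h5 w e hw; rewrite expnS; set x := _ ^ _; nia.
- have [n0 [D cs]] := IHs rho; have [n1 [D1 ct]] := IHt rho.
  have [h1 h2 h3] := compiles_mono (leq_maxl n0 n1) (leq_maxl D D1) cs.
  have [_ h5 h6] := compiles_mono (leq_maxr n0 n1) (leq_maxr D D1) ct.
  exists (maxn n0 n1), (maxn D D1 + maxn D D1); split=> // [w e hw|]; last exact: res_mul.
  by rewrite expnD ltn_mul ?h2 ?h5.
- have [n0 [D cs]] := IHs rho; have [n1 [D1 ct]] := IHt rho.
  by have [n2 h] := compiles_le cs ct; apply: compiles_bool h.
- have [nb [Db cb]] := IHb rho.
  pose shift i := i + Db.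
  pose rho' := scons (iota 0 Db) (fun i => map shift (rho i)).
  have [ns [Ds cs]] := IHs rho'.
  have [nb' [Db' cb']] := IHb (fun i => map shift (rho i)).
  have denv_shift w (e : env w) : denv (fun i => map shift (rho i)) e =
      denv rho (fun i => e (shift i)).
    apply: functional_extensionality => i; exact/esym/digs_map.
  have c1 : compiles_at 2 Db (fun w (e : env w) => digs e (iota 0 Db)).
    split=> // [w e _|]; last exact: res_digs.
    by have := digs_ltn e (iota 0 Db); rewrite size_iota.
  have [n2 h2] := compiles_le cb' c1.
  have dlt := def_not h2.
  have [n3 [D3 c3]] := compiles_bool dlt.
  pose N := maxn nb (maxn ns n3).
  exists N, (Db + Ds); split.
  + by rewrite leq_max; case: cb => ->.
  + move=> w e hw; rewrite expnD.
    have /and3P[hb hs h3] : [&& nb <= dsize w, ns <= dsize w & n3 <= dsize w].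
      by move: hw; rewrite /N !geq_max.
    have [_ bb _] := cb; have [_ bs _] := cs; have {bb} bb := bb w e hb.
    set B := eval w _ b in bb *.
    apply: (@leq_ltn_trans (B * (dsize w ^ Ds).-1)); last first.
      have : 0 < dsize w ^ Ds by rewrite expn_gt0; case: cs => *; lia.
      by set x := _ ^ Ds; set y := _ ^ Db in bb *; nia.
    rewrite -[B in B * _]card_ord -sum_nat_const; apply: leq_sum => i _.
    have [e' [h1 h4]] := digits_exist e (ltn_trans (ltn_ord i) bb).
    have := bs w e' hs; have -> : denv rho' e' = scons (i : nat) (denv rho e).
      apply: functional_extensionality => -[|j] //=.
      rewrite /denv /= -digs_map; congr (digs _ _).
      exact: functional_extensionality.
    by rewrite -ltnS; set x := _ ^ _; case: x.
  + have [_ _ rs] := cs; have [n31 _ r3] := c3.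
    have N1 : 1 < N by rewrite !leq_max n31 !orbT.
    have nsN : ns <= N by rewrite !leq_max leqnn ?orbT.
    have n3N : n3 <= N by rewrite !leq_max leqnn ?orbT.
    (* The sum runs over all numbers with Db digits; the first factor of the product, the negated
       comparison [dlt], cuts it off at the bound. *)
    apply: res_ext (res_sumd Db N1 (res_mul (res_mono n3N r3) (res_mono nsN rs))).
    move=> w e hw; have [_ bb _] := cb.
    have hb : nb <= dsize w by apply: leq_trans hw; apply: leq_maxl.
    have {bb} bb := bb w e hb.
    pose G v := (v < eval w (denv rho e) b) * eval w (scons v (denv rho e)) s.
    rewrite (@sumdE _ _ w e G) => [|e' he].
      rewrite (big_ord_widen _ (fun i => eval w (scons i (denv rho e)) s) (ltnW bb)).
      rewrite big_mkcond; apply: eq_bigr => v _; rewrite /G.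
      by case: ltnP; rewrite ?mul1n.
    have Ee : (fun i => e' (shift i)) = e by apply: functional_extensionality.
    rewrite /G -ltnNge denv_shift Ee; congr (_ * eval _ _ _).
    apply: functional_extensionality => -[|j] //=.
    by rewrite /denv /= -digs_map Ee.
- have [ns [Ds cs]] := IHs (fun i => map (fun j => j + 2) (rho i)).
  have [nt [Dt ct]] := IHt (fun i => map (fun j => j + 2) (rho i)).
  have [n1 h1] := compiles_eq (compiles_var 0 (isT : 1 < 2)) cs.
  have [n2 h2] := compiles_eq (compiles_var 1 (isT : 1 < 2)) ct.
  pose N := maxn n1 n2.
  have h3 := def_and (def_mono (leq_maxl _ _ : n1 <= N) h1)
     (def_and (def_mono (leq_maxr _ _ : n2 <= N) h2) (def_edge ar N 0 1)).
  apply: (@compiles_bool N); apply: def_ext (def_exn 2 h3) => w e hw.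
  have dshift (e' : env w) : (forall i, e' (i + 2) = e i) ->
      denv (fun i => map (fun j => j + 2) (rho i)) e' = denv rho e.
    move=> he; apply: functional_extensionality => i; rewrite /denv -digs_map.
    by congr (digs _ _); apply: functional_extensionality.
  apply/existsP/exnP => [[a /existsP[b hab]]|[e' [he]]].
    have he : forall i, scons a (scons b e) (i + 2) = e i by move=> i; rewrite addn2.
    by exists (scons a (scons b e)); split=> //; rewrite dshift.
  by rewrite dshift // => h; exists (e' 0); apply/existsP; exists (e' 1).
- pose rho' i := map (fun j => j + ar R) (rho i).
  have H (i : 'I_(ar R)) : exists n, definable n (fun w (e : env w) =>
      e i == eval w (denv rho' e) (ts i) :> nat).
    have [n0 [D c]] := IH i rho'.
    exact: compiles_eq (compiles_var i (isT : 1 < 2)) c.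
  have [nf hnf] := fin_all_exists H.
  pose N := \max_i nf i.
  have h1 : definable N (fun w (e : env w) => [forall i : 'I_(ar R),
      e i == eval w (denv rho' e) (ts i) :> nat]).
    by apply: def_forall_ord => i; apply: def_mono (hnf i); apply: leq_bigmax.
  have h2 := def_and h1 (@def_aux _ _ N R (fun i => i)).
  apply: (@compiles_bool N); apply: def_ext (def_exn (ar R) h2) => w e hw.
  have dshift (e' : env w) : (forall i, e' (i + ar R) = e i) ->
      denv rho' e' = denv rho e.
    move=> he; apply: functional_extensionality => i; rewrite /denv -digs_map.
    by congr (digs _ _); apply: functional_extensionality.
  apply/existsP/exnP => [[v /andP[/forallP h3 h4]]|[e' [he /andP[/forallP h3 h4]]]].
    pose e' i := if insub i is Some j then tnth v j else e (i - ar R).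
    have he : forall i, e' (i + ar R) = e i.
      by move=> i; rewrite /e' insubF ?addnK // ltnNge leq_addl.
    have e'v (i : 'I_(ar R)) : e' i = tnth v i by rewrite /e' valK.
    exists e'; split=> //; rewrite dshift //; apply/andP; split.
      by apply/forallP => i; rewrite e'v.
    suff -> : [tuple e' i | i < ar R] = v by [].
    by apply: eq_from_tnth => i; rewrite tnth_mktuple.
  exists [tuple e' i | i < ar R]; rewrite h4 andbT; apply/forallP => i.
  by rewrite tnth_mktuple -(dshift e').
Qed.

Lemma compile_formula (t : tm) (k : nat) : exists n0 (phi : formula ar k.+1),
  forall w (v : k.+1.-tuple 'I_(dsize w)), n0 <= dsize w ->
    holds (wE w) (wA w) phi v = (0 < eval w (fun i => nth 0 (map val v) i) t).
Proof.
pose s i := minn i k.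
(* An empty digit list has value 0, the default of [nth] beyond the end of the tuple. *)
pose rho i := if i < k.+1 then [:: i] else [::].
have [n0 [D c]] := compile_tm t rho.
have c1 : compiles_at 2 1 (fun (w : world) e => 1).
  by split=> //; apply: res_const.
have [n1 h1] := compiles_le c1 c.
have hs i : s i < k.+1 by rewrite ltnS geq_minr.
have [phi hphi] := h1 s k.+1 hs.
exists n1, phi => w v hw.
pose e i := nth (thead v) v i.
have vE : v = etup k.+1 e.
  by apply: eq_from_tnth => i; rewrite tnth_mktuple /e -tnth_nth.
rewrite [in LHS]vE hphi //; congr (_ < eval _ _ _).
apply: functional_extensionality => i; rewrite /denv /rho.
case: (ltnP i k.+1) => hi; last by rewrite nth_default // size_map size_tuple.
rewrite (nth_map (thead v)) ?size_tuple //= muln0 addn0.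
by have -> : s i = i by apply/minn_idPl.
Qed.
End Compile.

(** * Functions defined by terms *)

Definition bsum (b : nat) (F : nat -> nat) := \sum_(i < b) F i.
Definition bex (b : nat) (P : nat -> bool) := has P (iota 0 b).
Definition ball (b : nat) (P : nat -> bool) := all P (iota 0 b).
(* The least i < b with P i, and b if there is none. *)
Definition bmin (b : nat) (P : nat -> bool) := bsum b (fun i => ball i.+1 (fun j => ~~ P j)).

Lemma bexP b (P : nat -> bool) : reflect (exists2 i, i < b & P i) (bex b P).
Proof. by apply: (iffP hasP) => -[i hi Pi]; exists i => //; move: hi; rewrite mem_iota. Qed.

Lemma ballP b (P : nat -> bool) : reflect (forall i, i < b -> P i) (ball b P).
Proof.
apply: (iffP allP) => h i; last by rewrite mem_iota; apply: h.
by move=> ib; apply: h; rewrite mem_iota.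
Qed.

Lemma bsumS b F : bsum b.+1 F = bsum b F + F b.
Proof. exact: big_ord_recr. Qed.

Lemma bsum0 F : bsum 0 F = 0.
Proof. exact: big_ord0. Qed.

Lemma eq_bsum b F G : (forall i, i < b -> F i = G i) -> bsum b F = bsum b G.
Proof. by move=> h; apply: eq_bigr => i _; apply: h. Qed.

Lemma bmin_spec b (P : nat -> bool) i : i < b -> P i -> (forall j, j < i -> ~~ P j) -> bmin b P = i.
Proof.
move=> ib Pi min; have aux c : c <= b -> bmin c P = minn c i.
  elim: c => [|c IH] cb; first by rewrite /bmin bsum0 min0n.
  have -> : bmin c.+1 P = bmin c P + ball c.+1 (fun j => ~~ P j) by apply: bsumS.
  rewrite (IH (ltnW cb)).
  case: (ltnP c i) => ci.
    have -> : ball c.+1 (fun j => ~~ P j) by apply/ballP => j jc; apply: min; lia.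
    by lia.
  have -> : ball c.+1 (fun j => ~~ P j) = false.
    by apply/negP => /ballP/(_ i ci); rewrite Pi.
  by lia.
by rewrite aux //; lia.
Qed.

Lemma bminP b (P : nat -> bool) : (exists2 i, i < b & P i) ->
  [/\ bmin b P < b, P (bmin b P) & forall j, j < bmin b P -> ~~ P j].
Proof.
case=> i ib Pi; have ex : exists i, P i by exists i.
case: (ex_minnP ex) => j Pj min.
have jb : j < b by apply: leq_ltn_trans (min _ Pi) ib.
have np l : l < j -> ~~ P l by move=> lj; apply/negP => /min; rewrite leqNgt lj.
by rewrite (bmin_spec jb Pj np).
Qed.

(** * Closure properties of term-definable functions *)

Section TermClass.
Variables (m : nat) (ar : 'I_m -> nat).
Local Notation world := (world ar).
Local Notation tm := (tm ar).
Local Notation nenv := (nat -> nat).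

(** Stated through values, so that no term has to be written down: the closure lemmas and the tactic
    [tm] find it from the shape of the function. *)
Definition Tm (f : world -> nenv -> nat) := exists t : tm, forall w e, eval w e t = f w e.

Fixpoint tren (s : nat -> nat) (t : tm) : tm :=
  match t with
  | TVar i => TVar _ (s i)
  | TSize => TSize _
  | TOne => TOne _
  | TAdd t u => TAdd (tren s t) (tren s u)
  | TMul t u => TMul (tren s t) (tren s u)
  | TLe t u => TLe (tren s t) (tren s u)
  | TSum t u => TSum (tren s t) (tren (up s) u)
  | TEdge t u => TEdge (tren s t) (tren s u)
  | TAux R ts => @TAux _ _ R (fun i => tren s (ts i))
  end.

Lemma eval_tren w t s e : eval w e (tren s t) = eval w (fun i => e (s i)) t.
Proof.
elim: t s e => [i|||t IHt u IHu|t IHt u IHu|t IHt u IHu|t IHt u IHu|t IHt u IHu|R ts IH] s e //=;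
  rewrite ?IHt ?IHu //.
  apply: eq_bigr => i _; rewrite IHu; congr (eval _ _ _).
  by apply: functional_extensionality => -[].
by congr (nat_of_bool (aux_val w _)); apply: functional_extensionality.
Qed.

Lemma tm_ren f (s : nat -> nat) : Tm f -> Tm (fun w e => f w (fun i => e (s i))).
Proof. by case=> t ht; exists (tren s t) => w e; rewrite eval_tren ht. Qed.

Lemma tm_ext f g : (forall w e, f w e = g w e) -> Tm g -> Tm f.
Proof. by move=> fg [t ht]; exists t => w e; rewrite fg. Qed.

Lemma tm_var i : Tm (fun w e => e i).
Proof. by exists (TVar _ i). Qed.

Lemma tm_size : Tm (fun w e => dsize w).
Proof. by exists (TSize _). Qed.

Lemma tm_add f g : Tm f -> Tm g -> Tm (fun w e => f w e + g w e).
Proof. by move=> [s hs] [t ht]; exists (TAdd s t) => w e; rewrite /= hs ht. Qed.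

Lemma tm_mul f g : Tm f -> Tm g -> Tm (fun w e => f w e * g w e).
Proof. by move=> [s hs] [t ht]; exists (TMul s t) => w e; rewrite /= hs ht. Qed.

Lemma tm_le f g : Tm f -> Tm g -> Tm (fun w e => f w e <= g w e).
Proof. by move=> [s hs] [t ht]; exists (TLe s t) => w e; rewrite /= hs ht. Qed.

Lemma tm_const c : Tm (fun w e => c).
Proof.
elim: c => [|c [t ht]]; first by exists (TLe (TAdd (TOne _) (TOne _)) (TOne _)).
by exists (TAdd (TOne _) t) => w e; rewrite /= ht.
Qed.

Lemma tm_S f : Tm f -> Tm (fun w e => (f w e).+1).
Proof. by move=> hf; apply: tm_ext (tm_add (tm_const 1) hf). Qed.

Lemma tm_bsum b (F : world -> nenv -> nat -> nat) : Tm b ->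
  Tm (fun w e => F w (fun i => e i.+1) (e 0)) -> Tm (fun w e => bsum (b w e) (F w e)).
Proof.
move=> [t ht] [s hs]; exists (TSum t s) => w e /=; rewrite ht.
by apply: eq_bigr => i _; rewrite hs.
Qed.

Lemma tm_edge f g : Tm f -> Tm g -> Tm (fun w e => edge_val w (f w e) (g w e)).
Proof. by move=> [s hs] [t ht]; exists (TEdge s t) => w e; rewrite /= hs ht. Qed.

Lemma tm_aux R (f : 'I_(ar R) -> world -> nenv -> nat) : (forall i, Tm (f i)) ->
  Tm (fun w e => aux_val w (fun i => f i w e)).
Proof.
move=> /fin_all_exists[t ht]; exists (@TAux _ _ R t) => w e /=.
by congr (nat_of_bool (aux_val w _)); apply: functional_extensionality => i.
Qed.

Lemma tm_not P : Tm (fun w e => P w e : bool) -> Tm (fun w e => ~~ P w e).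
Proof.
by move=> hP; apply: tm_ext (tm_le hP (tm_const 0)) => w e; case: (P w e).
Qed.

Lemma tm_and P Q : Tm (fun w e => P w e : bool) -> Tm (fun w e => Q w e : bool) ->
  Tm (fun w e => P w e && Q w e).
Proof.
by move=> hP hQ; apply: tm_ext (tm_mul hP hQ) => w e; case: (P w e); case: (Q w e).
Qed.

Lemma tm_or P Q : Tm (fun w e => P w e : bool) -> Tm (fun w e => Q w e : bool) ->
  Tm (fun w e => P w e || Q w e).
Proof.
move=> hP hQ; apply: tm_ext (tm_not (tm_and (tm_not hP) (tm_not hQ))) => w e.
by case: (P w e); case: (Q w e).
Qed.

Lemma tm_imp P Q : Tm (fun w e => P w e : bool) -> Tm (fun w e => Q w e : bool) ->
  Tm (fun w e => P w e ==> Q w e).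
Proof.
move=> hP hQ; apply: tm_ext (tm_or (tm_not hP) hQ) => w e.
by case: (P w e); case: (Q w e).
Qed.

Lemma tm_eq f g : Tm f -> Tm g -> Tm (fun w e => f w e == g w e).
Proof.
move=> hf hg; apply: tm_ext (tm_and (tm_le hf hg) (tm_le hg hf)) => w e.
by rewrite eqn_leq.
Qed.

Lemma tm_if P f g : Tm (fun w e => P w e : bool) -> Tm f -> Tm g ->
  Tm (fun w e => if P w e then f w e else g w e).
Proof.
move=> hP hf hg; apply: tm_ext (tm_add (tm_mul hP hf) (tm_mul (tm_not hP) hg)) => w e.
by case: (P w e); rewrite ?mul1n ?mul0n ?addn0.
Qed.

Lemma tm_bex b (P : world -> nenv -> nat -> bool) : Tm b ->
  Tm (fun w e => P w (fun i => e i.+1) (e 0)) -> Tm (fun w e => bex (b w e) (P w e)).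
Proof.
move=> hb hP; apply: tm_ext (tm_le (tm_const 1) (@tm_bsum b (fun w e i => P w e i) hb hP)) => w e.
congr nat_of_bool; apply/bexP/idP => [[i ib Pi]|].
  by rewrite /bsum (bigD1 (Ordinal ib)) //= Pi.
rewrite lt0n /bsum sum_nat_eq0 => /forallPn[i].
by rewrite eqb0 negbK => Pi; exists i.
Qed.

Lemma tm_ball b (P : world -> nenv -> nat -> bool) : Tm b ->
  Tm (fun w e => P w (fun i => e i.+1) (e 0)) -> Tm (fun w e => ball (b w e) (P w e)).
Proof.
move=> hb hP.
apply: tm_ext (tm_not (@tm_bex b (fun w e i => ~~ P w e i) hb (tm_not hP))) => w e.
by congr nat_of_bool; rewrite /ball /bex -all_predC; apply: eq_all => i /=; rewrite negbK.
Qed.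

Lemma tm_bmin b (P : world -> nenv -> nat -> bool) : Tm b ->
  Tm (fun w e => P w (fun i => e i.+1) (e 0)) -> Tm (fun w e => bmin (b w e) (P w e)).
Proof.
move=> hb hP; apply: tm_bsum => //.
apply: (@tm_ball (fun w e => (e 0).+1) (fun w e j => ~~ P w (fun i => e i.+1) j)).
  exact/tm_S/tm_var.
exact: (tm_ren (up S) (tm_not hP)).
Qed.

Lemma tm_sub f g : Tm f -> Tm g -> Tm (fun w e => f w e - g w e).
Proof.
move=> hf hg.
apply: tm_ext (@tm_bsum f (fun w e i => g w e <= i) hf _) => [w e|].
  by rewrite /bsum; elim: (f w e) => [|x IH]; rewrite ?big_ord0 ?big_ord_recr //= -IH; lia.
by apply: tm_le; [apply: (tm_ren S)|apply: tm_var].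
Qed.

Lemma tm_pred f : Tm f -> Tm (fun w e => (f w e).-1).
Proof. by move=> hf; apply: tm_ext (tm_sub hf (tm_const 1)) => w e; rewrite subn1. Qed.

Lemma tm_div f g : Tm f -> Tm g -> Tm (fun w e => f w e %/ g w e).
Proof.
move=> hf hg.
(* The quotient counts the positive multiples of g up to f; the guard gives the value 0 for g =
   0. *)
apply: tm_ext (@tm_bsum f (fun w e i => (0 < g w e) && (i.+1 * g w e <= f w e)) hf _) => [w e|].
  case: (posnP (g w e)) => g0; first by rewrite g0 divn0 /bsum big1.
  rewrite (@eq_bsum _ _ (fun i => i < f w e %/ g w e)) => [|i _].
    by rewrite /bsum sum_ord_ltn; apply/esym/minn_idPl/leq_div.
  by rewrite /= leq_divRL.
apply: tm_and; first by apply: tm_le; [apply: tm_const|apply: (tm_ren S)].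
apply: tm_le; last exact: (tm_ren S).
by apply: tm_mul; [apply: tm_S; apply: tm_var|apply: (tm_ren S)].
Qed.

Lemma tm_mod f g : Tm f -> Tm g -> Tm (fun w e => f w e %% g w e).
Proof.
move=> hf hg; apply: tm_ext (tm_sub hf (tm_mul (tm_div hf hg) hg)) => w e.
by rewrite {2}(divn_eq (f w e) (g w e)) addKn.
Qed.

Lemma tm_dvd f g : Tm f -> Tm g -> Tm (fun w e => f w e %| g w e).
Proof. by move=> hf hg; apply: tm_eq (tm_mod hg hf) (tm_const 0). Qed.

Lemma tm_prime f : Tm f -> Tm (fun w e => prime (f w e)).
Proof.
move=> hf; apply: (@tm_ext _ (fun w e => (1 < f w e) && ball (f w e) (fun d =>
   (d %| f w e) ==> (d <= 1)))).
  move=> w e; congr nat_of_bool; apply/primeP/andP => -[h1 h2]; split=> //.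
    apply/ballP => d df; apply/implyP => /h2/orP[/eqP->//|/eqP E].
    by rewrite E ltnn in df.
  move=> d dv; have := dvdn_leq (ltnW h1) dv; rewrite leq_eqVlt => /orP[/eqP->|lt].
    by rewrite eqxx orbT.
  have := implyP (ballP _ _ h2 d lt) dv.
  have : 0 < d by apply: dvdn_gt0 dv; apply: ltnW.
  by case: d {dv lt} => [|[|d]].
apply: tm_and; first exact: tm_le (tm_const _) hf.
apply: tm_ball => //; apply: tm_imp; first exact: tm_dvd (tm_var 0) (tm_ren S hf).
exact: tm_le (tm_var 0) (tm_const 1).
Qed.

Lemma tm_exp f k : Tm f -> Tm (fun w e => f w e ^ k).
Proof.
move=> hf; elim: k => [|k IH]; first exact: tm_const.
by apply: tm_ext (tm_mul hf IH) => w e; rewrite expnS.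
Qed.

(** A function argument of a definable operation is applied under binders, hence in shifted
    environments; closure under renaming is therefore part of the notion. *)
Definition Tm1 (f : world -> nenv -> nat -> nat) := forall (s : nat -> nat) x,
  Tm x -> Tm (fun w e => f w (fun i => e (s i)) (x w e)).

Definition Tm2 (f : world -> nenv -> nat -> nat -> nat) := forall (s : nat -> nat) x y,
  Tm x -> Tm y -> Tm (fun w e => f w (fun i => e (s i)) (x w e) (y w e)).

Lemma tm0P f : Tm f -> forall s : nat -> nat, Tm (fun w e => f w (fun i => e (s i))).
Proof. by move=> h s; apply: tm_ren. Qed.
End TermClass.

Ltac tm_user := fail.
Ltac tm_step := first
  [ tm_user
  | assumption
  | match goal with H : forall s : nat -> nat, Tm (fun w e => ?p w (fun i => e (s i)))
      |- Tm ?p => exact: (H id) end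
  | match goal with |- Tm (fun w e => ?c) => exact: (@tm_const _ _ c) end
  | match goal with |- Tm (fun w e => e ?i) => exact: (@tm_var _ _ i) end
  | match goal with |- Tm (fun w e => dsize w) => exact: tm_size end
  | match goal with H : forall s : nat -> nat, Tm (fun w e => ?p w (fun i => e (s i)))
      |- Tm (fun w e => ?p w _) => apply: H end
  | match goal with H : Tm1 ?p |- Tm (fun w e => ?p w _ _) => apply: H end
  | match goal with H : Tm2 ?p |- Tm (fun w e => ?p w _ _ _) => apply: H end
  | match goal with |- Tm (fun w e => nat_of_bool (~~ _)) => apply: tm_not end
  | match goal with |- Tm (fun w e => nat_of_bool (_ && _)) => apply: tm_and end
  | match goal with |- Tm (fun w e => nat_of_bool (_ || _)) => apply: tm_or end
  | match goal with |- Tm (fun w e => nat_of_bool (_ ==> _)) => apply: tm_imp end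
  | match goal with |- Tm (fun w e => nat_of_bool (_ == _)) => apply: tm_eq end
  | match goal with |- Tm (fun w e => nat_of_bool (leq _ _)) => apply: tm_le end
  | match goal with |- Tm (fun w e => nat_of_bool (dvdn _ _)) => apply: tm_dvd end
  | match goal with |- Tm (fun w e => nat_of_bool (prime _)) => apply: tm_prime end
  | match goal with |- Tm (fun w e => nat_of_bool (bex _ _)) => apply: tm_bex end
  | match goal with |- Tm (fun w e => nat_of_bool (ball _ _)) => apply: tm_ball end
  | match goal with |- Tm (fun w e => bmin _ _) => apply: tm_bmin end
  | match goal with |- Tm (fun w e => bsum _ _) => apply: tm_bsum end
  | match goal with |- Tm (fun w e => if _ then _ else _) => apply: tm_if end
  | match goal with |- Tm (fun w e => addn _ _) => apply: tm_add end
  | match goal with |- Tm (fun w e => muln _ _) => apply: tm_mul end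
  | match goal with |- Tm (fun w e => subn _ _) => apply: tm_sub end
  | match goal with |- Tm (fun w e => divn _ _) => apply: tm_div end
  | match goal with |- Tm (fun w e => modn _ _) => apply: tm_mod end
  | match goal with |- Tm (fun w e => expn _ _) => apply: tm_exp end
  | match goal with |- Tm (fun w e => predn _) => apply: tm_pred end
  | match goal with |- Tm (fun w e => S _) => apply: tm_S end ].
Ltac tm_intro := match goal with
  | |- Tm1 _ => let s := fresh "s" in let x := fresh "x" in
      move=> s x /tm0P ?; cbv beta
  | |- Tm2 _ => let s := fresh "s" in let x := fresh "x" in let y := fresh "y" in
      move=> s x y /tm0P ? /tm0P ?; cbv beta end.
Ltac tm := repeat (first [tm_step | tm_intro]).

(** * The numerical algorithm *)

Section Algorithm.
Variable n : nat.

Definition ispow2 y :=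
  (0 < y) && ball y.+1 (fun d => (d %| y) ==> ((d == 1) || (2 %| d))).
Definition nlog2 := bsum n.+1 (fun y => (1 < y) && ispow2 y).
(** The integer square root of log n balances two demands: 2^wid exceeds every polylogarithm for
    large n, and wid digits of wid bits each form a number below n + 1. *)
Definition wid := bsum nlog2 (fun i => i.+1 * i.+1 <= nlog2).
(** The k-th power of two is recognised by the k powers of two below it. The value is 2^k only while
    2^k <= n, and 0 otherwise. *)
Definition pow2 k := bsum n.+1 (fun y => (ispow2 y && (bsum y ispow2 == k)) * y).

(* A number codes a sequence of numbers below [2 ^ wid]. *)
Definition dg z i := (z %/ pow2 (wid * i)) %% pow2 wid.
Definition walkv u z i := if i == 0 then u else dg z i.-1.

(* [pt p a x] is meant to be [a ^ x %% p]. *)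
Variable pt : nat -> nat -> nat -> nat.

(** With a correct table and a prime p > 2 this is the least primitive root modulo p. *)
Definition gen p := bmin p (fun g => ball p (fun x =>
  (0 < x) ==> bex p.-1 (fun y => pt p g y == x))).
Definition dlog p x := bmin p.-1 (fun y => pt p (gen p) y == x %% p).
(** A factor divisible by p has no logarithm and is treated apart. The exponent is reduced modulo p
    - 1, the order of the generator, to stay within the range of the table. *)
Definition prodm p d (f : nat -> nat) :=
  if bex d (fun i => f i %% p == 0) then 0
  else pt p (gen p) (bsum d (fun i => dlog p (f i)) %% p.-1).

(* The modulus 0 stands for computation in the Boolean semiring. *)
Definition red p x : nat := if p == 0 then (0 < x : nat) else x %% p.
Definition prd p d (f : nat -> nat) : nat :=
  if p == 0 then (ball d (fun i => 0 < f i) : nat) else prodm p d f.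

Section MatrixPower.
Variables (p k : nat).
(** A power with exponent d <= wid as a single sum over coded walks: z lists the d vertices after
    u. *)
Definition spow (Q : nat -> nat -> nat) d u v :=
  red p (bsum (pow2 (wid * d)) (fun z =>
    (ball d (fun i => dg z i < k) && (walkv u z d == v)) *
    prd p d (fun i => Q (walkv u z i) (walkv u z i.+1)))).
(** From Q^i = (Q^wid)^(i / wid) Q^(i mod wid): each level removes one digit of the exponent in base
    wid, so that J + 1 rounds reach all exponents below wid^(J + 1). *)
Fixpoint mpow J (Q : nat -> nat -> nat) i u v :=
  if J is J'.+1 then
    red p (bsum k (fun y => mpow J' (spow Q wid) (i %/ wid) u y * spow Q (i %% wid) y v))
  else spow Q i u v.
End MatrixPower.

Definition sel (S : nat -> bool) r := bmin n (fun v => S v && (bsum v S == r)).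

(** The coefficient of x^l, for l and the degree below p - 1, is minus the sum of h(a) a^(p - 1 - l)
    over all a != 0, see [Fp_interpolation]; the factor [p.-1] is -1 modulo p. *)
Definition interp p l (h : nat -> nat) :=
  (p.-1 * bsum p (fun a => (0 < a) * (h a * pt p a (p.-1 - l)))) %% p.

Section Adjugate.
Variables (J p k : nat) (Q : nat -> nat -> nat).
Definition minor l r c := ((r <= l) && (c <= l)) * Q r c.
(** The value at z of the truncated series for the last diagonal entry of the inverse of 1 - x Q',
    where Q' is the leading block of size l + 1. By Cramer's rule this entry is a quotient of
    consecutive leading principal minors of 1 - x Q. *)
Definition Fval l z := bsum k.+1 (fun j => mpow p k J (minor l) j l l * pt p z j) %% p.
(** The product of these quotients telescopes to the inverse of det(1 - x Q), and the geometric
    series inverts it back, all modulo x^(k + 1). For y < p, [1 + (p - y)] represents 1 - y. *)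
Definition Hval z :=
  bsum k.+1 (fun i => pt p ((1 + (p - prodm p k (fun l => Fval l z))) %% p) i) %% p.
Definition ecoef j := interp p j Hval.
(** The coefficient of x^m in adj(1 - x Q) is the sum of e_j Q^(m - j) over j <= m, with e_j from
    [ecoef]; setting x = 1 adds these up for m < k. *)
Definition adjv r c := bsum k (fun i => bsum (k - i) (fun j =>
  ecoef j * mpow p k J Q i r c)) %% p.
Definition detv := bsum k.+1 ecoef %% p.
End Adjugate.

Section Update.
Variables (J p : nat) (mt : nat -> nat -> nat -> nat) (ed bs : nat -> nat -> bool).
Variable (Sv : nat -> bool).
Definition nsel := bsum n Sv.
Definition mval s t a := bsum n (fun l => mt s t l * pt p a l) %% p.
Definition dlt r c := ed r c + p.-1 * bs r c.
Definition Kval a r c := bsum nsel (fun y =>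
  a * dlt (sel Sv r) (sel Sv y) * mval (sel Sv y) (sel Sv c) a) %% p.
Definition vval a c t := bsum nsel (fun y =>
  a * dlt (sel Sv c) (sel Sv y) * mval (sel Sv y) t a) %% p.
Definition numv a s t := bsum nsel (fun r => bsum nsel (fun c =>
  mval s (sel Sv r) a * adjv J p nsel (Kval a) r c * vval a c t)) %% p.
(** The determinant may be 0 at a, so this is not the inverse of its value. It is the value at a of
    the polynomial that inverts the determinant modulo x^n. *)
Definition dinvv a :=
  bsum n (fun i => pt p ((1 + (p - detv J p nsel (Kval a))) %% p) i) %% p.
Definition mnew s t l :=
  (mt s t l + interp p l (fun a => (numv a s t * dinvv a) %% p)) %% p.
End Update.
End Algorithm.

(** * Term definability of the algorithm *)

Section AlgorithmTerms.
Variables (m : nat) (ar : 'I_m -> nat).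
Local Notation world := (world ar).
Local Notation nenv := (nat -> nat).
Local Notation fn := (world -> nenv -> nat).

Lemma tm_ispow2 (y : fn) : Tm y -> Tm (fun w e => ispow2 (y w e)).
Proof. by move=> /tm0P hy; rewrite /ispow2; tm. Qed.
Local Ltac tm_user ::= match goal with
  |- Tm (fun w e => nat_of_bool (ispow2 _)) => apply: tm_ispow2 end.

Lemma tm_nlog2 : Tm (fun (w : world) e => nlog2 (dsize w)).
Proof. by rewrite /nlog2; tm. Qed.
Local Ltac tm_user ::= first [exact: tm_nlog2 | match goal with
  |- Tm (fun w e => nat_of_bool (ispow2 _)) => apply: tm_ispow2 end].

Lemma tm_wid : Tm (fun (w : world) e => wid (dsize w)).
Proof. by rewrite /wid; tm. Qed.

Lemma tm_pow2 (k : fn) : Tm k -> Tm (fun w e => pow2 (dsize w) (k w e)).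
Proof. by move=> /tm0P hk; rewrite /pow2; tm. Qed.

Local Ltac tm_user ::= match goal with
  | |- Tm (fun w e => wid _) => exact: tm_wid
  | |- Tm (fun w e => pow2 _ _) => apply: tm_pow2 end.

Lemma tm_dg (z i : fn) : Tm z -> Tm i -> Tm (fun w e => dg (dsize w) (z w e) (i w e)).
Proof. by move=> hz hi; rewrite /dg; tm. Qed.

Lemma tm_walkv (u z i : fn) : Tm u -> Tm z -> Tm i ->
  Tm (fun w e => walkv (dsize w) (u w e) (z w e) (i w e)).
Proof. by move=> hu hz hi; rewrite /walkv; tm; last (by apply: tm_dg; tm). Qed.

Variable pt : world -> nat -> nat -> nat -> nat.
Hypothesis tm_pt : forall p a x : fn, Tm p -> Tm a -> Tm x ->
  Tm (fun w e => pt w (p w e) (a w e) (x w e)).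

Local Ltac tm_user ::= match goal with
  | |- Tm (fun w e => pt w _ _ _) => apply: tm_pt end.

Lemma tm_gen (p : fn) : Tm p -> Tm (fun w e => gen (pt w) (p w e)).
Proof. by move=> /tm0P hp; rewrite /gen; tm. Qed.
Local Ltac tm_user ::= match goal with
  | |- Tm (fun w e => pt w _ _ _) => apply: tm_pt
  | |- Tm (fun w e => gen _ _) => apply: tm_gen end.

Lemma tm_dlog (p x : fn) : Tm p -> Tm x -> Tm (fun w e => dlog (pt w) (p w e) (x w e)).
Proof. by move=> /tm0P hp /tm0P hx; rewrite /dlog; tm. Qed.
Local Ltac tm_user ::= match goal with
  | |- Tm (fun w e => pt w _ _ _) => apply: tm_pt
  | |- Tm (fun w e => gen _ _) => apply: tm_gen
  | |- Tm (fun w e => dlog _ _ _) => apply: tm_dlog end.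

Lemma tm_prodm (p d : fn) (f : world -> nenv -> nat -> nat) : Tm p -> Tm d -> Tm1 f ->
  Tm (fun w e => prodm (pt w) (p w e) (d w e) (f w e)).
Proof. by move=> /tm0P hp /tm0P hd hf; rewrite /prodm; tm. Qed.
Local Ltac tm_user ::= match goal with
  | |- Tm (fun w e => pt w _ _ _) => apply: tm_pt
  | |- Tm (fun w e => prodm _ _ _ _) => apply: tm_prodm end.

Lemma tm_prd (p d : fn) (f : world -> nenv -> nat -> nat) : Tm p -> Tm d -> Tm1 f ->
  Tm (fun w e => prd (pt w) (p w e) (d w e) (f w e)).
Proof. by move=> /tm0P hp /tm0P hd hf; rewrite /prd; tm. Qed.

Lemma tm_red (p x : fn) : Tm p -> Tm x -> Tm (fun w e => red (p w e) (x w e)).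
Proof. by move=> hp hx; rewrite /red; tm. Qed.

Local Ltac tm_user ::= match goal with
  | |- Tm (fun w e => pt w _ _ _) => apply: tm_pt
  | |- Tm (fun w e => wid _) => exact: tm_wid
  | |- Tm (fun w e => pow2 _ _) => apply: tm_pow2
  | |- Tm (fun w e => dg _ _ _) => apply: tm_dg
  | |- Tm (fun w e => walkv _ _ _ _) => apply: tm_walkv
  | |- Tm (fun w e => prd _ _ _ _) => apply: tm_prd
  | |- Tm (fun w e => red _ _) => apply: tm_red end.

Lemma tm_spow (p k d u v : fn) (Q : world -> nenv -> nat -> nat -> nat) :
  Tm p -> Tm k -> Tm2 Q -> Tm d -> Tm u -> Tm v ->
  Tm (fun w e => spow (dsize w) (pt w) (p w e) (k w e) (Q w e) (d w e) (u w e) (v w e)).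
Proof.
move=> /tm0P hp /tm0P hk hQ /tm0P hd /tm0P hu /tm0P hv; rewrite /spow; tm.
Qed.

Local Ltac tm_alg := match goal with
  | |- Tm (fun w e => wid _) => exact: tm_wid
  | |- Tm (fun w e => pt w _ _ _) => apply: tm_pt
  | |- Tm (fun w e => spow _ _ _ _ _ _ _ _) => apply: tm_spow
  | |- Tm (fun w e => prodm _ _ _ _) => apply: tm_prodm
  | |- Tm (fun w e => red _ _) => apply: tm_red end.
Local Ltac tm_user ::= tm_alg.

Lemma tm_mpow J (p k i u v : fn) (Q : world -> nenv -> nat -> nat -> nat) :
  Tm p -> Tm k -> Tm2 Q -> Tm i -> Tm u -> Tm v ->
  Tm (fun w e =>
    mpow (dsize w) (pt w) (p w e) (k w e) J (Q w e) (i w e) (u w e) (v w e)).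
Proof.
elim: J p k i u v Q => [|J IH] p k i u v Q /tm0P hp /tm0P hk hQ /tm0P hi /tm0P hu /tm0P hv.
  by apply: tm_spow; tm.
rewrite /mpow -/mpow; tm; apply: IH; tm.
Qed.

Lemma tm_sel (S : world -> nat -> bool) (r : fn) :
  (forall v : fn, Tm v -> Tm (fun w e => S w (v w e))) -> Tm r ->
  Tm (fun w e => sel (dsize w) (S w) (r w e)).
Proof.
move=> hS /tm0P hr; rewrite /sel; tm; first by apply: hS; tm.
by apply: hS; tm.
Qed.

Lemma tm_interp (p l : fn) (h : world -> nenv -> nat -> nat) :
  Tm p -> Tm l -> Tm1 h -> Tm (fun w e => interp (pt w) (p w e) (l w e) (h w e)).
Proof. by move=> /tm0P hp /tm0P hl hh; rewrite /interp; tm. Qed.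

Local Ltac tm_user ::= first [tm_alg | match goal with
  | |- Tm (fun w e => mpow _ _ _ _ _ _ _ _ _) => apply: tm_mpow
  | |- Tm (fun w e => interp _ _ _ _) => apply: tm_interp end].

Section AdjugateTerms.
Variable J : nat.

Lemma tm_Fval (p k l z : fn) (Q : world -> nenv -> nat -> nat -> nat) :
  Tm p -> Tm k -> Tm2 Q -> Tm l -> Tm z ->
  Tm (fun w e => Fval (dsize w) (pt w) J (p w e) (k w e) (Q w e) (l w e) (z w e)).
Proof.
move=> /tm0P hp /tm0P hk hQ /tm0P hl /tm0P hz; rewrite /Fval; tm.
by rewrite /minor; tm.
Qed.

Lemma tm_Hval (p k z : fn) (Q : world -> nenv -> nat -> nat -> nat) :
  Tm p -> Tm k -> Tm2 Q -> Tm z ->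
  Tm (fun w e => Hval (dsize w) (pt w) J (p w e) (k w e) (Q w e) (z w e)).
Proof.
move=> /tm0P hp /tm0P hk hQ /tm0P hz; rewrite /Hval; tm.
by apply: tm_Fval; tm.
Qed.

Lemma tm_ecoef (p k j : fn) (Q : world -> nenv -> nat -> nat -> nat) :
  Tm p -> Tm k -> Tm2 Q -> Tm j ->
  Tm (fun w e => ecoef (dsize w) (pt w) J (p w e) (k w e) (Q w e) (j w e)).
Proof.
move=> /tm0P hp /tm0P hk hQ /tm0P hj; rewrite /ecoef; tm.
by apply: tm_Hval; tm.
Qed.

Lemma tm_adjv (p k r c : fn) (Q : world -> nenv -> nat -> nat -> nat) :
  Tm p -> Tm k -> Tm2 Q -> Tm r -> Tm c ->
  Tm (fun w e => adjv (dsize w) (pt w) J (p w e) (k w e) (Q w e) (r w e) (c w e)).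
Proof.
move=> /tm0P hp /tm0P hk hQ /tm0P hr /tm0P hc; rewrite /adjv; tm.
by apply: tm_ecoef; tm.
Qed.

Lemma tm_detv (p k : fn) (Q : world -> nenv -> nat -> nat -> nat) :
  Tm p -> Tm k -> Tm2 Q ->
  Tm (fun w e => detv (dsize w) (pt w) J (p w e) (k w e) (Q w e)).
Proof.
move=> /tm0P hp /tm0P hk hQ; rewrite /detv; tm.
by apply: tm_ecoef; tm.
Qed.
End AdjugateTerms.

Section UpdateTerms.
Variables (J : nat) (mt : world -> nat -> nat -> nat -> nat -> nat).
Variables (bs : world -> nat -> nat -> bool) (Sv : world -> nat -> bool).
Hypothesis tm_mt : forall p s t l : fn, Tm p -> Tm s -> Tm t -> Tm l ->
  Tm (fun w e => mt w (p w e) (s w e) (t w e) (l w e)).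
Hypothesis tm_bs : forall s t : fn, Tm s -> Tm t -> Tm (fun w e => bs w (s w e) (t w e)).
Hypothesis tm_Sv : forall s : fn, Tm s -> Tm (fun w e => Sv w (s w e)).

Lemma tm_nsel : Tm (fun w e => nsel (dsize w) (Sv w)).
Proof. by rewrite /nsel; tm; apply: tm_Sv; tm. Qed.

Local Ltac tm_upd := match goal with
  | |- Tm (fun w e => mt w _ _ _ _) => apply: tm_mt
  | |- Tm (fun w e => nat_of_bool (bs w _ _)) => apply: tm_bs
  | |- Tm (fun w e => nat_of_bool (edge_val w _ _)) => apply: tm_edge
  | |- Tm (fun w e => sel _ _ _) => apply: (tm_sel tm_Sv)
  | |- Tm (fun w e => nsel _ _) => exact: tm_nsel end.
Local Ltac tm_user ::= first [tm_upd | tm_alg | match goal with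
  | |- Tm (fun w e => interp _ _ _ _) => apply: tm_interp end].

Lemma tm_mval (p s t a : fn) : Tm p -> Tm s -> Tm t -> Tm a ->
  Tm (fun w e => mval (dsize w) (pt w) (p w e) (mt w (p w e)) (s w e) (t w e) (a w e)).
Proof. by move=> /tm0P hp /tm0P hs /tm0P ht /tm0P ha; rewrite /mval; tm. Qed.

Lemma tm_Kval (p a r c : fn) : Tm p -> Tm a -> Tm r -> Tm c ->
  Tm (fun w e => Kval (dsize w) (pt w) (p w e) (mt w (p w e)) (edge_val w) (bs w) (Sv w)
    (a w e) (r w e) (c w e)).
Proof.
move=> /tm0P hp /tm0P ha /tm0P hr /tm0P hc; rewrite /Kval /dlt; tm.
by apply: tm_mval; tm.
Qed.

Lemma tm_vval (p a c t : fn) : Tm p -> Tm a -> Tm c -> Tm t ->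
  Tm (fun w e => vval (dsize w) (pt w) (p w e) (mt w (p w e)) (edge_val w) (bs w) (Sv w)
    (a w e) (c w e) (t w e)).
Proof.
move=> /tm0P hp /tm0P ha /tm0P ht /tm0P hc; rewrite /vval /dlt; tm.
by apply: tm_mval; tm.
Qed.

Local Ltac tm_user ::= first [tm_upd | tm_alg | match goal with
  | |- Tm (fun w e => interp _ _ _ _) => apply: tm_interp
  | |- Tm (fun w e => mval _ _ _ _ _ _ _) => apply: tm_mval
  | |- Tm (fun w e => Kval _ _ _ _ _ _ _ _ _ _) => apply: tm_Kval
  | |- Tm (fun w e => vval _ _ _ _ _ _ _ _ _ _) => apply: tm_vval
  | |- Tm (fun w e => adjv _ _ _ _ _ _ _ _) => apply: tm_adjv
  | |- Tm (fun w e => detv _ _ _ _ _ _) => apply: tm_detv end].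

Lemma tm_numv (p a s t : fn) : Tm p -> Tm a -> Tm s -> Tm t ->
  Tm (fun w e => numv (dsize w) (pt w) J (p w e) (mt w (p w e)) (edge_val w) (bs w) (Sv w)
    (a w e) (s w e) (t w e)).
Proof. by move=> /tm0P hp /tm0P ha /tm0P hs /tm0P ht; rewrite /numv; tm. Qed.

Lemma tm_dinvv (p a : fn) : Tm p -> Tm a ->
  Tm (fun w e => dinvv (dsize w) (pt w) J (p w e) (mt w (p w e)) (edge_val w) (bs w) (Sv w)
    (a w e)).
Proof. by move=> /tm0P hp /tm0P ha; rewrite /dinvv; tm. Qed.

Lemma tm_mnew (p s t l : fn) : Tm p -> Tm s -> Tm t -> Tm l ->
  Tm (fun w e => mnew (dsize w) (pt w) J (p w e) (mt w (p w e)) (edge_val w) (bs w) (Sv w)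
    (s w e) (t w e) (l w e)).
Proof.
move=> /tm0P hp /tm0P hs /tm0P ht /tm0P hl; rewrite /mnew; tm.
  by apply: tm_numv; tm.
by apply: tm_dinvv; tm.
Qed.
End UpdateTerms.
End AlgorithmTerms.

(** * Chistov's formula *)

Section PolynomialMatrices.
Import GRing.Theory.
Local Open Scope ring_scope.

Section PolyCongruence.
Variable R : comNzRingType.
Implicit Types p q : {poly R}.

(** Congruence modulo X^N, that is, equality of truncated power series; the explicit quotient lets
    [ring] prove its properties. *)
Definition cx N p q := exists r, p = q + r * 'X^N.

Lemma cx_refl N p : cx N p p.
Proof. by exists 0; rewrite mul0r addr0. Qed.

Lemma cx_sym N p q : cx N p q -> cx N q p.
Proof. by case=> r ->; exists (- r); ring. Qed.

Lemma cx_trans N p q r : cx N p q -> cx N q r -> cx N p r.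
Proof. by case=> a -> [b ->]; exists (a + b); ring. Qed.

Lemma cx_add N p q p' q' : cx N p p' -> cx N q q' -> cx N (p + q) (p' + q').
Proof. by case=> a -> [b ->]; exists (a + b); ring. Qed.

Lemma cx_mul N p q p' q' : cx N p p' -> cx N q q' -> cx N (p * q) (p' * q').
Proof. by case=> a -> [b ->]; exists (p' * b + a * q' + a * b * 'X^N); ring. Qed.

Lemma cx_coef N p q i : cx N p q -> (i < N)%N -> p`_i = q`_i.
Proof. by case=> r -> iN; rewrite coefD coefMXn iN addr0. Qed.

Lemma cx_X0 N p : (cx N ('X^N * p) 0).
Proof. by exists p; rewrite add0r mulrC. Qed.

Lemma cx_root N p : p`_0 = 0 -> cx N (p ^+ N) 0.
Proof.
move=> p0; have [q ->] : exists q, p = q * 'X.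
  exists (drop_poly 1 p).
  have := poly_take_drop 1 p => {1}<-.
  rewrite expr1 [X in X + _](_ : _ = 0) ?add0r //.
  by apply/polyP => i; rewrite coef_take_poly coef0; case: i => //=; rewrite p0.
by exists (q ^+ N); rewrite add0r exprMn.
Qed.

(** The substitute for division: p times the sum telescopes to 1 - (1 - p)^N, and X divides 1 -
    p. *)
Lemma cx_geom N p : p`_0 = 1 -> cx N (p * \sum_(i < N) (1 - p) ^+ i) 1.
Proof.
move=> p0; have -> : p * \sum_(i < N) (1 - p) ^+ i = 1 - (1 - p) ^+ N.
  have := subrX1 (1 - p) N; set s := \sum_(i < N) _ => E.
  by rewrite -[RHS]opprB E; ring.
have [r ->] : cx N ((1 - p) ^+ N) 0 by apply: cx_root; rewrite coefB coef1 p0 subrr.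
by exists (- r); ring.
Qed.
End PolyCongruence.

Section SizeBounds.
Variable R : idomainType.

(** Interpolation needs explicit degree bounds. A [size] is the degree plus one, hence the
    successors here and below. *)
Lemma size_prod_bound (I : finType) (P : pred I) (F : I -> {poly R}) s :
  (forall i, P i -> (size (F i) <= s.+1)%N) ->
  (size (\prod_(i | P i) F i)%R <= (#|P| * s).+1)%N.
Proof.
move=> h; apply: leq_trans (size_poly_prod_leq _ _) _.
have := @leq_sum I (index_enum I) P (fun i => size (F i)) (fun=> s.+1) h.
by rewrite sum_nat_const; lia.
Qed.

Lemma size_mul_bound (p q : {poly R}) a b : (size p <= a.+1)%N -> (size q <= b.+1)%N ->
  (size (p * q)%R <= (a + b).+1)%N.
Proof.
move=> hp hq; apply: leq_trans (size_polyMleq _ _) _; lia.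
Qed.

Lemma size_sum_bound (I : finType) (P : pred I) (F : I -> {poly R}) s :
  (forall i, P i -> (size (F i) <= s)%N) -> (size (\sum_(i | P i) F i)%R <= s)%N.
Proof. by move=> h; apply: leq_trans (size_sum _ _ _) _; apply/bigmax_leqP. Qed.

Lemma size_exp_bound (p : {poly R}) a i : (size p <= a.+1)%N ->
  (size (p ^+ i)%R <= (i * a).+1)%N.
Proof.
move=> h; elim: i => [|i IH]; first by rewrite expr0 size_poly1.
by rewrite exprS mulSn; apply: size_mul_bound.
Qed.

Lemma size_det_bound k (A : 'M[{poly R}]_k) s :
  (forall i j, (size (A i j) <= s.+1)%N) -> (size (\det A)%R <= (k * s).+1)%N.
Proof.
move=> h; rewrite /determinant; apply: size_sum_bound => t _.
have -> : (-1) ^+ odd_perm t * \prod_i A i (t i) =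
   (((-1) ^+ odd_perm t)%:P : {poly R}) * \prod_i A i (t i).
  by rewrite rmorphXn rmorphN1.
have H : (size (\prod_i A i (t i))%R <= (k * s).+1)%N.
  have := @size_prod_bound _ predT (fun i => A i (t i)) s; rewrite card_ord.
  by apply=> i _; apply: h.
exact: size_mul_bound (size_polyC_leq1 _) H.
Qed.

Lemma size_adj_bound k (A : 'M[{poly R}]_k) s :
  (forall i j, (size (A i j) <= s.+1)%N) ->
  forall i j, (size (\adj A i j)%R <= (k.-1 * s).+1)%N.
Proof.
move=> h i j; rewrite mxE /cofactor.
have -> : (-1) ^+ (j + i) = (((-1) ^+ (j + i))%:P : {poly R}).
  by rewrite rmorphXn rmorphN1.
apply: size_mul_bound (size_polyC_leq1 _) _.
by apply: size_det_bound => a b; rewrite !mxE.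
Qed.
End SizeBounds.

Lemma sum_triangle (R : nmodType) k (f : nat -> nat -> R) :
  \sum_(m < k) \sum_(j < m.+1) f j (m - j)%N = \sum_(i < k) \sum_(j < k - i) f j i.
Proof.
elim: k => [|k IH]; first by rewrite !big_ord0.
rewrite big_ord_recr /= IH [RHS]big_ord_recr /= subSnn big_ord1.
have -> : \sum_(i < k) \sum_(j < k.+1 - i) f j i =
   \sum_(i < k) \sum_(j < k - i) f j i + \sum_(i < k) f (k - i)%N i.
  rewrite -big_split; apply: eq_bigr => i _ /=.
  by rewrite subSn ?(ltnW (ltn_ord i)) // big_ord_recr.
rewrite -addrA; congr (_ + _).
rewrite (reindex_inj rev_ord_inj) /= big_ord_recr /=; congr (_ + _).
  by apply: eq_bigr => i _; rewrite subSS subKn // ltnW.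
by rewrite subnn subn0.
Qed.

Lemma exp_scalemx (R : comNzRingType) k (x : R) (M : 'M[R]_k) j :
  (x *: M) ^+ j = x ^+ j *: M ^+ j.
Proof.
elim: j => [|j IH]; first by rewrite !expr0 scale1r.
by rewrite !exprS IH -[LHS]scalemxAl -[X in _ *: X]scalemxAr scalerA.
Qed.

Lemma exp_map_mx (R S : nzRingType) (f : {rmorphism R -> S}) k (M : 'M[R]_k) j :
  map_mx f (M ^+ j) = map_mx f M ^+ j.
Proof.
by elim: j => [|j IH]; rewrite ?expr0 ?map_mx1 // !exprS map_mxM IH.
Qed.

Section Chistov.
Variables (F : fieldType) (k : nat) (A : 'M[F]_k).
Local Notation P := (map_mx polyC).

Definition lead_block m : 'M[F]_k :=
  \matrix_(i, j) (if (i < m)%N && (j < m)%N then A i j else 0).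
Definition charB (B : 'M[F]_k) : 'M[{poly F}]_k := 1%:M - 'X *: P B.
Definition Dpoly m := \det (charB (lead_block m)).
Definition Fpoly (m : 'I_k) : {poly F} :=
  \sum_(j < k.+1) ((lead_block m.+1 ^+ j) m m)%:P * 'X^j.

(** 1 - X B times the truncated geometric series of X B is 1 - (X B)^(k + 1); multiplication by the
    adjugate turns 1 - X B into its determinant. *)
Lemma adj_charB (B : 'M[F]_k) r c :
  cx k.+1 (\det (charB B) * \sum_(j < k.+1) ((B ^+ j) r c)%:P * 'X^j)
          (\adj (charB B) r c).
Proof.
pose T : 'M[{poly F}]_k := \sum_(j < k.+1) ('X *: P B) ^+ j.
have TE : T r c = \sum_(j < k.+1) ((B ^+ j) r c)%:P * 'X^j.
  rewrite /T summxE; apply: eq_bigr => j _.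
  have -> : ('X *: P B) ^+ j = 'X^j *: P (B ^+ j).
    by rewrite exp_scalemx exp_map_mx.
  by rewrite !mxE mulrC.
have E : charB B *m T = 1%:M - 'X^(k.+1) *: (P B) ^+ k.+1.
  have := subrX1 ('X *: P B) k.+1; rewrite -/T exp_scalemx => E.
  by rewrite -[RHS]opprB -[1%:M]/(1 : 'M_k) E /charB -mulNmx opprB.
have := congr1 (fun M : 'M_k => (\adj (charB B) *m M) r c) E.
rewrite mulmxA mul_adj_mx mul_scalar_mx mulmxBr mulmx1 -scalemxAr.
rewrite !mxE TE => ->; set z := \sum_j _.
by exists (- z); ring.
Qed.

(** Cramer's rule on the diagonal: the cofactor at m for the leading block of size m + 1 is the next
    smaller leading minor. *)
Lemma Dpoly_step (m : 'I_k) : cx k.+1 (Dpoly m.+1 * Fpoly m) (Dpoly m).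
Proof.
have := adj_charB (lead_block m.+1) m m; rewrite -/(Dpoly m.+1) -/(Fpoly m).
suff -> : \adj (charB (lead_block m.+1)) m m = Dpoly m by [].
(* Row m of the matrix for the smaller block is a unit vector, so expansion along it leaves only the
   cofactor. *)
rewrite mxE /Dpoly (expand_det_row _ m) (bigD1 m) //= big1 ?addr0 => [|j jm].
  rewrite !mxE eqxx ltnn mulr0 subr0 mul1r /cofactor; congr (_ * \det _).
  apply/matrixP => i j; rewrite !mxE; congr (_ - 'X * _%:P).
  have ne (l : 'I_k.-1) : (lift m l < m.+1)%N = (lift m l < m)%N.
    rewrite ltnS leq_eqVlt; case: eqP => // E.
    by case/eqP: (neq_lift m l); apply: val_inj; exact: esym E.
  by rewrite !ne.
by rewrite !mxE ltnn mulr0 subr0 eq_sym (negbTE jm) mul0r.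
Qed.

Lemma Dpoly_full : Dpoly k = \det (charB A).
Proof.
congr (\det (charB _)); apply/matrixP => i j; by rewrite mxE !ltn_ord.
Qed.

(** The quotients of consecutive minors telescope down to the empty leading block, whose determinant
    is 1. *)
Lemma Dpoly_prod : cx k.+1 (\det (charB A) * \prod_(m < k) Fpoly m) 1.
Proof.
rewrite -Dpoly_full.
suff H l (lk : (l <= k)%N) :
    cx k.+1 (Dpoly l * \prod_(m < k | (m < l)%N) Fpoly m) 1.
  have := H k (leqnn k); by under eq_bigl do rewrite ltn_ord.
elim: l lk => [|l IH] lk.
  rewrite big_pred0 ?mulr1 //.
  suff -> : Dpoly 0 = 1 by exact: cx_refl.
  rewrite /Dpoly (_ : charB _ = 1%:M) ?det1 //.
  by apply/matrixP => i j; rewrite !mxE ltn0 mulr0 subr0.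
have E : \prod_(m < k | (m < l.+1)%N) Fpoly m =
    Fpoly (Ordinal lk) * \prod_(m < k | (m < l)%N) Fpoly m.
  rewrite (bigD1 (Ordinal lk)) //=; congr (_ * _); apply: eq_bigl => i.
  by rewrite -val_eqE /=; lia.
rewrite E mulrA; apply: cx_trans (IH (ltnW lk)).
by apply: cx_mul (Dpoly_step (Ordinal lk)) (cx_refl _ _).
Qed.

Lemma Fpoly0 m : (Fpoly m)`_0 = 1.
Proof.
rewrite /Fpoly coef_sum big_ord_recl /= big1 ?addr0 => [|i _].
  by rewrite coefMXn coefC /= mxE eqxx.
by rewrite coefMXn.
Qed.

Definition Hpoly : {poly F} := \sum_(i < k.+1) (1 - \prod_(m < k) Fpoly m) ^+ i.

(** [Hpoly] and the determinant are both inverse to the product of the [Fpoly] modulo X^(k + 1). *)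
Lemma Hpoly_coef j : (j <= k)%N -> Hpoly`_j = (\det (charB A))`_j.
Proof.
move=> jk; apply: (@cx_coef _ k.+1); last exact: jk.
have p0 : (\prod_(m < k) Fpoly m)`_0 = 1.
  rewrite -horner_coef0 horner_prod big1 // => i _.
  by rewrite horner_coef0 Fpoly0.
set Q := \prod_(m < k) Fpoly m in p0 *.
have h1 : cx k.+1 (Q * Hpoly) 1 by apply: cx_geom.
have h2 := Dpoly_prod; rewrite -/Q in h2.
apply: (@cx_trans _ _ _ (Hpoly * (\det (charB A) * Q))).
  by apply: cx_sym; have := cx_mul (cx_refl k.+1 Hpoly) h2; rewrite mulr1.
have -> : Hpoly * (\det (charB A) * Q) = \det (charB A) * (Q * Hpoly) by ring.
by have := cx_mul (cx_refl k.+1 (\det (charB A))) h1; rewrite mulr1.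
Qed.

Lemma size_charB i j : (size (charB A i j) <= 2)%N.
Proof.
rewrite !mxE; apply: leq_trans (size_polyD _ _) _; rewrite geq_max size_polyN.
apply/andP; split; first by case: eqP => _; rewrite ?mulr1n ?size_poly1 ?mulr0n ?size_poly0.
apply: (@size_mul_bound _ _ _ 1 0); rewrite ?size_polyX //.
exact: size_polyC_leq1.
Qed.

Lemma det_sub1 : \det (1%:M - A) = \sum_(j < k.+1) (\det (charB A))`_j.
Proof.
have -> : 1%:M - A = map_mx (horner_eval 1) (charB A).
  apply/matrixP => i j; rewrite !mxE /horner_eval hornerD hornerN hornerM hornerX.
  by rewrite hornerC mul1r; case: eqP; rewrite ?mulr1n ?hornerC ?mulr0n ?horner0.
rewrite det_map_mx [LHS]horner_evalE (@horner_coef_wide _ k.+1).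
  by apply: eq_bigr => j _; rewrite expr1n mulr1.
by have := size_det_bound size_charB; rewrite muln1.
Qed.

(** The adjugate of 1 - X A has degree below k, so the congruence [adj_charB] yields all its
    coefficients, and setting X = 1 adds them up. *)
Lemma adj_sub1 r c : \adj (1%:M - A) r c =
  \sum_(i < k) \sum_(j < k - i) (\det (charB A))`_j * (A ^+ i) r c.
Proof.
have k0 : (0 < k)%N by apply: leq_ltn_trans (ltn_ord r).
have -> : 1%:M - A = map_mx (horner_eval 1) (charB A).
  apply/matrixP => i j; rewrite !mxE /horner_eval hornerD hornerN hornerM hornerX.
  by rewrite hornerC mul1r; case: eqP; rewrite ?mulr1n ?hornerC ?mulr0n ?horner0.
rewrite -map_mx_adj mxE [LHS]horner_evalE (@horner_coef_wide _ k); last first.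
  by have := size_adj_bound size_charB r c; rewrite muln1 prednK.
rewrite -(sum_triangle k (fun j i => (\det (charB A))`_j * (A ^+ i) r c)).
apply: eq_bigr => m _; rewrite expr1n mulr1.
rewrite -(cx_coef (adj_charB A r c)) ?(ltnW (ltn_ord m)) ?ltnS ?(ltnW (ltn_ord m)) //.
rewrite coefM; apply: eq_bigr => j _; congr (_ * _).
have lk : (m - j < k.+1)%N by rewrite ltnS (leq_trans (leq_subr _ _)) // ltnW.
rewrite coef_sum (bigD1 (Ordinal lk)) //= coefMXn ltnn subnn coefC eqxx big1 ?addr0 //.
move=> i /eqP hi; rewrite coefMXn coefC; case: ltnP => // le.
rewrite subn_eq0 ifN //; apply/negP => le2; case: hi; apply: val_inj => /=.
by apply/eqP; rewrite eqn_leq le le2.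
Qed.
End Chistov.
End PolynomialMatrices.

(** * Updating walk generating functions *)

Section GeneratingFunctions.
Import GRing.Theory.
Local Open Scope ring_scope.

Section WalkUpdate.
Variables (F : fieldType) (n k N : nat) (A A' : 'M[F]_n) (sv : 'I_k -> 'I_n).
Variable delta : 'M[F]_k.
Local Notation P := (map_mx polyC).
Definition selmx (R : nzRingType) : 'M[R]_(n, k) := \matrix_(v, r) (v == sv r)%:R.
Hypothesis A'E : A' = A + selmx F *m delta *m (selmx F)^T.

Definition walkgf (B : 'M[F]_n) : 'M[{poly F}]_n := \sum_(l < N) 'X^l *: P (B ^+ l).
Definition Wp : 'M[{poly F}]_k := 'X *: P delta.
Definition Kp : 'M[{poly F}]_k :=
  Wp *m (\matrix_(y, c) walkgf A (sv y) (sv c)).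
Definition Yp : 'M[{poly F}]_(k, n) := Wp *m (\matrix_(y, t) walkgf A (sv y) t).
Definition dp := \det (1%:M - Kp).
Definition dinvp := \sum_(i < N) (1 - dp) ^+ i.
(** The correction term M U adj(1 - K) Y / det(1 - K) of the Sherman-Morrison-Woodbury formula, with
    the truncated inverse of the determinant. *)
Definition resp s t := (\sum_r \sum_c walkgf A s (sv r) * \adj (1%:M - Kp) r c * Yp c t)
  * dinvp.

Lemma walkgf_coef B s t l : (l < N)%N -> (walkgf B s t)`_l = (B ^+ l) s t.
Proof.
move=> lN; rewrite /walkgf summxE coef_sum (bigD1 (Ordinal lN)) //= big1 => [|i /eqP hi].
  by rewrite !mxE coefXnM ltnn subnn coefC eqxx addr0.
rewrite !mxE coefXnM coefC; case: ltnP => // le; rewrite subn_eq0 ifN //.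
by apply/negP => le2; case: hi; apply: val_inj; apply/eqP; rewrite eqn_leq /= le le2.
Qed.

Lemma walkgfE B : walkgf B = \sum_(l < N) ('X *: P B) ^+ l.
Proof. by apply: eq_bigr => l _; rewrite exp_scalemx exp_map_mx. Qed.

Lemma walkgf_mull B : (1 - 'X *: P B) * walkgf B = 1 - 'X^N *: (P B) ^+ N.
Proof.
have := subrX1 ('X *: P B) N; rewrite -walkgfE exp_scalemx => E.
by rewrite -[RHS]opprB E -mulNr opprB.
Qed.

Lemma walkgf_mulr B : walkgf B * (1 - 'X *: P B) = 1 - 'X^N *: (P B) ^+ N.
Proof.
rewrite -walkgf_mull walkgfE; apply/esym/commr_sum => i _.
by apply: commrX; apply/commr_sym/commrB; [apply: commr1|].
Qed.

Lemma dp0 : dp`_0 = 1.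
Proof.
rewrite -horner_coef0 /dp.
have -> : (\det (1%:M - Kp)).[0] = \det (map_mx (horner_eval 0) (1%:M - Kp)).
  by rewrite det_map_mx.
suff -> : map_mx (horner_eval 0) (1%:M - Kp) = 1%:M by rewrite det1.
apply/matrixP => i j; rewrite !mxE [LHS]horner_evalE hornerD hornerN horner_sum big1 ?subr0.
  by case: eqP => _; rewrite ?mulr1n ?mulr0n ?horner0 ?hornerC.
by move=> c _; rewrite !mxE !hornerM hornerX !mul0r.
Qed.

(** The factor det(1 - K) on both sides avoids division. The right-hand side Z satisfies (1 - X A')
    Z = det(1 - K) modulo X^N, and M' inverts 1 - X A' from the left modulo X^N. *)
Lemma walk_update_mx : exists C : 'M[{poly F}]_n,
  dp *: walkgf A' = dp *: walkgf A +
    walkgf A *m selmx {poly F} *m \adj (1%:M - Kp) *m Yp + 'X^N *: C.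
Proof.
set M := walkgf A; set M' := walkgf A'; set U := selmx _; set Ad := \adj _.
have VM : U^T *m M = \matrix_(y, t) M (sv y) t.
  apply/matrixP => y t; rewrite !mxE (bigD1 (sv y)) //= !mxE eqxx mul1r big1 ?addr0 //.
  by move=> v hv; rewrite !mxE (negbTE hv) mul0r.
have VMU : U^T *m M *m U = \matrix_(y, c) M (sv y) (sv c).
  rewrite VM; apply/matrixP => y c; rewrite !mxE (bigD1 (sv c)) //= !mxE eqxx mulr1.
  by rewrite big1 ?addr0 // => v hv; rewrite !mxE (negbTE hv) mulr0.
have YE : Yp = Wp *m U^T *m M by rewrite -mulmxA VM.
have KE : Kp = Wp *m U^T *m M *m U by rewrite -!mulmxA [U^T *m _]mulmxA VMU.
have XA' : 'X *: P A' = 'X *: P A + U *m Wp *m U^T.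
  rewrite A'E map_mxD !map_mxM scalerDr; congr (_ + _).
  have PU : P (selmx F) = U by apply/matrixP => i j; rewrite !mxE rmorph_nat.
  by rewrite -map_trmx PU /Wp -scalemxAr -scalemxAl.
set G := 1 - 'X *: P A'.
have E1 : (1 - 'X *: P A) *m M = 1 - 'X^N *: (P A) ^+ N := walkgf_mull A.
set Z := dp *: M + M *m U *m Ad *m Yp.
have [C1 hC1] : exists C1, G *m Z = dp%:M + 'X^N *: C1.
  exists (- ((P A) ^+ N *m (dp%:M + U *m Ad *m Yp))).
  have -> : G = (1 - 'X *: P A) - U *m Wp *m U^T by rewrite /G XA' opprD addrA.
  have -> : Z = M *m (dp%:M + U *m Ad *m Yp).
    by rewrite /Z mulmxDr mul_mx_scalar !mulmxA.
  rewrite mulmxBl mulmxA E1.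
  have -> : U *m Wp *m U^T *m (M *m (dp%:M + U *m Ad *m Yp)) =
      U *m (dp%:M + Kp *m Ad) *m Yp.
    rewrite !mulmxDr !mulmxDl KE YE !mulmxA; congr (_ + _).
    by rewrite !mul_mx_scalar -!scalemxAl.
  have adE : (1%:M - Kp) *m Ad = dp%:M by rewrite mul_mx_adj.
  (* With this identity the term subtracted on account of U Wp U^T becomes U Ad Yp, which cancels
     the correction. *)
  have KAd : Kp *m Ad = Ad - dp%:M.
    by rewrite -adE mulmxBl mul1mx opprB addrC subrK.
  rewrite KAd (addrC dp%:M (Ad - _)) subrK.
  rewrite -[1 - _]/(1%:M - _) mulmxBl mul1mx -scalemxAl scalerN.
  by rewrite addrAC addrK.
have E2 : M' *m G = 1 - 'X^N *: (P A') ^+ N := walkgf_mulr A'.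
have E3 := congr1 (mulmx M') hC1.
exists (- ((P A') ^+ N *m Z) - M' *m C1).
move: E3; rewrite mulmxA E2 [M' *m (dp%:M + _)]mulmxDr mul_mx_scalar -scalemxAr -[1 - _]/(1%:M - _).
rewrite mulmxBl mul1mx -scalemxAl => E3.
rewrite -/Z; apply: (addIr ('X^N *: (M' *m C1))); rewrite -E3.
rewrite scalerBr scalerN -!addrA; congr (_ + _).
by rewrite addNr addr0.
Qed.

Theorem walk_update s t l : (l < N)%N ->
  (A' ^+ l) s t = (A ^+ l) s t + (resp s t)`_l.
Proof.
move=> lN; rewrite -!walkgf_coef // -coefD; apply: (@cx_coef _ N) => //.
have entry (d x : {poly F}) (X Y Z W : 'M[{poly F}]_n) :
    d *: X = d *: Y + Z + x *: W -> d * X s t = d * Y s t + Z s t + x * W s t.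
  by move/matrixP/(_ s t); rewrite !mxE.
have [C /entry] := walk_update_mx.
set T := walkgf A *m _ *m _ *m _ => E.
have TE : T s t = \sum_r \sum_c walkgf A s (sv r) * \adj (1%:M - Kp) r c * Yp c t.
  rewrite /T mxE exchange_big; apply: eq_bigr => c _; rewrite mxE mulr_suml.
  apply: eq_bigr => r _; congr (_ * _ * _).
  rewrite mxE (bigD1 (sv r)) //= mxE eqxx mulr1 big1 ?addr0 // => v hv.
  by rewrite mxE (negbTE hv) mulr0.
have cd : cx N (dp * dinvp) 1 by apply: cx_geom dp0.
apply: (@cx_trans _ _ _ (dp * dinvp * walkgf A' s t)).
  by apply: cx_sym; have := cx_mul cd (cx_refl N (walkgf A' s t)); rewrite mul1r.
have -> : dp * dinvp * walkgf A' s t =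
   dp * dinvp * walkgf A s t + resp s t + 'X^N * (C s t * dinvp).
  by rewrite /resp -TE; transitivity (dp * walkgf A' s t * dinvp); [|rewrite E]; ring.
apply: cx_trans (cx_add (cx_refl _ _) (cx_X0 _ _)) _; rewrite addr0.
apply: cx_add (cx_refl _ _).
by have := cx_mul cd (cx_refl N (walkgf A s t)); rewrite mul1r.
Qed.

Lemma size_walkgf B s t : (size (walkgf B s t) <= N)%N.
Proof.
apply/leq_sizeP => j Nj; rewrite /walkgf summxE coef_sum big1 // => i _.
rewrite !mxE coefXnM coefC; case: ltnP => // le; rewrite subn_eq0 ifN //.
by rewrite -ltnNge (leq_trans (ltn_ord i)).
Qed.

(** The truncated inverse of the determinant dominates: powers up to N of a polynomial of degree at
    most k (N + 1). For k <= N = n the bound is cubic in n. *)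
Lemma size_resp s t :
  (size (resp s t) <= (N + k * N.+1 + N.+1 + N * (k * N.+1)).+1)%N.
Proof.
have sM B i j : (size (walkgf B i j) <= N.+1)%N by apply: leqW; apply: size_walkgf.
have sW i j : (size (Wp i j) <= 2)%N.
  rewrite !mxE.
  exact: (@size_mul_bound _ _ _ 1 0) (eq_leq (size_polyX _)) (size_polyC_leq1 _).
have sK i j : (size ((1%:M - Kp) i j)%R <= N.+2)%N.
  rewrite !mxE; apply: leq_trans (size_polyD _ _) _; rewrite size_polyN geq_max.
  apply/andP; split.
    by case: eqP => _; rewrite ?mulr1n ?mulr0n ?size_poly0 ?size_poly1.
  apply: size_sum_bound => c _; rewrite [X in _ * X]mxE.
  exact: (@size_mul_bound _ _ _ 1 N).
have sY i j : (size (Yp i j) <= N.+2)%N.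
  rewrite mxE; apply: size_sum_bound => c _; rewrite [X in _ * X]mxE.
  exact: (@size_mul_bound _ _ _ 1 N).
have sA i j : (size (\adj (1%:M - Kp) i j)%R <= (k * N.+1).+1)%N.
  by apply: leq_trans (size_adj_bound sK i j) _; rewrite ltnS leq_mul2r leq_pred orbT.
have sd : (size dp <= (k * N.+1).+1)%N by apply: size_det_bound.
have sdi : (size dinvp <= (N * (k * N.+1)).+1)%N.
  apply: size_sum_bound => i _; apply: leq_trans (_ : (i * (k * N.+1)).+1 <= _)%N.
    apply: size_exp_bound; apply: leq_trans (size_polyD _ _) _.
    by rewrite size_polyN geq_max size_poly1 sd.
  by rewrite ltnS leq_mul2r ltnW ?orbT.
apply: size_mul_bound => //; apply: size_sum_bound => r _; apply: size_sum_bound => c _.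
by apply: size_mul_bound => //; apply: size_mul_bound.
Qed.

(** Evaluation is a ring morphism and commutes with adjugate and determinant. So the values of the
    response come from a matrix over F, to which Chistov's formula applies. *)
Lemma horner_resp s t a :
  let Ka := map_mx (horner_eval a) Kp in
  (resp s t).[a] = (\sum_r \sum_c (walkgf A s (sv r)).[a] * \adj (1%:M - Ka) r c * (Yp c t).[a])
     * \sum_(i < N) (1 - \det (1%:M - Ka)) ^+ i.
Proof.
move=> Ka; rewrite /resp hornerM.
have KaE : 1%:M - Ka = map_mx (horner_eval a) (1%:M - Kp) by rewrite map_mxB map_mx1.
congr (_ * _).
  rewrite horner_sum; apply: eq_bigr => r _; rewrite horner_sum; apply: eq_bigr => c _.
  by rewrite !hornerM KaE -map_mx_adj [in RHS]mxE.
rewrite /dinvp horner_sum; apply: eq_bigr => i _.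
by rewrite horner_exp hornerD hornerN hornerC KaE det_map_mx.
Qed.
End WalkUpdate.

(** * Power sums and interpolation over a prime field *)

Section PrimeField.
Variables (p : nat) (pp : prime p).

Lemma sum_Fp (R : nmodType) (G : 'F_p -> R) :
  \sum_(a : 'F_p) G a = \sum_(i < p) G (i%:R).
Proof.
pose h (i : 'I_p) : 'F_p := (i : nat)%:R.
have inj : injective h.
  move=> i j /(congr1 val) /=; rewrite !val_Fp_nat // !modn_small //.
  exact: val_inj.
have bij : bijective h by apply: inj_card_bij => //; rewrite (card_Fp pp) card_ord.
by rewrite (reindex h) //; apply: onW_bij.
Qed.

Lemma Fp_fermat (a : 'F_p) : a != 0 -> a ^+ p.-1 = 1.
Proof.
move=> a0; apply: (mulfI a0); rewrite mulr1 -exprS prednK ?prime_gt0 //.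
by have := expf_card a; rewrite card_Fp.
Qed.

Lemma Fp_prim_root : exists g : 'F_p, p.-1.-primitive_root g.
Proof.
pose rs := [seq a <- enum 'F_p | a != 0].
have p1 : (0 < p.-1)%N by rewrite -ltnS prednK ?prime_gt1 // prime_gt0.
have hall : all p.-1.-unity_root rs.
  by apply/allP => a; rewrite mem_filter => /andP[a0 _]; rewrite unity_rootE Fp_fermat.
have hu : uniq rs by rewrite filter_uniq ?enum_uniq.
have hs : (p.-1 <= size rs)%N.
  have E : size rs = #|predC1 (0 : 'F_p)|.
    rewrite -(card_uniqP hu); apply: eq_card => a.
    by rewrite mem_filter mem_enum !inE andbT.
  by rewrite E cardC1 card_Fp.
by have /hasP[g _ hg] := @has_prim_root _ p.-1 rs p1 hall hu hs; exists g.
Qed.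

(** Multiplication by a primitive root g permutes the nonzero elements and multiplies the sum by
    g^e, which differs from 1 unless p - 1 divides e. *)
Lemma Fp_power_sum e : \sum_(a : 'F_p | a != 0) a ^+ e = - ((p.-1 %| e)%N)%:R.
Proof.
case: (boolP (p.-1 %| e)%N) => [/dvdnP[q ->]|nd].
  rewrite (eq_bigr (fun=> 1)) => [|a a0]; last by rewrite mulnC exprM Fp_fermat ?expr1n.
  rewrite sumr_const; have := cardC1 (0 : 'F_p); rewrite card_Fp // => E.
  have -> : #|[pred a : 'F_p | a != 0]| = p.-1 by rewrite -E; apply: eq_card.
  apply/eqP; rewrite -subr_eq0 opprK -natrD addn1 prednK ?prime_gt0 //.
  by rewrite -(Fp_nat_mod pp) modnn.
have [g hg] := Fp_prim_root.
have g0 : g != 0.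
  apply/eqP => g0; have := prim_expr_order hg; rewrite g0 expr0n.
  by have := prime_gt1 pp; case: (p) => [|[|q]] //= _ /eqP; rewrite eq_sym oner_eq0.
set s := \sum_(a | _) _; rewrite oppr0.
have E : s = g ^+ e * s.
  rewrite /s big_distrr /= [LHS](reindex (fun a => g * a)) /=.
    apply: eq_big => [a|a _]; last by rewrite exprMn.
    by rewrite mulf_eq0 (negbTE g0).
  exists (fun a => g^-1 * a) => a _; [exact: mulKf|exact: mulVKf].
have ge : g ^+ e != 1 by rewrite -(prim_order_dvd hg).
apply/eqP; have : (1 - g ^+ e) * s = 0 by rewrite mulrBl mul1r -E subrr.
by move/eqP; rewrite mulf_eq0 subr_eq0 eq_sym (negbTE ge).
Qed.

(** For i, l < p - 1 the exponent i + (p - 1 - l) is a multiple of p - 1 only if i = l, so the power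
    sums isolate one coefficient. *)
Lemma Fp_interpolation (h : {poly 'F_p}) l : (size h <= p.-1)%N -> (l < p.-1)%N ->
  h`_l = - \sum_(a : 'F_p | a != 0) h.[a] * a ^+ (p.-1 - l).
Proof.
move=> hs lp.
under eq_bigr => a _ do rewrite (horner_coef_wide _ hs) mulr_suml.
rewrite exchange_big /= (bigD1 (Ordinal lp)) //= [X in _ + X]big1 => [|i hi].
  under eq_bigr => a _ do rewrite -mulrA -exprD.
  by rewrite -big_distrr /= Fp_power_sum subnKC ?(ltnW lp) // dvdnn addr0 mulrN1 opprK.
under eq_bigr => a _ do rewrite -mulrA -exprD.
rewrite -big_distrr /= Fp_power_sum.
suff -> : (p.-1 %| i + (p.-1 - l))%N = false by rewrite oppr0 mulr0.
apply/negP => /dvdnP[q hq]; have := ltn_ord i; move/eqP: hi => hi ip.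
have qe : q = 1%N by nia.
by apply: hi; apply: val_inj => /=; lia.
Qed.
End PrimeField.
End GeneratingFunctions.

(** * Matrix powers by walk codes *)

Lemma ispow2P y : reflect (exists e, y = 2 ^ e) (ispow2 y).
Proof.
apply: (iffP andP) => [[y0 /ballP h]|[e ->]].
  have /p_natP[e ->] : 2.-nat y; last by exists e.
  apply/pnatP => // q pq qy; rewrite inE /=.
  have := implyP (h q (dvdn_leq y0 qy)) qy.
  case/orP=> [/eqP q1|]; first by rewrite q1 in pq.
  by rewrite dvdn_prime2 // eq_sym.
split; first by rewrite expn_gt0.
apply/ballP => d _; apply/implyP => /(dvdn_pfactor _ _ (isT : prime 2))[j _ ->].
by case: j => [|j]; rewrite ?expn0 ?eqxx // expnS dvdn_mulr ?orbT.
Qed.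

Lemma bsum_add a b F : bsum (a + b) F = bsum a F + bsum b (fun i => F (a + i)).
Proof. exact: big_split_ord. Qed.

Lemma leq_bsum a b F : a <= b -> bsum a F <= bsum b F.
Proof. by move=> ab; rewrite -(subnKC ab) bsum_add leq_addr. Qed.

Lemma count_pow2 e : bsum (2 ^ e) ispow2 = e.
Proof.
elim: e => [|e IH].
  by rewrite /bsum big_ord1 [ispow2]lock /= -lock.
rewrite expnS mul2n -addnn bsum_add IH -[RHS]addn1; congr (_ + _).
have e0 : 0 < 2 ^ e by rewrite expn_gt0.
rewrite (@eq_bsum _ _ (fun z => (z == 0) * 1)) => [|z ze]; first exact: (@sum_ord_eq _ 0 (fun=> 1)).
rewrite muln1; congr nat_of_bool; apply/ispow2P/eqP => [[j hj]|->]; last first.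
  by exists e; rewrite addn0.
have /eqP : trunc_log 2 (2 ^ e + z) == e.
  by apply/eqP; apply: trunc_log_eq => //; rewrite expnS; lia.
by rewrite hj trunc_expnK // => je; rewrite je in hj; lia.
Qed.

Section CodeWidth.
Variable n : nat.
Hypothesis n_gt0 : 0 < n.

Lemma nlog2E : nlog2 n = trunc_log 2 n.
Proof.
set t := trunc_log 2 n.
have t1 : 2 ^ t <= n by apply: trunc_logP.
have t2 : n < 2 ^ t.+1 by apply: trunc_log_ltn.
have E : bsum n.+1 ispow2 = t.+1.
  apply/eqP; rewrite eqn_leq -{1}(count_pow2 t.+1) leq_bsum //=.
  apply: (@leq_trans (bsum (2 ^ t).+1 ispow2)); last by apply: leq_bsum.
  rewrite bsumS count_pow2; have -> : ispow2 (2 ^ t) by apply/ispow2P; exists t.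
  by rewrite addn1.
apply/eqP; rewrite -eqSS -E.
have -> : bsum n.+1 ispow2 = nlog2 n + bsum n.+1 (fun y => (y == 1) * 1).
  rewrite /nlog2 /bsum -big_split; apply: eq_bigr => y _ /=; rewrite muln1.
  have : ispow2 1 by apply/ispow2P; exists 0.
  by case: (y : nat) => [|[|z]] h; rewrite ?h ?addn0.
by rewrite /bsum (@sum_ord_eq _ 1 (fun=> 1)) ?addn1.
Qed.

Lemma wid_bounds : wid n * wid n <= trunc_log 2 n < (wid n).+1 * (wid n).+1.
Proof.
have [s /andP[h1 h2]] := sqrt_exists (trunc_log 2 n).
suff -> : wid n = s by rewrite h1.
rewrite /wid nlog2E (@eq_bsum _ _ (fun i => i < s)) => [|i _].
  by rewrite /bsum sum_ord_ltn; apply/minn_idPl; nia.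
by congr nat_of_bool; apply/idP/idP => h; nia.
Qed.

Lemma pow2E e : 2 ^ e <= n -> pow2 n e = 2 ^ e.
Proof.
move=> en; rewrite /pow2 (@eq_bsum _ _ (fun y => (y == 2 ^ e) * y)) => [|y _].
  by rewrite /bsum (@sum_ord_eq _ (2 ^ e) id).
congr (nat_of_bool _ * _); apply/andP/eqP => [[/ispow2P[j ->]]|->].
  by rewrite count_pow2 => /eqP->.
by split; [apply/ispow2P; exists e|rewrite count_pow2].
Qed.

Lemma pow2_wid d : d <= wid n -> pow2 n (wid n * d) = (2 ^ wid n) ^ d.
Proof.
move=> dw; rewrite -expnM; apply: pow2E.
have /andP[h _] := wid_bounds.
apply: leq_trans (trunc_logP (isT : 1 < 2) n_gt0); rewrite leq_exp2l //; nia.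
Qed.

Definition digit B z i := z %/ B ^ i %% B.

Lemma dgE z i : i <= wid n -> 0 < wid n -> dg n z i = digit (2 ^ wid n) z i.
Proof.
move=> iw w0; rewrite /dg pow2_wid // /digit; congr (_ %% _).
by have := pow2_wid w0; rewrite muln1 expn1.
Qed.
End CodeWidth.

(** Matrix powers over the natural numbers: their residues give the powers over F_p and their
    positivity the Boolean powers. *)
Fixpoint npow (k : nat) (Q : nat -> nat -> nat) (d u v : nat) : nat :=
  if d is d'.+1 then \sum_(c < k) npow k Q d' u c * Q c v else u == v.

Section WalkCodes.
Variables (B k : nat) (Q : nat -> nat -> nat).
Hypothesis kB : k <= B.

Definition pos u z i := if i == 0 then u else digit B z i.-1.
Definition code_sum d u v := \sum_(z < B ^ d)
  (ball d (fun i => digit B z i < k) && (pos u z d == v)) *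
  \prod_(i < d) Q (pos u z i) (pos u z i.+1).

Lemma digit_lo d y z i : i < d -> digit B (y * B ^ d + z) i = digit B z i.
Proof.
move=> id; rewrite /digit; case: (posnP B) => [->|B0]; first by rewrite [0 ^ d]exp0n ?muln0 ?(leq_ltn_trans _ id).
rewrite -(subnKC id) expnD expnSr.
have -> : y * (B ^ i * B * B ^ (d - i.+1)) = y * B ^ (d - i.+1) * B * B ^ i by lia.
by rewrite divnMDl ?expn_gt0 ?B0 // modnMDl.
Qed.

Lemma digit_hi d y z : y < B -> z < B ^ d -> digit B (y * B ^ d + z) d = y.
Proof.
move=> yB zB; rewrite /digit divnMDl ?(leq_ltn_trans _ zB) //.
by rewrite divn_small // addn0 modn_small.
Qed.

(** The leading digit of a code is the last vertex. The condition fixes it to v, and the other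
    digits code the walk to the predecessor of v. *)
Lemma code_sumE d u v : u < k -> v < k -> code_sum d u v = npow k Q d u v.
Proof.
move=> uk; elim: d v => [|d IH] v vk.
  by rewrite /code_sum expn0 big_ord1 big_ord0 muln1.
transitivity (\sum_(c < k) code_sum d u c * Q c v); last first.
  by apply: eq_bigr => c _; rewrite IH.
rewrite /code_sum expnS
  (sum_ord_mul B (B ^ d) (fun z => (ball d.+1 (fun i => digit B z i < k) &&
     (pos u z d.+1 == v)) * \prod_(i < d.+1) Q (pos u z i) (pos u z i.+1))).
pose ok z := ball d (fun i => digit B z i < k).
pose w z := \prod_(i < d) Q (pos u z i) (pos u z i.+1).
transitivity (\sum_(z < B ^ d) ok z * w z * Q (pos u z d) v).
  rewrite exchange_big; apply: eq_bigr => z _ /=.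
  rewrite -[RHS](@sum_ord_eq B v (fun y => ok z * w z * Q (pos u z d) y));
    last exact: leq_trans kB.
  apply: eq_bigr => y _.
  have pE i : i <= d -> pos u (y * B ^ d + z) i = pos u z i.
    by case: i => // i id; rewrite /pos /= digit_lo.
  have pE2 : pos u (y * B ^ d + z) d.+1 = y by rewrite /pos /= digit_hi.
  rewrite big_ord_recr /= pE2 pE // (eq_bigr (fun i : 'I_d => Q (pos u z i) (pos u z i.+1))).
    rewrite -/(w z); case: (eqVneq (y : nat) v) => [yv|]; last by rewrite andbF.
    rewrite andbT mul1n mulnA; congr (nat_of_bool _ * _ * _).
    apply/ballP/ballP => h i id.
      by have := h i (ltnW id); rewrite digit_lo.
    case: (ltnP i d) => id2; first by rewrite digit_lo // h.
    have -> : i = d by lia.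
    by rewrite digit_hi // yv.
  by move=> i _; rewrite !pE // ltnW.
rewrite (eq_bigr (fun c : 'I_k => \sum_(z < B ^ d) (ok z && (pos u z d == c)) * w z * Q c v));
  last by move=> c _; rewrite big_distrl.
rewrite exchange_big; apply: eq_bigr => z _ /=.
case okz: (ok z) => /=; last by rewrite big1.
have pk : pos u z d < k.
  rewrite /pos; case: eqP => [//|/eqP d0].
  by rewrite (ballP _ _ okz) // prednK // lt0n.
rewrite -(@sum_ord_eq k (pos u z d) (fun c => true * w z * Q c v)) //.
by apply: eq_bigr => c _; rewrite eq_sym; case: eqP; rewrite ?mul1n ?mul0n.
Qed.
End WalkCodes.

Lemma npow_add k Q i j u v : u < k -> v < k ->
  npow k Q (i + j) u v = \sum_(c < k) npow k Q i u c * npow k Q j c v.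
Proof.
move=> uk; elim: j v => [|j IH] v vk.
  rewrite addn0 /= -(@sum_ord_eq k v (npow k Q i u)) //.
  by apply: eq_bigr => c _; rewrite mulnC.
rewrite addnS /=.
transitivity (\sum_(c < k) (\sum_(a < k) npow k Q i u a * npow k Q j a c) * Q c v).
  by apply: eq_bigr => c _; rewrite IH.
under [RHS]eq_bigr => c _ do rewrite big_distrr /=.
rewrite exchange_big; apply: eq_bigr => c _; rewrite big_distrl.
by apply: eq_bigr => a _; rewrite /= mulnA.
Qed.

Lemma npow_mul k Q i j u v : u < k -> v < k ->
  npow k Q (j * i) u v = npow k (npow k Q i) j u v.
Proof.
move=> uk; elim: j v => [|j IH] v vk //.
rewrite mulSnr npow_add //=; apply: eq_bigr => c _.
by rewrite IH.
Qed.

Section PowerCorrect.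
Variables (n : nat) (pt : nat -> nat -> nat -> nat) (p k : nat).
Hypotheses (n_gt0 : 0 < n) (w_gt0 : 0 < wid n) (kB : k <= 2 ^ wid n).
(** Instantiated twice: by equality in F_p and, for the modulus 0, by agreement on being positive,
    which is arithmetic in the Boolean semiring. *)
Variable eqv : nat -> nat -> Prop.
Hypotheses (eqv_refl : forall x, eqv x x)
  (eqv_trans : forall x y z, eqv x y -> eqv y z -> eqv x z)
  (eqv_add : forall x y x' y', eqv x x' -> eqv y y' -> eqv (x + y) (x' + y'))
  (eqv_mul : forall x y x' y', eqv x x' -> eqv y y' -> eqv (x * y) (x' * y'))
  (eqv_red : forall x, eqv (red p x) x)
  (eqv_prd : forall d f, eqv (prd pt p d f) (\prod_(i < d) f i)).

Lemma eqv_sum b (f g : 'I_b -> nat) : (forall i, eqv (f i) (g i)) ->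
  eqv (\sum_i f i) (\sum_i g i).
Proof. by move=> h; elim/big_rec2: _ => // i x y _ hxy; apply: eqv_add. Qed.

Lemma eqv_npow Q Q' d u v : (forall a b, a < k -> b < k -> eqv (Q a b) (Q' a b)) ->
  u < k -> v < k -> eqv (npow k Q d u v) (npow k Q' d u v).
Proof.
move=> h uk; elim: d v => [|d IH] v vk //=.
by apply: eqv_sum => c; apply: eqv_mul; [apply: IH|apply: h].
Qed.

Lemma spowE Q d u v : d <= wid n -> u < k -> v < k ->
  eqv (spow n pt p k Q d u v) (npow k Q d u v).
Proof.
move=> dw uk vk; rewrite /spow -(code_sumE Q kB d uk vk); apply: eqv_trans (eqv_red _) _.
rewrite /code_sum /bsum pow2_wid //; apply: eqv_sum => z.
have posE i : i <= d -> walkv n u z i = pos (2 ^ wid n) u z i.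
  by case: i => // i id; rewrite /walkv /pos /= dgE //; lia.
have -> : ball d (fun i => dg n z i < k) = ball d (fun i => digit (2 ^ wid n) z i < k).
  by apply: eq_in_all => i; rewrite mem_iota => id; rewrite dgE //; lia.
rewrite posE //; apply: eqv_mul => //; apply: eqv_trans (eqv_prd _ _) _.
suff -> : \prod_(i < d) Q (walkv n u z i) (walkv n u z i.+1) =
  \prod_(i < d) Q (pos (2 ^ wid n) u z i) (pos (2 ^ wid n) u z i.+1) by [].
by apply: eq_bigr => i _; rewrite !posE // ltnW.
Qed.

Lemma mpowE J Q i u v : i < wid n ^ J.+1 -> u < k -> v < k ->
  eqv (mpow n pt p k J Q i u v) (npow k Q i u v).
Proof.
elim: J Q i u v => [|J IH] Q i u v iw uk vk.
  by apply: spowE => //; rewrite -ltnS ltnW // ltnS -[wid n]expn1.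
rewrite /mpow -/mpow; apply: eqv_trans (eqv_red _) _.
rewrite [in X in eqv _ X](divn_eq i (wid n)) npow_add //.
apply: eqv_sum => c; apply: eqv_mul; last by apply: spowE => //; rewrite ltnW // ltn_mod.
rewrite npow_mul //; apply: eqv_trans (IH _ _ _ _ _ _ _) _ => //.
  by rewrite ltn_divLR // -expnSr.
by apply: eqv_npow => // a b ak bk; apply: spowE.
Qed.
End PowerCorrect.

Section Selection.
Variables (n : nat) (S : nat -> bool).

Lemma sel_spec r : r < nsel n S ->
  [/\ sel n S r < n, S (sel n S r) & bsum (sel n S r) S = r].
Proof.
move=> rn; have ex : exists2 v, v < n & S v && (bsum v S == r).
  move: rn; rewrite /nsel; elim: n => [|m IH]; first by rewrite bsum0.
  rewrite bsumS; case: (ltnP r (bsum m S)) => [/IH[v vm h] _|le lt].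
    by exists v => //; apply: ltnW.
  by exists m => //; case: (S m) lt; lia.
by have [h1 /andP[h2 /eqP h3] _] := bminP ex.
Qed.

Lemma rank_lt v : v < n -> S v -> bsum v S < nsel n S.
Proof.
move=> vn Sv; apply: (@leq_trans (bsum v.+1 S)); last exact: leq_bsum.
by rewrite bsumS Sv addn1.
Qed.

Lemma rank_inj u v : S u -> S v -> bsum u S = bsum v S -> u = v.
Proof.
wlog le : u v / u <= v => [H|] Su Sv E.
  by case/orP: (leq_total u v) => h; [|apply/esym]; apply: H.
move: le; rewrite leq_eqVlt => /orP[/eqP//|lt].
have := @leq_bsum u.+1 v S lt; rewrite bsumS Su; lia.
Qed.

Lemma sel_rank v : v < n -> S v -> sel n S (bsum v S) = v.
Proof.
move=> vn Sv; have [_ h1 h2] := sel_spec (rank_lt vn Sv).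
exact: rank_inj.
Qed.
End Selection.

(** * Correctness of the update modulo a prime *)

Section PrimeModulus.
Import GRing.Theory.
Local Open Scope ring_scope.

Section Link.
Variables (n p : nat) (pt : nat -> nat -> nat -> nat).
Hypotheses (pp : prime p) (p2 : (2 < p)%N).
Hypothesis ptE : forall a x, (a < p)%N -> (x < p)%N -> pt p a x = (a ^ x %% p)%N.
Local Notation "x %:fp" := (x%:R : 'F_p) (at level 1, format "x %:fp").

Let p0 : (0 < p)%N := prime_gt0 pp.

Lemma natF_mod x : (x %% p)%:fp = x%:fp.
Proof. exact: Fp_nat_mod. Qed.

Lemma natF_inj x y : (x < p)%N -> (y < p)%N -> x%:fp = y%:fp -> x = y.
Proof.
move=> xp yp /(congr1 val) /=; by rewrite !val_Fp_nat // !modn_small.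
Qed.

Lemma natF_eq0 x : (x%:fp == 0) = (x %% p == 0)%N.
Proof.
apply/eqP/eqP => [h|h]; last by rewrite -natF_mod h.
by apply: natF_inj; rewrite ?ltn_mod // natF_mod.
Qed.

Lemma FofN (a : 'F_p) : exists2 x, (x < p)%N & a = x%:fp.
Proof.
exists (val a); last by rewrite natr_Zp.
by have := ltn_ord a; rewrite [X in (_ < X)%N]Fp_cast.
Qed.

Lemma natF_opp x : (x <= p)%N -> (p - x)%:fp = - x%:fp.
Proof.
move=> xp; rewrite natrB // -(natF_mod p) modnn sub0r //.
Qed.

Lemma natF_pred : p.-1%:fp = -1.
Proof. by rewrite -subn1 natF_opp // prime_gt0. Qed.

Lemma ptF a x : (a < p)%N -> (x < p)%N -> (pt p a x)%:fp = a%:fp ^+ x.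
Proof. by move=> ap xp; rewrite ptE // natF_mod natrX. Qed.

Lemma pt_lt a x : (a < p)%N -> (x < p)%N -> (pt p a x < p)%N.
Proof. by move=> ap xp; rewrite ptE // ltn_mod. Qed.

Lemma gen_spec : (gen pt p < p)%N /\ forall x, (0 < x < p)%N ->
  exists2 y, (y < p.-1)%N & pt p (gen pt p) y = x.
Proof.
have [g0 hg] := Fp_prim_root pp; have [g gp gE] := FofN g0.
have ex : exists2 g, (g < p)%N & ball p (fun x =>
  (0 < x)%N ==> bex p.-1 (fun y => pt p g y == x)).
  exists g => //; apply/ballP => x xp; apply/implyP => x0; apply/bexP.
  have xF : x%:fp ^+ p.-1 = 1.
    by apply: Fp_fermat => //; rewrite natF_eq0 modn_small // -lt0n.
  have [i hi] := prim_rootP hg xF; exists i => //.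
  have ip : (i < p)%N by apply: leq_trans (ltn_ord i) (leq_pred _).
  by apply/eqP/natF_inj => //; rewrite ?pt_lt // ptF // -gE.
have [h1 /ballP h2 _] := bminP ex; split=> // x /andP[x0 xp].
by have /bexP[y yp /eqP] := implyP (h2 x xp) x0; exists y.
Qed.

Lemma dlog_spec x : (x %% p != 0)%N ->
  (dlog pt p x < p.-1)%N /\ pt p (gen pt p) (dlog pt p x) = (x %% p)%N.
Proof.
move=> x0; have [_ h] := gen_spec.
have [|y yp hy] := h (x %% p)%N; first by rewrite lt0n x0 ltn_mod.
have ex : exists2 y, (y < p.-1)%N & pt p (gen pt p) y == (x %% p)%N.
  by exists y => //; apply/eqP.
by have [h1 /eqP h2 _] := bminP ex.
Qed.

Lemma genF_fermat : (gen pt p)%:fp ^+ p.-1 = 1.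
Proof.
have [gp h] := gen_spec; apply: Fp_fermat => //; apply/negP => /eqP g0.
(* The powers of 0 are only 0 and 1, so a generator divisible by p would miss the residue 2. *)
have [|y yp hy] := h 2%N; first by rewrite p2.
have yp' : (y < p)%N by apply: leq_trans yp (leq_pred _).
have := ptF gp yp'; rewrite hy g0; case: y {hy yp yp'} => [|y].
  by rewrite expr0 => /(natF_inj p2 (ltnW p2)).
by rewrite expr0n /= => /eqP; rewrite natF_eq0 modn_small.
Qed.

Lemma prodm_lt d f : (prodm pt p d f < p)%N.
Proof.
rewrite /prodm; case: ifP => // _; have [gp _] := gen_spec; apply: pt_lt => //.
apply: leq_trans (ltn_pmod _ _) (leq_pred _); lia.
Qed.

Lemma prodmE d f : (prodm pt p d f)%:fp = \prod_(i < d) (f i)%:fp.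
Proof.
rewrite /prodm; case: bexP => [[i id h]|h].
  by apply/esym/eqP; rewrite prodf_seq_eq0; apply/hasP; exists (Ordinal id);
    rewrite ?mem_index_enum //= natF_eq0.
have h' i : (i < d)%N -> (f i %% p != 0)%N.
  by move=> id; apply/negP => fi; apply: h; exists i.
have [gp _] := gen_spec.
have p1 : (0 < p.-1)%N by lia.
rewrite ptF //; last by apply: leq_trans (ltn_pmod _ p1) (leq_pred _).
have -> : forall e, (gen pt p)%:fp ^+ (e %% p.-1) = (gen pt p)%:fp ^+ e.
  by move=> e; rewrite [in RHS](divn_eq e p.-1) exprD mulnC exprM genF_fermat expr1n mul1r.
rewrite /bsum expr_sum; apply: eq_bigr => i _.
have [h1 h2] := dlog_spec (h' i (ltn_ord i)).
by rewrite -ptF ?h2 ?natF_mod //; apply: leq_trans h1 (leq_pred _).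
Qed.

Lemma npow_mx k (Q : nat -> nat -> nat) i (u v : 'I_k) :
  (npow k Q i u v)%:fp = ((\matrix_(r < k, c < k) (Q r c)%:fp) ^+ i) u v.
Proof.
elim: i v => [|i IH] v; first by rewrite expr0 mxE.
rewrite exprSr mxE /= natr_sum; apply: eq_bigr => c _.
by rewrite natrM IH mxE.
Qed.

Hypotheses (n_gt0 : (0 < n)%N) (w_gt0 : (0 < wid n)%N).

Lemma mpowF J k Q i (u v : 'I_k) : (k <= 2 ^ wid n)%N -> (i < wid n ^ J.+1)%N ->
  (mpow n pt p k J Q i u v)%:fp = ((\matrix_(r < k, c < k) (Q r c)%:fp) ^+ i) u v.
Proof.
move=> kB iw; rewrite -npow_mx.
apply: (@mpowE n pt p k n_gt0 w_gt0 kB (fun x y => x%:fp = y%:fp)) => //.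
- by move=> x y z -> ->.
- by move=> x y x' y' hx hy; rewrite !natrD hx hy.
- by move=> x y x' y' hx hy; rewrite !natrM hx hy.
- by move=> x; rewrite /red gtn_eqF // natF_mod.
- by move=> d f; rewrite /prd gtn_eqF // prodmE natr_prod.
Qed.

Lemma interpF l h (H : {poly 'F_p}) : (size H <= p.-1)%N -> (l < p.-1)%N ->
  (forall a, (a < p)%N -> (h a)%:fp = H.[a%:fp]) -> (interp pt p l h)%:fp = H`_l.
Proof.
move=> hs lp hH; rewrite (Fp_interpolation pp hs lp) /interp natF_mod natrM natF_pred.
rewrite mulN1r; congr (- _); rewrite [RHS]big_mkcond (sum_Fp pp) /bsum natr_sum.
apply: eq_bigr => a _; rewrite natrM natF_eq0 modn_small // -lt0n.
case: posnP => a0; first by rewrite mul0r.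
by rewrite mul1r natrM hH // ptF //; lia.
Qed.

Section Adj.
Variables (J k : nat) (Q : nat -> nat -> nat).
Hypotheses (kB : (k <= 2 ^ wid n)%N) (kw : (k < wid n ^ J.+1)%N).
Hypothesis kp : ((k * (k * k)).+1 <= p.-1)%N.
Let A : 'M['F_p]_k := \matrix_(r, c) (Q r c)%:fp.

Let k_lt : (k < p)%N.
Proof. by case: (k) kp => [|j]; nia. Qed.

Lemma FvalF (l : 'I_k) z : (z < p)%N ->
  (Fval n pt J p k Q l z)%:fp = (Fpoly A l).[z%:fp].
Proof.
move=> zp; rewrite /Fval natF_mod /bsum natr_sum /Fpoly horner_sum.
apply: eq_bigr => j _; rewrite natrM hornerM hornerC hornerXn.
rewrite ptF //; last by apply: leq_ltn_trans k_lt; rewrite -ltnS.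
congr (_ * _); rewrite mpowF //; last by apply: leq_ltn_trans kw; rewrite -ltnS.
suff -> : lead_block A l.+1 = \matrix_(r, c) (minor Q l r c)%:fp by [].
apply/matrixP => r c; rewrite !mxE /minor !ltnS.
by case: (_ && _); rewrite ?mul1n.
Qed.

Lemma HvalF z : (z < p)%N -> (Hval n pt J p k Q z)%:fp = (Hpoly A).[z%:fp].
Proof.
move=> zp; rewrite /Hval natF_mod /bsum natr_sum /Hpoly horner_sum.
apply: eq_bigr => i _; rewrite ptF ?ltn_mod //; last by apply: leq_ltn_trans k_lt; rewrite -ltnS.
rewrite natF_mod natrD natF_opp ?(ltnW (prodm_lt _ _)) // prodmE.
rewrite horner_exp hornerD hornerN hornerC horner_prod; congr ((_ - _) ^+ _).
by apply: eq_bigr => l _; rewrite FvalF.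
Qed.

(** The degree is that of at most k-th powers of a product of k polynomials of degree at most k. *)
Lemma size_Hpoly : (size (Hpoly A) <= p.-1)%N.
Proof.
apply: leq_trans kp; apply: size_sum_bound => i _.
apply: leq_trans (_ : (i * (k * k)).+1 <= _)%N.
  apply: size_exp_bound; apply: leq_trans (size_polyD _ _) _.
  rewrite size_polyN geq_max size_poly1 /=.
  have := @size_prod_bound 'F_p _ predT (Fpoly A) k; rewrite card_ord; apply=> l _.
  apply: size_sum_bound => j _; apply: leq_trans (_ : (0 + j).+1 <= _)%N.
    by apply: size_mul_bound; rewrite ?size_polyC_leq1 ?size_polyXn.
  by rewrite add0n ltnS -ltnS.
by rewrite ltnS leq_mul2r -ltnS ltn_ord orbT.
Qed.

Lemma ecoefF j : (j <= k)%N -> (ecoef n pt J p k Q j)%:fp = (\det (charB A))`_j.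
Proof.
move=> jk; rewrite -Hpoly_coef //; apply: interpF; first exact: size_Hpoly.
  by apply: leq_ltn_trans jk _; case: (k) kp => [|i]; nia.
exact: HvalF.
Qed.

Lemma adjvF (r c : 'I_k) : (adjv n pt J p k Q r c)%:fp = \adj (1%:M - A) r c.
Proof.
rewrite /adjv natF_mod adj_sub1 /bsum natr_sum; apply: eq_bigr => i _.
rewrite natr_sum; apply: eq_bigr => j _; rewrite natrM ecoefF; last first.
  by apply: leq_trans (ltnW (ltn_ord j)) (leq_subr _ _).
by rewrite mpowF // (ltn_trans _ kw).
Qed.

Lemma detvF : (detv n pt J p k Q)%:fp = \det (1%:M - A).
Proof.
rewrite /detv natF_mod det_sub1 /bsum natr_sum; apply: eq_bigr => j _.
by rewrite ecoefF // -ltnS.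
Qed.

Lemma detv_lt : (detv n pt J p k Q < p)%N.
Proof. by rewrite /detv ltn_mod. Qed.
End Adj.

Section Upd.
Variables (J : nat) (mt : nat -> nat -> nat -> nat) (ed bs : nat -> nat -> bool).
Variable Sv : nat -> bool.
Local Notation k := (nsel n Sv).
Hypotheses (kB : (k <= 2 ^ wid n)%N) (kw : (k < wid n ^ J.+1)%N).
Hypothesis hp : (n ^ 4 + 5 * n ^ 3 + 10 < p)%N.
Hypothesis mtE : forall s t l, (s < n)%N -> (t < n)%N -> (l < n)%N ->
  mt s t l = (npow n bs l s t %% p)%N.
Hypothesis hS : forall u v, (u < n)%N -> (v < n)%N -> ed u v != bs u v -> Sv u && Sv v.

Let A : 'M['F_p]_n := \matrix_(u, v) (bs u v)%:fp.
Let A' : 'M['F_p]_n := \matrix_(u, v) (ed u v)%:fp.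

Let sel_ltn (r : 'I_k) : (sel n Sv r < n)%N.
Proof. by have [] := sel_spec (ltn_ord r). Qed.
Let sv (r : 'I_k) : 'I_n := Ordinal (sel_ltn r).
Let delta : 'M['F_p]_k := \matrix_(r, c) (A' (sv r) (sv c) - A (sv r) (sv c)).

Let k_le : (k <= n)%N.
Proof.
rewrite /nsel /bsum -[X in (_ <= X)%N]card_ord -sum1_card.
by apply: leq_sum => i _; case: (Sv i).
Qed.

Let n_lt : (n.+1 < p)%N.
Proof. by apply: leq_trans hp; rewrite !expnS; nia. Qed.

Let sv_inj : injective sv.
Proof.
move=> r c /(congr1 val)/= h; have [_ _ hr] := sel_spec (ltn_ord r).
by have [_ _ hc] := sel_spec (ltn_ord c); apply: val_inj; rewrite /= -hr -hc h.
Qed.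

Let svP (u : 'I_n) : Sv u -> exists r, sv r = u.
Proof.
move=> Su; exists (Ordinal (rank_lt (ltn_ord u) Su)); apply: val_inj => /=.
exact: sel_rank.
Qed.

Let A'E : A' = A + selmx sv 'F_p *m delta *m (selmx sv 'F_p)^T.
Proof.
apply/matrixP => u v; rewrite [RHS]mxE; apply/eqP; rewrite addrC -subr_eq; apply/eqP.
rewrite [RHS]mxE.
have entry c : (selmx sv 'F_p *m delta) u c * (selmx sv 'F_p)^T c v =
   \sum_r (u == sv r)%:R * delta r c * (v == sv c)%:R.
  by rewrite !mxE mulr_suml; apply: eq_bigr => r _; rewrite !mxE.
rewrite (eq_bigr _ (fun c _ => entry c)).
case: (boolP (Sv u && Sv v)) => [/andP[/svP[r <-] /svP[c <-]]|nS].
  rewrite (bigD1 c) //= (bigD1 r) //= !eqxx mul1r mulr1 !big1 ?addr0 ?mxE //.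
    move=> c' hc; rewrite big1 // => r' _.
    by rewrite !(inj_eq sv_inj) (eq_sym c c') (negbTE hc) mulr0.
  by move=> r' hr; rewrite !(inj_eq sv_inj) (eq_sym r r') (negbTE hr) !mul0r.
have -> : A' u v - A u v = 0.
  rewrite !mxE; case: (eqVneq (ed u v) (bs u v)) => [->|/hS h]; first by rewrite subrr.
  by rewrite h in nS.
rewrite big1 // => c _; rewrite big1 // => r _.
case: (eqVneq u (sv r)) => [ur|]; last by rewrite !mul0r.
case: (eqVneq v (sv c)) => [vc|]; last by rewrite mulr0.
move: nS; rewrite ur vc /=; have [_ -> _] := sel_spec (ltn_ord r).
by have [_ -> _] := sel_spec (ltn_ord c).
Qed.

Let mvalF (s t : 'I_n) a : (a < p)%N ->
  (mval n pt p mt s t a)%:fp = (walkgf n A s t).[a%:fp].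
Proof.
move=> ap; rewrite /mval natF_mod /bsum natr_sum.
rewrite (horner_coef_wide _ (size_walkgf n A s t)); apply: eq_bigr => l _.
rewrite natrM ptF //; last by apply: ltn_trans (ltn_ord l) (ltnW n_lt).
by rewrite walkgf_coef // mtE // natF_mod npow_mx.
Qed.

Let dltF (u v : 'I_n) : (dlt p ed bs u v)%:fp = A' u v - A u v.
Proof. by rewrite /dlt natrD natrM natF_pred mulN1r !mxE. Qed.

Let Ka a := map_mx (horner_eval a%:fp) (Kp n A sv delta).

Let KvalF a (r c : 'I_k) : (a < p)%N ->
  (Kval n pt p mt ed bs Sv a r c)%:fp = Ka a r c.
Proof.
move=> ap; rewrite mxE [RHS]horner_evalE mxE horner_sum /Kval natF_mod /bsum natr_sum.
apply: eq_bigr => y _; rewrite !mxE !hornerM hornerX hornerC !natrM.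
by rewrite -[sel n Sv r]/(val (sv r)) -[sel n Sv y]/(val (sv y))
  -[sel n Sv c]/(val (sv c)) mvalF // dltF !mxE.
Qed.

Let vvalF a (c : 'I_k) (t : 'I_n) : (a < p)%N ->
  (vval n pt p mt ed bs Sv a c t)%:fp = (Yp n A sv delta c t).[a%:fp].
Proof.
move=> ap; rewrite mxE horner_sum /vval natF_mod /bsum natr_sum.
apply: eq_bigr => y _; rewrite !mxE !hornerM hornerX hornerC !natrM.
by rewrite -[sel n Sv c]/(val (sv c)) -[sel n Sv y]/(val (sv y)) mvalF // dltF !mxE.
Qed.

Let kp3 : ((k * (k * k)).+1 <= p.-1)%N.
Proof.
have : (k * (k * k) <= n * (n * n))%N by rewrite !leq_mul.
by move: hp; rewrite !expnS; nia.
Qed.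

Let KmxE a : (a < p)%N ->
  \matrix_(r < k, c < k) (Kval n pt p mt ed bs Sv a r c)%:fp = Ka a.
Proof. by move=> ap; apply/matrixP => r c; rewrite mxE KvalF. Qed.

Let resF (s t : 'I_n) a : (a < p)%N ->
  ((numv n pt J p mt ed bs Sv a s t * dinvv n pt J p mt ed bs Sv a) %% p)%:fp =
  (resp n A sv delta s t).[a%:fp].
Proof.
move=> ap; rewrite natF_mod natrM horner_resp; congr (_ * _).
  rewrite /numv natF_mod /bsum natr_sum; apply: eq_bigr => r _.
  rewrite natr_sum; apply: eq_bigr => c _; rewrite !natrM vvalF // adjvF //.
  by rewrite -[sel n Sv r]/(val (sv r)) mvalF // KmxE.
rewrite /dinvv natF_mod /bsum natr_sum; apply: eq_bigr => i _.
rewrite ptF ?ltn_mod //; last by apply: ltn_trans (ltn_ord i) (ltnW n_lt).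
by rewrite natF_mod natrD natF_opp ?(ltnW (detv_lt _ _ _)) // detvF // KmxE.
Qed.

Theorem mnew_correct s t l : (s < n)%N -> (t < n)%N -> (l < n)%N ->
  mnew n pt J p mt ed bs Sv s t l = (npow n ed l s t %% p)%N.
Proof.
move=> sn tn ln; apply: natF_inj; rewrite /mnew ?ltn_mod // !natF_mod natrD.
rewrite mtE // natF_mod -[s]/(val (Ordinal sn)) -[t]/(val (Ordinal tn)) !npow_mx.
rewrite [RHS](@walk_update _ _ _ n _ _ _ _ A'E) //; congr (_ + _); apply: interpF.
- apply: leq_trans (size_resp n A sv delta _ _) _.
  have h1 : (k * n.+1 <= n * n.+1)%N by rewrite leq_mul2r k_le orbT.
  have h2 : (n * (k * n.+1) <= n * (n * n.+1))%N by rewrite leq_mul2l h1 orbT.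
  by move: hp; rewrite !expnS; nia.
- by have := n_lt; lia.
- by move=> a ap; apply: resF.
Qed.
End Upd.
End Link.
End PrimeModulus.

(** * Walk counts and the queries *)

Lemma prod_primes_logn N : 0 < N -> N = \prod_(q <- primes N) q ^ logn q N.
Proof.
by move=> N0; rewrite {1}(prod_prime_decomp N0) prime_decompE big_map.
Qed.

(** Each prime contributes at most 2k to the factorisation. Against the lower bound 2^k this forces
    many primes up to 2k, as in Chebyshev's estimate. *)
Lemma central_bin_le k : 0 < k -> 'C(k.*2, k) <= k.*2 ^ size (primes 'C(k.*2, k)).
Proof.
move=> k0; have C0 : 0 < 'C(k.*2, k) by rewrite bin_gt0; lia.
rewrite {1}(prod_primes_logn C0).
have : all prime (primes 'C(k.*2, k)).
  by apply/allP => q; rewrite mem_primes => /and3P[].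
elim: (primes _) => [|q s IH] /=; first by rewrite big_nil.
case/andP=> pq /IH h; rewrite big_cons expnS leq_mul //.
exact: logn_central_bin.
Qed.

Lemma exp_size_primes N : 0 < N -> 2 ^ size (primes N) <= N.
Proof.
move=> N0; rewrite {2}(prod_primes_logn N0).
have : all (fun q => 2 <= q ^ logn q N) (primes N).
  apply/allP => q qN; have lq : 0 < logn q N by rewrite logn_gt0.
  move: qN; rewrite mem_primes => /and3P[/prime_gt1 q1 _ _].
  apply: (@leq_trans (q ^ 1)); first by rewrite expn1.
  by apply: leq_pexp2l => //; apply: ltnW.
elim: (primes _) => [|q s IH] /=; first by rewrite big_nil.
by case/andP=> h /IH; rewrite big_cons expnS => h2; apply: leq_mul.
Qed.

(** Exceeds the size of every polynomial that is interpolated modulo p, see [size_resp] and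
    [size_Hpoly]. *)
Definition plow n := n ^ 4 + 5 * n ^ 3 + 10.
(** Numbers in the tables are below n^7, because the primes are taken from C(2k, k) with k = n^6 and
    so are at most 2 n^6. *)
Definition pdig := 7.
Definition good_prime n p := prime p && (plow n < p).

(** Otherwise each prime divisor of C(2k, k), k = n^6, is at most [plow n] or divides N. At most n^2
    primes divide N <= n^n <= 2^(n^2), and each prime contributes at most 2k <= 2^n. So 2^k would be
    at most 2^(n (plow n + 1 + n^2)), where the exponent has degree 5 in n instead of 6. *)
Lemma good_prime_exists : exists n0, forall n N, n0 <= n -> 0 < N -> N <= n ^ n ->
  exists p, [/\ p < n ^ pdig, good_prime n p & ~~ (p %| N)].
Proof.
have [n0 hn0] := exp_dominates 2 0 6.
exists (maxn n0 20) => n N; rewrite geq_max => /andP[/hn0 + n20 N0 Nn].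
rewrite addn0 => n6.
pose k := n ^ 6; have k0 : 0 < k by rewrite expn_gt0; lia.
have kn : k.*2 < n ^ pdig by rewrite /pdig /k expnS -mul2n ltn_mul2r k0; lia.
have k2 : k.*2 <= 2 ^ n by rewrite -mul2n ltnW.
case: (boolP (has (fun p => (plow n < p) && ~~ (p %| N)) (primes 'C(k.*2, k)))) => [|/hasPn hn].
  case/hasP=> p; rewrite mem_primes => /and3P[pp C0 pC] /andP[h1 h2]; exists p; split=> //.
    apply: leq_ltn_trans kn; apply: leq_trans (logn_central_bin pp k0).
    apply: (@leq_trans (p ^ 1)); first by rewrite expn1.
    by apply: leq_pexp2l; [apply: prime_gt0|rewrite logn_gt0 mem_primes pp C0].
  by rewrite /good_prime pp h1.
exfalso; set Ps := primes _ in hn.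
have s1 : size [seq p <- Ps | p <= plow n] <= (plow n).+1.
  rewrite -[X in _ <= X](size_iota 0); apply: uniq_leq_size.
    by rewrite filter_uniq // primes_uniq.
  by move=> p; rewrite mem_filter mem_iota => /andP[].
have s2 : size [seq p <- Ps | ~~ (p <= plow n)] <= n * n.
  apply: (@leq_trans (size (primes N))).
    apply: uniq_leq_size; first by rewrite filter_uniq // primes_uniq.
    move=> p; rewrite mem_filter -ltnNge => /andP[h1 h2].
    have := hn p h2; rewrite h1 /= negbK => pN.
    by move: h2; rewrite /Ps !mem_primes => /and3P[-> _ _]; rewrite N0.
  rewrite -(@leq_exp2l 2) //; apply: leq_trans (exp_size_primes N0) _.
  apply: leq_trans Nn _; rewrite expnM leq_exp2r; last by lia.
  exact/ltnW/ltn_expl.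
have sz : size Ps <= (plow n).+1 + n * n.
  rewrite -(count_predC (fun p => p <= plow n)) -!size_filter.
  exact: leq_add s1 s2.
have : 2 ^ k <= 2 ^ (n * ((plow n).+1 + n * n)).
  apply: leq_trans (central_bin_ge k) _; apply: leq_trans (central_bin_le k0) _.
  rewrite expnM; apply: (@leq_trans ((2 ^ n) ^ size Ps)).
    by case: (size Ps) => // s; rewrite leq_exp2r.
  by rewrite leq_exp2l // (leq_trans _ (ltn_expl _ _)) //; lia.
rewrite leq_exp2l // leqNgt; apply/negP/negPn.
rewrite /k /plow !expnS expn0 muln1; set x := n * n.
have hx : 400 <= x by rewrite /x; nia.
have h3 : n * x >= 20 * x by rewrite leq_mul2r n20 orbT.
by rewrite -/x; nia.
Qed.

Section Walks.
Variables (n : nat) (E : digraph n).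

Definition eval_edge (u v : nat) : bool :=
  [exists a : 'I_n, exists b : 'I_n, [&& a == u :> nat, b == v :> nat & (a, b) \in E]].

Lemma eval_edgeE (u v : 'I_n) : eval_edge u v = ((u, v) \in E).
Proof.
apply/existsP/idP => [[a /existsP[b /and3P[/eqP/val_inj-> /eqP/val_inj->]]]//|h].
by exists u; apply/existsP; exists v; rewrite !eqxx.
Qed.

Local Notation cnt := (npow n eval_edge).

Lemma cnt_gt0 l (s t : 'I_n) : (0 < cnt l s t) = has_path E s t l.
Proof.
elim: l t => [|l IH] t /=.
  rewrite lt0b val_eqE; apply/eqP/existsP => [<-|[p]].
    by exists [tuple]; rewrite /= eqxx.
  by rewrite tuple0 /= => /eqP.
rewrite lt0n sum_nat_eq0 negb_forall; apply/existsP/existsP => [[c]|[p /andP[hp lp]]].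
  rewrite /= -lt0n muln_gt0 IH lt0b eval_edgeE => /andP[/existsP[p /andP[hp /eqP lp]] ct].
  exists [tuple of rcons p t]; rewrite /= rcons_path hp last_rcons eqxx lp andbT.
  exact: ct.
have sz : size p = l.+1 by rewrite size_tuple.
move: (val p) hp lp sz => q; case/lastP: q => [|q x] //.
rewrite rcons_path last_rcons size_rcons => /andP[hq eq] /eqP xt [sz].
rewrite /edge in eq; exists (last s q).
rewrite /= -lt0n muln_gt0 IH lt0b eval_edgeE -xt eq andbT.
apply/existsP; have sz' : size q == l by apply/eqP.
by exists (Tuple sz'); rewrite /= hq eqxx.
Qed.

Lemma cnt_le l s t : cnt l s t <= n ^ l.
Proof.
elim: l t => [|l IH] t /=; first by case: eqP.
apply: (@leq_trans (\sum_(c < n) n ^ l)); last by rewrite sum_nat_const card_ord expnS.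
apply: leq_sum => c _; apply: leq_trans (IH c).
by case: (eval_edge _ _); rewrite ?muln1 ?muln0.
Qed.

Lemma connect_short (s t : 'I_n) : connect (edge E) s t ->
  exists2 p, [/\ path (edge E) s p, last s p = t & uniq (s :: p)] & size p < n.
Proof.
case/connectP=> p hp ->; case/shortenP: hp => q hq uq _.
exists q; first by split.
by have := card_uniqP uq => /= <-; rewrite -[X in _ <= X]card_ord max_card.
Qed.

Lemma path_cnt (s : 'I_n) p : path (edge E) s p -> 0 < cnt (size p) s (last s p).
Proof.
by move=> hp; rewrite cnt_gt0; apply/existsP; exists (in_tuple p); rewrite /= hp eqxx.
Qed.

Lemma connect_cnt (s t : 'I_n) :
  connect (edge E) s t = bex n (fun l => 0 < cnt l s t).
Proof.
apply/idP/bexP => [/connect_short[p [hp <- _] sz]|[l _]].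
  by exists (size p) => //; apply: path_cnt.
by rewrite cnt_gt0 => /existsP[p /andP[hp /eqP <-]]; apply/connectP; exists p.
Qed.

Lemma distance_cnt (v : 3.-tuple 'I_n) :
  (v \in distance E) = (0 < cnt (nth 0 (map val v) 2) (nth 0 (map val v) 0) (nth 0 (map val v) 1))
   && ball (nth 0 (map val v) 2) (fun l => cnt l (nth 0 (map val v) 0) (nth 0 (map val v) 1) == 0).
Proof.
case/tupleP: v => s v; case/tupleP: v => t v; case/tupleP: v => d v.
rewrite tuple0 inE /= !(tnth_nth s) /= !inordK //=.
rewrite cnt_gt0; congr (_ && _); apply/forallP/ballP => [h l ld|h l].
  have ln : l < n by apply: ltn_trans ld (ltn_ord d).
  by have := implyP (h (Ordinal ln)) ld; rewrite -cnt_gt0 -eqn0Ngt.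
by apply/implyP => ld; rewrite -cnt_gt0 -eqn0Ngt h.
Qed.

Lemma reachability_cnt (v : 2.-tuple 'I_n) :
  (v \in reachability E) =
  bex n (fun l => 0 < cnt l (nth 0 (map val v) 0) (nth 0 (map val v) 1)).
Proof.
case/tupleP: v => s v; case/tupleP: v => t v.
by rewrite tuple0 inE /= !(tnth_nth s) /= connect_cnt.
Qed.

Definition touched (v : nat) : bool := bex n (fun u => eval_edge v u || eval_edge u v).

Lemma eval_edge_lt u v : eval_edge u v -> (u < n) && (v < n).
Proof. by case/existsP=> a /existsP[b /and3P[/eqP<- /eqP<- _]]; rewrite !ltn_ord. Qed.

Lemma touchedl u v : eval_edge u v -> touched u.
Proof. by move=> h; apply/bexP; exists v; [case/andP: (eval_edge_lt h)|rewrite h]. Qed.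

Lemma touchedr u v : eval_edge u v -> touched v.
Proof. by move=> h; apply/bexP; exists u; [case/andP: (eval_edge_lt h)|rewrite h orbT]. Qed.

Lemma cnt_touched l s t : 0 < cnt l.+1 s t -> touched s && touched t.
Proof.
elim: l t => [|l IH] t; rewrite /= lt0n sum_nat_eq0 => /forallPn[c];
  rewrite /= -lt0n muln_gt0 => /andP[h]; rewrite lt0b => ct.
  by move: h; rewrite lt0b => /eqP sc; rewrite sc (touchedl ct) (touchedr ct).
by have /andP[-> _] := IH _ h; rewrite (touchedr ct).
Qed.

Local Notation k := (nsel n touched).
Local Notation sl := (sel n touched).

(** A walk leaves each vertex before the last along an edge, so these vertices are touched and have
    a rank. *)
Lemma cnt_restrict l r c : r < k -> c < k ->
  (0 < npow k (fun a b => eval_edge (sl a) (sl b)) l r c) = (0 < cnt l (sl r) (sl c)).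
Proof.
move=> rk; elim: l c => [|l IH] c ck /=.
  rewrite !lt0b; apply/eqP/eqP => [->//|h].
  have [_ _ <-] := sel_spec rk; have [_ _ <-] := sel_spec ck; by rewrite h.
rewrite !lt0n !sum_nat_eq0 !negb_forall; apply/existsP/existsP => -[x];
  rewrite /= -lt0n muln_gt0 => /andP[h ct].
  have [xn _ _] := sel_spec (ltn_ord x).
  by exists (Ordinal xn); rewrite /= -lt0n muln_gt0 -IH // h ct.
have tx : touched x by move: ct; rewrite lt0b => /touchedl.
have xk := rank_lt (ltn_ord x) tx.
exists (Ordinal xk); rewrite /= -lt0n muln_gt0 sel_rank ?IH // ?sel_rank //.
by rewrite h ct.
Qed.

(** A path of positive length without repetitions visits distinct touched nodes only, which bounds
    its length; the empty path has length 0. *)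
Lemma connect_short_touched (s t : 'I_n) l : 0 < cnt l s t ->
  exists2 d, d <= k & 0 < cnt d s t.
Proof.
rewrite cnt_gt0 => /existsP[p /andP[hp /eqP lp]].
have : connect (edge E) s t by apply/connectP; exists p.
case/connect_short=> q [hq lq uq] _; exists (size q); last by rewrite -lq path_cnt.
case: q hq lq uq => [//|x q] hq lq uq; apply: ltnW.
have tch (y : 'I_n) : y \in s :: x :: q -> touched y.
  have edgeT a b : edge E a b -> touched a && touched b.
    by rewrite /edge -eval_edgeE => h; rewrite (touchedl h) (touchedr h).
  have all_t (a : 'I_n) r : touched a -> path (edge E) a r -> {in r, forall z : 'I_n, touched z}.
    elim: r a => [|b r IH] a ta //= /andP[/edgeT/andP[_ tb] hr] z.
    by rewrite inE => /orP[/eqP->//|]; apply: IH hr _.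
  have /edgeT/andP[ts _] : edge E s x by case/andP: hq.
  by rewrite inE => /orP[/eqP->//|]; apply: all_t hq y.
rewrite -[X in X <= _]/(size (s :: x :: q)) -(size_map val).
have -> : k = size [seq v <- iota 0 n | touched v].
  rewrite /nsel /bsum size_filter -sum1_count [RHS]big_mkcond.
  have -> : iota 0 n = index_iota 0 n by rewrite /index_iota subn0.
  by rewrite big_mkord; apply: eq_bigr => i _; case: touched.
apply: uniq_leq_size; first by rewrite map_inj_uniq //; apply: val_inj.
move=> y /mapP[z hz ->]; rewrite mem_filter mem_iota /= ltn_ord andbT.
exact: tch.
Qed.
End Walks.

(** * Tables and update terms *)

Section Digits.
Variable n : nat.

Fixpoint ndig D x : seq nat := if D is D'.+1 then x %% n :: ndig D' (x %/ n) else [::].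
Fixpoint uval D (f : nat -> nat) : nat :=
  if D is D'.+1 then f 0 + n * uval D' (fun j => f j.+1) else 0.

(** Arguments of relations are domain elements, so each argument of a table takes [pdig] consecutive
    positions; [block] reads one back. *)
Definition enc (L : seq nat) := flatten (map (ndig pdig) L).
Definition block (f : nat -> nat) j := uval pdig (fun i => f (j * pdig + i)).

Lemma size_ndig D x : size (ndig D x) = D.
Proof. by elim: D x => //= D IH x; rewrite IH. Qed.

Lemma nth_ndig_lt D x i : 0 < n -> nth 0 (ndig D x) i < n.
Proof.
by move=> n0; elim: D x i => [|D IH] x [|i] //=; rewrite ltn_mod.
Qed.

Lemma eq_uval D f g : (forall i, i < D -> f i = g i) -> uval D f = uval D g.
Proof.
elim: D f g => //= D IH f g h; rewrite h // (IH _ (fun j => g j.+1)) // => i iD.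
exact: h.
Qed.

Lemma uval_ndig D x : x < n ^ D -> uval D (nth 0 (ndig D x)) = x.
Proof.
elim: D x => [|D IH] x; first by rewrite expn0; case: x.
move=> h /=; rewrite (IH (x %/ n)).
  by rewrite [RHS](divn_eq x n); lia.
case: (posnP n) => n0; first by rewrite n0 exp0n in h.
by rewrite ltn_divLR // -expnSr.
Qed.

Arguments ndig : simpl never.

Lemma nth_enc L j i : j < size L -> i < pdig ->
  nth 0 (enc L) (j * pdig + i) = nth 0 (ndig pdig (nth 0 L j)) i.
Proof.
elim: L j => [//|x L IH] j hj hi.
have -> : enc (x :: L) = ndig pdig x ++ enc L by [].
rewrite nth_cat size_ndig; case: j hj => [|j] hj; first by rewrite mul0n add0n hi.
have -> : j.+1 * pdig + i < pdig = false by rewrite mulSn -addnA ltnNge leq_addr.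
by rewrite mulSn -addnA addKn; apply: IH.
Qed.

Lemma nth_enc_lt L i : 0 < n -> nth 0 (enc L) i < n.
Proof.
move=> n0; elim: L i => [|x L IH] i; first by rewrite nth_nil.
have -> : enc (x :: L) = ndig pdig x ++ enc L by [].
by rewrite nth_cat; case: ifP => _; [apply: nth_ndig_lt|apply: IH].
Qed.

Lemma block_enc L j : j < size L -> nth 0 L j < n ^ pdig -> block (nth 0 (enc L)) j = nth 0 L j.
Proof.
move=> hj hL; rewrite /block -[RHS](uval_ndig hL); apply: eq_uval => i hi.
exact: nth_enc.
Qed.
End Digits.
Arguments ndig : simpl never.

(** The first four relations are graphs of functions, with blocks for the arguments followed by one
    for the value: clock, base graph, powers and walk counts. The two answers have plain elements as
    arguments. *)
Definition par (R : 'I_6) : nat :=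
  nth 0 [:: pdig; 3 * pdig; 4 * pdig; 5 * pdig; 2; 3] R.
Local Notation pworld := (world par).

(** As the relation is the graph of a function, the sum has a single nonzero term. An empty
    relation, as in the initial state, reads as 0. *)
Definition rd (w : pworld) (R : 'I_6) (L : seq nat) : nat :=
  bsum (dsize w ^ pdig) (fun v =>
    @aux_val _ par w R (fun i => nth 0 (enc (dsize w) (rcons L v)) i) * v).

Lemma rdE (w : pworld) R q (F : seq nat -> nat) L : par R = q.+1 * pdig ->
  (forall v : (par R).-tuple 'I_(dsize w), (v \in wA w R) =
     (block (dsize w) (nth 0 (map val v)) q ==
      F (mkseq (block (dsize w) (nth 0 (map val v))) q))) ->
  0 < dsize w -> size L = q -> all (fun x => x < dsize w ^ pdig) L ->
  F L < dsize w ^ pdig -> rd w R L = F L.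
Proof.
move=> arR hA n0 sL aL hF; rewrite /rd.
rewrite (@eq_bsum _ _ (fun v => (v == F L) * v)); first exact: (sum_ord_eq id hF).
move=> v hv; congr (nat_of_bool _ * _).
pose x (i : 'I_(par R)) := nth 0 (enc (dsize w) (rcons L v)) i.
have hx i : x i < dsize w by apply: nth_enc_lt.
pose tv := [tuple Ordinal (hx i) | i < par R].
have tvE i : i < par R -> nth 0 (map val tv) i = nth 0 (enc (dsize w) (rcons L v)) i.
  move=> hi; have h0 : 0 < par R by apply: leq_ltn_trans hi.
  rewrite (nth_map (Ordinal (hx (Ordinal h0)))) ?size_tuple //.
  by rewrite -[i]/(val (Ordinal hi)) -tnth_nth tnth_mktuple.
have bl j : j <= q -> block (dsize w) (nth 0 (map val tv)) j = nth 0 (rcons L v) j.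
  move=> jq; rewrite -(@block_enc (dsize w)) ?size_rcons ?sL //; last first.
    rewrite nth_rcons sL; case: (ltnP j q) => h.
      by apply: (allP aL); rewrite mem_nth ?sL.
    by have -> : j = q; [lia|rewrite eqxx].
  apply: eq_uval => i hi; apply: tvE; rewrite arR; move: hi; rewrite /pdig; nia.
transitivity (tv \in wA w R).
  apply/existsP/idP => [[t /andP[/forallP h1 h2]]|h].
    suff -> : tv = t by [].
    by apply: eq_from_tnth => i; rewrite tnth_mktuple; apply: val_inj; exact: esym (eqP (h1 i)).
  by exists tv; rewrite h andbT; apply/forallP => i; rewrite tnth_mktuple.
rewrite hA bl // nth_rcons sL ltnn eqxx; congr (_ == F _).
apply: (@eq_from_nth _ 0); rewrite size_mkseq // => i iq.
by rewrite nth_mkseq // bl ?(ltnW iq) // nth_rcons sL iq.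
Qed.

Section TableTerms.
Local Notation fn := (pworld -> (nat -> nat) -> nat).

Lemma tm_ndig D (x : fn) i : Tm x -> Tm (fun w e => nth 0 (ndig (dsize w) D (x w e)) i).
Proof.
elim: D x i => [|D IH] x i hx.
  by apply: tm_ext (tm_const _ 0) => w e; rewrite nth_nil.
case: i => [|i]; first by apply: tm_ext (tm_mod hx (tm_size _)).
by apply: tm_ext (IH _ i (tm_div hx (tm_size _))).
Qed.

Lemma tm_enc (fs : seq fn) i : (forall j, Tm (nth (fun _ _ => 0) fs j)) ->
  Tm (fun w e => nth 0 (enc (dsize w) [seq f w e | f <- fs]) i).
Proof.
elim: fs i => [|f fs IH] i h.
  by apply: tm_ext (tm_const _ 0) => w e; rewrite /enc /= nth_nil.
case: (ltnP i pdig) => hi.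
  apply: tm_ext (tm_ndig pdig i (h 0)) => w e.
  have -> : enc (dsize w) [seq g w e | g <- f :: fs] =
    ndig (dsize w) pdig (f w e) ++ enc (dsize w) [seq g w e | g <- fs] by [].
  by rewrite nth_cat size_ndig hi.
apply: tm_ext (IH (i - pdig) (fun j => h j.+1)) => w e.
have -> : enc (dsize w) [seq g w e | g <- f :: fs] =
    ndig (dsize w) pdig (f w e) ++ enc (dsize w) [seq g w e | g <- fs] by [].
by rewrite nth_cat size_ndig ltnNge hi.
Qed.

Lemma tm_rd R (fs : seq fn) : (forall j, Tm (nth (fun _ _ => 0) fs j)) ->
  Tm (fun w e => rd w R [seq f w e | f <- fs]).
Proof.
move=> h; rewrite /rd; apply: tm_bsum; first by tm.
apply: tm_mul; last by tm.
apply: tm_aux => i.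
pose fs' := rcons [seq (fun w e => f w (fun i => e i.+1)) | f <- fs] (fun w e => e 0).
have h' j : Tm (nth (fun _ _ => 0) fs' j).
  rewrite nth_rcons size_map; case: ltnP => hj; last by case: eqP => _; tm.
  by rewrite (nth_map (fun _ _ => 0)) //; apply: (tm_ren S (h j)).
by apply: tm_ext (tm_enc i h') => w e; rewrite /fs' map_rcons -map_comp.
Qed.

Lemma tm_rd0 R : Tm (fun w e => rd w R [::]).
Proof. by apply: (@tm_rd R [::]) => j; rewrite nth_nil; apply: tm_const. Qed.

Lemma tm_rd2 R (x y : fn) : Tm x -> Tm y -> Tm (fun w e => rd w R [:: x w e; y w e]).
Proof.
move=> hx hy; apply: (@tm_rd R [:: x; y]) => -[|[|j]] //=.
by rewrite nth_nil; apply: tm_const.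
Qed.

Lemma tm_rd3 R (x y z : fn) : Tm x -> Tm y -> Tm z ->
  Tm (fun w e => rd w R [:: x w e; y w e; z w e]).
Proof.
move=> hx hy hz; apply: (@tm_rd R [:: x; y; z]) => -[|[|[|j]]] //=.
by rewrite nth_nil; apply: tm_const.
Qed.

Lemma tm_rd4 R (x y z u : fn) : Tm x -> Tm y -> Tm z -> Tm u ->
  Tm (fun w e => rd w R [:: x w e; y w e; z w e; u w e]).
Proof.
move=> hx hy hz hu; apply: (@tm_rd R [:: x; y; z; u]) => -[|[|[|[|j]]]] //=.
by rewrite nth_nil; apply: tm_const.
Qed.

Lemma tm_uval D (f : nat -> fn) : (forall j, Tm (f j)) ->
  Tm (fun w e => uval (dsize w) D (fun j => f j w e)).
Proof.
elim: D f => [|D IH] f h /=; first exact: tm_const.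
by apply: tm_add => //; apply: tm_mul; [apply: tm_size|apply: (IH (fun j => f j.+1))].
Qed.

Lemma tm_block j : Tm (fun (w : pworld) e => block (dsize w) e j).
Proof. by apply: (@tm_uval pdig (fun i w e => e (j * pdig + i))) => i; apply: tm_var. Qed.
End TableTerms.

Section Program.
Variable J : nat.

Definition Rclk : 'I_6 := @Ordinal 6 0 isT.
Definition Rbase : 'I_6 := @Ordinal 6 1 isT.
Definition Rpow : 'I_6 := @Ordinal 6 2 isT.
Definition Rcnt : 'I_6 := @Ordinal 6 3 isT.
Definition Rreach : 'I_6 := @Ordinal 6 4 isT.
Definition Rdist : 'I_6 := @Ordinal 6 5 isT.

(* The number of steps after which the table of powers is complete. *)
Definition startup n := (pdig * (nlog2 n).+1).+1.

Definition clk (w : pworld) := rd w Rclk [::].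
Definition late (w : pworld) := startup (dsize w) <= clk w.
Definition ptw (w : pworld) p a x := rd w Rpow [:: p; a; x].
Definition bsw (w : pworld) u v := 0 < rd w Rbase [:: u; v].
Definition mtw (w : pworld) p s t l := rd w Rcnt [:: p; s; t; l].
(** The comparison is with the stored base graph, not with the previous input graph. At the first
    late step the base graph is still empty, so the whole graph counts as changed. *)
Definition Svw (w : pworld) u := bex (dsize w) (fun v =>
  ~~ ((edge_val w u v : nat) == bsw w u v) || ~~ ((edge_val w v u : nat) == bsw w v u)).
Definition mnw (w : pworld) p s t l :=
  mnew (dsize w) (ptw w) J p (mtw w p) (edge_val w) (bsw w) (Svw w) s t l.
Definition nz_late (w : pworld) s t l := bex (dsize w ^ pdig) (fun p =>
  (prime p && (plow (dsize w) < p)) && (0 < mnw w p s t l)).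
Definition tchw (w : pworld) v := bex (dsize w) (fun u => edge_val w v u || edge_val w u v).
Definition sel0 (w : pworld) r := sel (dsize w) (tchw w) r.
Definition ksize (w : pworld) := nsel (dsize w) (tchw w).
(** The empty walk is treated apart, since its vertex may be untouched and then has no rank. *)
Definition nz_early (w : pworld) s t l :=
  if l == 0 then nat_of_bool (s == t) else nat_of_bool (bex (ksize w) (fun r => bex (ksize w) (fun c =>
    [&& sel0 w r == s, sel0 w c == t &
      0 < mpow (dsize w) (ptw w) 0 (ksize w) J (fun a b => edge_val w (sel0 w a) (sel0 w b)) l r c]))).

Definition new_clk (w : pworld) := if late w then clk w else (clk w).+1.
(** Empty until startup is over, in agreement with [new_cnt], which until then has walks of length 0
    only. *)
Definition new_base (w : pworld) u v := late w && edge_val w u v.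
Definition new_pow (w : pworld) p a x := if x == 0 then 1 %% p else
  (ptw w p a (x %/ 2) * ptw w p a (x %/ 2) * (if x %% 2 == 0 then 1 else a)) %% p.
Definition new_cnt (w : pworld) p s t l :=
  if late w then mnw w p s t l else nat_of_bool ((s == t) && (l == 0)).
Definition ans_reach (w : pworld) s t :=
  if late w then nat_of_bool (bex (dsize w) (fun l => nz_late w s t l))
  else nat_of_bool (bex (ksize w).+1 (fun l => 0 < nz_early w s t l)).
Definition ans_dist (w : pworld) s t d :=
  if late w then nat_of_bool (nz_late w s t d && ball d (fun l => ~~ nz_late w s t l))
  else nat_of_bool [&& d <= ksize w, 0 < nz_early w s t d & ball d (fun l => ~~ (0 < nz_early w s t l))].

Definition upd (R : 'I_6) (w : pworld) (e : nat -> nat) : nat :=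
  let b := block (dsize w) e in
  match nat_of_ord R with
  | 0 => b 0 == new_clk w
  | 1 => b 2 == new_base w (b 0) (b 1)
  | 2 => b 3 == new_pow w (b 0) (b 1) (b 2)
  | 3 => b 4 == new_cnt w (b 0) (b 1) (b 2) (b 3)
  | 4 => ans_reach w (e 0) (e 1)
  | _ => ans_dist w (e 0) (e 1) (e 2)
  end.

Local Notation fn := (pworld -> (nat -> nat) -> nat).

Lemma tm_late : Tm (fun w e => late w).
Proof.
rewrite /late /startup; apply: tm_le; last exact: tm_rd0.
by apply: tm_S; apply: tm_mul; [tm | apply: tm_S; apply: tm_nlog2].
Qed.

Lemma tm_bsw (x y : fn) : Tm x -> Tm y -> Tm (fun w e => bsw w (x w e) (y w e)).
Proof. by move=> hx hy; apply: tm_le; [tm|apply: tm_rd2]. Qed.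

Lemma tm_ptw (p a x : fn) : Tm p -> Tm a -> Tm x ->
  Tm (fun w e => ptw w (p w e) (a w e) (x w e)).
Proof. exact: tm_rd3. Qed.

Local Ltac tm_user ::= match goal with
  | |- Tm (fun w e => nat_of_bool (bsw w _ _)) => apply: tm_bsw
  | |- Tm (fun w e => nat_of_bool (late w)) => exact: tm_late
  | |- Tm (fun w e => clk w) => exact: tm_rd0
  | |- Tm (fun w e => ptw w _ _ _) => apply: tm_ptw
  | |- Tm (fun w e => nat_of_bool (edge_val w _ _)) => apply: tm_edge end.

Lemma tm_Svw (x : fn) : Tm x -> Tm (fun w e => Svw w (x w e)).
Proof. by move=> /tm0P hx; rewrite /Svw; tm. Qed.

Lemma tm_mnw (p s t l : fn) : Tm p -> Tm s -> Tm t -> Tm l ->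
  Tm (fun w e => mnw w (p w e) (s w e) (t w e) (l w e)).
Proof.
apply: tm_mnew; [exact: tm_ptw|exact: tm_rd4|exact: tm_bsw|exact: tm_Svw].
Qed.

Lemma tm_nz_late (s t l : fn) : Tm s -> Tm t -> Tm l ->
  Tm (fun w e => nz_late w (s w e) (t w e) (l w e)).
Proof.
move=> /tm0P hs /tm0P ht /tm0P hl; rewrite /nz_late /plow; tm.
by apply: tm_mnw; tm.
Qed.

Lemma tm_tchw (x : fn) : Tm x -> Tm (fun w e => tchw w (x w e)).
Proof. by move=> /tm0P hx; rewrite /tchw; tm. Qed.

Lemma tm_ksize : Tm (fun w e => ksize w).
Proof. by apply: tm_nsel tm_tchw. Qed.

Lemma tm_sel0 (x : fn) : Tm x -> Tm (fun w e => sel0 w (x w e)).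
Proof. exact: tm_sel tm_tchw. Qed.

Lemma tm_nz_early (s t l : fn) : Tm s -> Tm t -> Tm l ->
  Tm (fun w e => nz_early w (s w e) (t w e) (l w e)).
Proof.
move=> /tm0P hs /tm0P ht /tm0P hl; rewrite /nz_early; tm.
1, 2: exact: tm_ksize.
1, 2: by apply: tm_sel0; tm.
apply: tm_mpow; tm; first exact: tm_ptw.
- exact: tm_ksize.
all: by apply: tm_sel0; tm.
Qed.

Lemma tm_upd R : Tm (upd R).
Proof.
case: R => -[|[|[|[|[|[|//]]]]]] h; rewrite /upd /=.
- apply: tm_eq; first exact: tm_block.
  by rewrite /new_clk; tm.
- apply: tm_eq; first exact: tm_block.
  by rewrite /new_base; tm; exact: tm_block.
- apply: tm_eq; first exact: tm_block.
  by rewrite /new_pow; tm; exact: tm_block.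
- apply: tm_eq; first exact: tm_block.
  by rewrite /new_cnt; tm; try exact: tm_block; apply: tm_mnw; exact: tm_block.
- rewrite /ans_reach; tm; first by apply: tm_nz_late; tm.
    exact: tm_ksize.
  by apply: tm_nz_early; tm.
- rewrite /ans_dist; tm; try (by apply: tm_nz_late; tm); try exact: tm_ksize.
  all: by apply: tm_nz_early; tm.
Qed.
End Program.

(** * The invariant of the program *)

Lemma eq_npow n Q Q' l s t : (forall u v, u < n -> v < n -> Q u v = Q' u v) ->
  t < n -> npow n Q l s t = npow n Q' l s t.
Proof.
move=> h; elim: l t => [|l IH] t tn //=; apply: eq_bigr => c _.
by rewrite IH // h.
Qed.

Lemma nth_val_lt n k (v : k.-tuple 'I_n) i : i < k -> nth 0 (map val v) i < n.
Proof.
move=> ik; rewrite (nth_map (tnth v (Ordinal ik))) ?size_tuple //; exact: ltn_ord.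
Qed.

Lemma eqb_nat (a b : bool) : ((a : nat) == b) = (a == b).
Proof. by case: a; case: b. Qed.

Lemma nselE n (S : nat -> bool) : nsel n S = #|[set i : 'I_n | S i]|.
Proof. by rewrite -sum1dep_card [RHS]big_mkcond. Qed.

Lemma nsel_le n (S : nat -> bool) (A : {set 'I_n}) : (forall u : 'I_n, S u -> u \in A) -> nsel n S <= #|A|.
Proof. by move=> h; rewrite nselE subset_leq_card //; apply/subsetP => u; rewrite inE => /h. Qed.

Lemma mod_pow_step a x p (h := a ^ (x %/ 2) %% p) :
  (h * h * (if x %% 2 == 0 then 1 else a)) %% p = a ^ x %% p.
Proof.
have E : (h * h) %% p = a ^ (x %/ 2 * 2) %% p.
  by rewrite expnM -mulnn /h modnMml modnMmr.
rewrite -modnMml E modnMml [in RHS](divn_eq x 2) expnD.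
by case: (x %% 2) (ltn_pmod x (isT : 0 < 2)) => [|[|r]].
Qed.

Section Invariant.
Variables (J n f : nat).
Local Notation kk := ((startup n).+1 * f).
Hypotheses (n1 : 1 < n) (w_gt0 : 0 < wid n).
Hypotheses (kB : kk <= 2 ^ wid n) (kw : kk < wid n ^ J.+1).
Hypothesis hprime : forall N, 0 < N -> N <= n ^ n ->
  exists p, [/\ p < n ^ pdig, good_prime n p & ~~ (p %| N)].

Local Notation world := (world par).
Local Notation aux := (aux_structure par n).
Local Notation wld E A := (@World _ par n E A).
Local Notation T := (startup n).

(** A step is late if at least T steps precede it, so after t <= T steps the tables still describe
    the empty graph. The power table holds the exponent 0 after the first step and doubles its range
    with each further one. *)
Record Inv (t : nat) (E : digraph n) (A : aux) : Prop := MkInv {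
  inv_clk : clk (wld E A) = minn t T;
  inv_pow : 0 < t -> forall p a x, 0 < p -> p < n ^ pdig -> a < n ^ pdig ->
    x < n ^ pdig -> x < 2 ^ t.-1 -> ptw (wld E A) p a x = a ^ x %% p;
  inv_base : 0 < t -> forall u v, u < n -> v < n ->
    bsw (wld E A) u v = eval_edge (if t <= T then set0 else E) u v;
  inv_cnt : 0 < t -> forall p s r l, good_prime n p -> p < n ^ pdig ->
    s < n -> r < n -> l < n -> mtw (wld E A) p s r l =
      npow n (eval_edge (if t <= T then set0 else E)) l s r %% p;
  inv_touched : t <= T -> nsel n (touched E) <= t * f }.

Let n_gt0 : 0 < n := ltnW n1.
Let n_le : n <= n ^ pdig.
Proof. by rewrite -[X in X <= _]expn1 leq_exp2l. Qed.

Let T_lt : T < n ^ pdig.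
Proof.
have h : trunc_log 2 n < n.
  by apply: leq_trans (ltn_expl _ (isT : 1 < 2)) (trunc_logP _ _).
rewrite /startup nlog2E // /pdig.
have h2 : 2 ^ 6 <= n ^ 6 by rewrite leq_exp2r.
by rewrite expnS; move: h2; set y := n ^ 6; rewrite -[2 ^ 6]/64; nia.
Qed.

Lemma Inv0 : Inv 0 set0 (fun R => set0).
Proof.
have rd0 R L : rd (wld set0 (fun R => set0)) R L = 0.
  rewrite /rd /bsum big1 // => v _.
  suff -> : @aux_val _ par (wld set0 (fun R => set0)) R
     (fun i => nth 0 (enc n (rcons L v)) i) = false by [].
  by apply/negbTE/existsPn => u; rewrite inE andbF.
split=> // [|_]; first by rewrite /clk rd0 min0n.
rewrite mul0n leqn0 nselE cards_eq0 -subset0; apply/subsetP => u; rewrite !inE.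
by case/bexP=> v _ /orP[] /existsP[a /existsP[b]]; rewrite inE !andbF.
Qed.

Section Step.
Variables (t : nat) (E E' : digraph n) (A A' : aux) (d : change n).
Hypotheses (inv : Inv t E A) (E'E : E' = apply_change E d) (dle : #|affected d| <= f).
Hypothesis hA' : forall R (v : (par R).-tuple 'I_n),
  (v \in A' R) = (0 < upd J R (wld E' A) (nth 0 (map val v))).
Local Notation wh := (wld E' A).
Local Notation w' := (wld E' A').

Let lateE : late wh = (T <= t).
Proof.
by rewrite /late -[clk wh]/(clk (wld E A)) (inv_clk inv) leq_min leqnn andbT.
Qed.

Let clkE : clk w' = new_clk wh.
Proof.
apply: (@rdE w' Rclk 0 (fun L => new_clk wh) [::]) => //.
  by move=> v; rewrite hA' lt0b.
rewrite /new_clk lateE -[clk wh]/(clk (wld E A)) (inv_clk inv).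
by move: T_lt; rewrite /=; set y := n ^ pdig; case: (leqP T t) => h; lia.
Qed.

Let baseE u v : u < n -> v < n -> rd w' Rbase [:: u; v] = new_base wh u v.
Proof.
move=> un vn.
apply: (@rdE w' Rbase 2 (fun L => new_base wh (nth 0 L 0) (nth 0 L 1)) [:: u; v]) => //.
- by move=> x; rewrite hA' lt0b.
- by rewrite /= !(leq_trans _ n_le).
- by apply: leq_trans n_le; case: new_base.
Qed.

Let powE p a x : 0 < p -> p < n ^ pdig -> a < n ^ pdig -> x < n ^ pdig ->
  ptw w' p a x = new_pow wh p a x.
Proof.
move=> p0 pn an xn.
apply: (@rdE w' Rpow 3 (fun L => new_pow wh (nth 0 L 0) (nth 0 L 1) (nth 0 L 2)) [:: p; a; x]) => //.
- by move=> y; rewrite hA' lt0b.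
- by rewrite /= pn an xn.
- by rewrite /new_pow; case: ifP => _; apply: ltn_trans (ltn_pmod _ p0) pn.
Qed.

Let cntE p s r l : 0 < p -> p < n ^ pdig -> s < n -> r < n -> l < n ->
  mtw w' p s r l = new_cnt J wh p s r l.
Proof.
move=> p0 pn sn rn ln.
apply: (@rdE w' Rcnt 4 (fun L => new_cnt J wh (nth 0 L 0) (nth 0 L 1) (nth 0 L 2) (nth 0 L 3))
   [:: p; s; r; l]) => //.
- by move=> y; rewrite hA' lt0b.
- by rewrite /= pn !(leq_trans _ n_le).
- rewrite /new_cnt; case: ifP => _; last by apply: leq_trans n_le; case: (_ && _).
  by apply: ltn_trans (ltn_pmod _ p0) pn.
Qed.

Let change_affected (u v : 'I_n) :
  eval_edge E' u v != eval_edge E u v -> (u \in affected d) && (v \in affected d).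
Proof.
rewrite !eval_edgeE E'E /apply_change !inE => h.
have hin : (u, v) \in inserted d :|: deleted d.
  by rewrite inE; move: h; case: (_ \in deleted d); case: (_ \in inserted d); rewrite ?orbF ?andbT ?eqxx.
by apply/andP; split; apply/existsP; exists (u, v); rewrite hin !eqxx ?orbT.
Qed.

Let touched_step : nsel n (touched E') <= nsel n (touched E) + f.
Proof.
apply: (@leq_trans #|[set i : 'I_n | touched E i] :|: affected d|).
  apply: nsel_le => u tu; rewrite !inE; apply/orP.
  case/bexP: tu => v vn h; rewrite -[v]/(val (Ordinal vn)) in h.
  case/orP: h => h.
    case: (eqVneq (eval_edge E' u (Ordinal vn)) (eval_edge E u (Ordinal vn))) => [e|].
      by left; rewrite e in h; apply: touchedl h.
    by move/change_affected/andP=> [+ _]; rewrite inE; right.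
  case: (eqVneq (eval_edge E' (Ordinal vn) u) (eval_edge E (Ordinal vn) u)) => [e|].
    by left; rewrite e in h; apply: touchedr h.
  by move/change_affected/andP=> [_ +]; rewrite inE; right.
by apply: leq_trans (leq_card_setU _ _) _; rewrite nselE leq_add2l.
Qed.

(** At the first late step all touched nodes count: at most T f of them before the change and f more
    through it. At later steps only nodes affected by the change can differ from the base graph. *)
Let Sv_bound : T <= t -> nsel n (Svw wh) <= kk.
Proof.
move=> Tt; have t0 : 0 < t by apply: leq_trans Tt.
have SvE (u : 'I_n) : Svw wh u -> exists v : 'I_n,
    eval_edge E' u v != eval_edge (if t <= T then set0 else E) u v \/
    eval_edge E' v u != eval_edge (if t <= T then set0 else E) v u.
  case/bexP=> v vn; rewrite -[bsw wh]/(bsw (wld E A)) !(inv_base inv t0) //.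
  by rewrite !eqb_nat => /orP h; exists (Ordinal vn).
case: (leqP t T) => tT.
  have tE : t = T by lia.
  apply: (@leq_trans (nsel n (touched E'))); last first.
    apply: leq_trans touched_step _; have := inv_touched inv tT; rewrite tE; lia.
  rewrite [X in _ <= X]nselE; apply: nsel_le => u /SvE[v]; rewrite tT.
  have e0 (a b : 'I_n) : eval_edge (set0 : digraph n) a b = false by rewrite eval_edgeE inE.
  rewrite !e0 inE => -[|] h.
    by apply: (@touchedl _ _ _ v); move: h; case: eval_edge.
  by apply: (@touchedr _ _ v); move: h; case: eval_edge.
apply: (@leq_trans #|affected d|); last by apply: leq_trans dle _; rewrite leq_pmull.
apply: nsel_le => u /SvE[v]; rewrite leqNgt tT /=.
by case=> /change_affected/andP[].
Qed.

Lemma mnw_late p s r l : T <= t -> good_prime n p -> p < n ^ pdig ->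
  s < n -> r < n -> l < n -> mnw J wh p s r l = npow n (eval_edge E') l s r %% p.
Proof.
move=> Tt /andP[pp pl] pn sn rn ln; have t0 : 0 < t by apply: leq_trans Tt.
have gp : good_prime n p by rewrite /good_prime pp.
apply: mnew_correct => //.
- by apply: leq_ltn_trans pl; rewrite /plow; lia.
- move=> a x ap xp.
  apply: (inv_pow inv t0 (prime_gt0 pp) pn (ltn_trans ap pn) (ltn_trans xp pn)).
  (* The table covers the exponents below 2^(T - 1) = 2^(pdig (L + 1)) with L = [nlog2 n], and n <
     2^(L + 1). *)
  apply: (@leq_trans (n ^ pdig)); first exact: ltn_trans xp pn.
  apply: (@leq_trans (2 ^ (pdig * (nlog2 n).+1))).
    rewrite mulnC expnM leq_exp2r // nlog2E //.
    by apply: ltnW; apply: trunc_log_ltn.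
  by rewrite leq_exp2l //; move: Tt; rewrite /startup; case: (t).
- exact: leq_trans (Sv_bound Tt) kB.
- exact: leq_ltn_trans (Sv_bound Tt) kw.
- move=> a b c an bn cn; rewrite -[mtw wh]/(mtw (wld E A)) (inv_cnt inv) //.
  congr (_ %% _); apply: eq_npow => // u v un vn.
  by rewrite -[bsw wh]/(bsw (wld E A)) (inv_base inv).
- move=> u v un vn h; rewrite -eqb_nat in h.
  apply/andP; split; apply/bexP.
    by exists v => //; rewrite h.
  by exists u => //; rewrite h orbT.
Qed.

Lemma step_Inv : Inv t.+1 E' A'.
Proof.
split.
- rewrite clkE /new_clk lateE -[clk wh]/(clk (wld E A)) (inv_clk inv).
  by case: (leqP T t); lia.
- move=> _ p a x p0 pn an xn xt; rewrite powE // /new_pow.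
  case: eqP => [->|/eqP x0]; first by rewrite expn0.
  case: (posnP t) => t0; first by rewrite t0 expn0 ltnS leqn0 (negbTE x0) in xt.
  rewrite -[ptw wh]/(ptw (wld E A)) !(inv_pow inv) //; first exact: mod_pow_step.
  + by apply: leq_ltn_trans xn; apply: leq_div.
  + by move: xt; rewrite -[t in 2 ^ t](prednK t0) expnS ltn_divLR // mulnC.
- move=> _ u v un vn; rewrite /bsw baseE // /new_base lateE lt0b ltnNge.
  case: (leqP T t) => Tt /=; first by rewrite [edge_val _ _ _]/(eval_edge E' u v).
  by apply/esym/negbTE/negP => /existsP[a /existsP[b]]; rewrite inE !andbF.
- move=> _ p s r l gp pn sn rn ln.
  have /andP[pp _] := gp; rewrite cntE ?prime_gt0 // /new_cnt lateE ltnNge.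
  case: (leqP T t) => Tt /=; first exact: mnw_late.
  case: l ln => [|l] ln /=.
    by rewrite eqxx andbT modn_small //; case: eqP => _; rewrite ?prime_gt1 ?prime_gt0.
  rewrite andbF big1 ?mod0n // => c _.
  rewrite (_ : eval_edge _ _ _ = false) ?muln0 //.
  by apply/negbTE/negP => /existsP[a /existsP[b]]; rewrite inE !andbF.
- move=> tT; apply: leq_trans touched_step _.
  by have := inv_touched inv (ltnW tT); lia.
Qed.

Lemma nz_lateE s r l : T <= t -> s < n -> r < n -> l < n ->
  nz_late J wh s r l = (0 < npow n (eval_edge E') l s r).
Proof.
move=> Tt sn rn ln; apply/bexP/idP => [[p pn /andP[gp]]|h].
  by rewrite mnw_late //; case: npow => //; rewrite mod0n.
have hN : npow n (eval_edge E') l s r <= n ^ n.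
  by apply: leq_trans (cnt_le E' l s r) _; rewrite leq_pexp2l // ltnW.
have [p [pn gp np]] := hprime h hN; exists p => //.
by rewrite mnw_late // -/(good_prime n p) gp lt0n.
Qed.

Lemma nz_earlyE s r l : t < T -> s < n -> r < n -> l <= nsel n (touched E') ->
  (0 < nz_early J wh s r l) = (0 < npow n (eval_edge E') l s r).
Proof.
move=> tT sn rn lk; rewrite /nz_early; case: l lk => [|l] lk; first by [].
set k := nsel n (touched E') in lk.
have kkk : k <= kk.
  by apply: leq_trans touched_step _; have := inv_touched inv (ltnW tT); nia.
have mp a b : a < k -> b < k ->
  (0 < mpow n (ptw wh) 0 k J (fun a b => edge_val wh (sel0 wh a) (sel0 wh b)) l.+1 a b) =
  (0 < npow n (eval_edge E') l.+1 (sel n (touched E') a) (sel n (touched E') b)).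
  move=> ak bk; rewrite -cnt_restrict //.
  apply: (@mpowE n (ptw wh) 0 k n_gt0 w_gt0 (leq_trans kkk kB)
     (fun x y => (0 < x) = (0 < y))) => //.
  - by move=> x y z -> ->.
  - by move=> x y x' y' hx hy; rewrite !addn_gt0 hx hy.
  - by move=> x y x' y' hx hy; rewrite !muln_gt0 hx hy.
  - by move=> x; rewrite /red eqxx lt0b.
  - move=> q g; rewrite /prd eqxx lt0b; apply/ballP/idP => [h|h i iq].
      by apply: prodn_gt0 => i; apply: h.
    rewrite lt0n; apply/negP => /eqP g0; move: h.
    by rewrite (bigD1 (Ordinal iq)) //= g0.
  - exact: leq_ltn_trans (leq_trans lk kkk) kw.
rewrite lt0b; apply/bexP/idP => [[a ak /bexP[b bk /and3P[/eqP<- /eqP<-]]]|h].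
  by rewrite mp.
have /andP[ts tr] := cnt_touched h.
exists (bsum s (touched E')); first exact: rank_lt.
apply/bexP; exists (bsum r (touched E')); first exact: rank_lt.
have ss : sel n (touched E') (bsum s (touched E')) = s by apply: sel_rank.
have sr : sel n (touched E') (bsum r (touched E')) = r by apply: sel_rank.
rewrite -[sel0 wh]/(sel n (touched E')) ss sr !eqxx /= mp ?ss ?sr //; exact: rank_lt.
Qed.

Lemma reach_correct (v : 2.-tuple 'I_n) : (v \in A' Rreach) = (v \in reachability E').
Proof.
rewrite (hA' (R := Rreach)) reachability_cnt /upd /= /ans_reach lateE.
set s := nth 0 _ 0; set r := nth 0 _ 1.
have [sn rn] : s < n /\ r < n by split; apply: nth_val_lt.
case: (leqP T t) => Tt; rewrite lt0b.
  by apply: eq_in_has => l; rewrite mem_iota => /andP[_ ln]; rewrite nz_lateE.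
apply/bexP/bexP => -[l lk h].
  have {lk}lk : l <= nsel n (touched E') by rewrite -ltnS.
  rewrite nz_earlyE // in h.
  have := connect_cnt E' (Ordinal sn) (Ordinal rn); case: bexP => [//|nh].
  move: h; rewrite -[s]/(val (Ordinal sn)) -[r]/(val (Ordinal rn)) cnt_gt0.
  case/existsP=> p /andP[hp /eqP hr] /negP[].
  by apply/connectP; exists p.
have [q qk hq] := @connect_short_touched _ E' (Ordinal sn) (Ordinal rn) l h.
by exists q; rewrite ?ltnS // nz_earlyE.
Qed.

Lemma dist_correct (v : 3.-tuple 'I_n) : (v \in A' Rdist) = (v \in distance E').
Proof.
rewrite (hA' (R := Rdist)) distance_cnt /upd /= /ans_dist lateE.
set s := nth 0 _ 0; set r := nth 0 _ 1; set q := nth 0 _ 2.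
have [sn rn qn] : [/\ s < n, r < n & q < n] by split; apply: nth_val_lt.
case: (leqP T t) => Tt; rewrite lt0b.
  rewrite nz_lateE //; congr (_ && _); apply: eq_in_all => l.
  rewrite mem_iota => /andP[_ lq]; rewrite nz_lateE // ?(ltn_trans lq qn) //.
  by rewrite -eqn0Ngt.
case: (leqP q (nsel n (touched E'))) => qk.
  rewrite andTb nz_earlyE //; congr (_ && _).
  apply: eq_in_all => l; rewrite mem_iota => /andP[_ lq].
  by rewrite nz_earlyE // ?(leq_trans (ltnW lq) qk) // -eqn0Ngt.
rewrite andFb.
(* A distance larger than the number of touched nodes is impossible, as some walk has at most that
   length. *)
apply/esym/negbTE/negP => /andP[h /ballP min].
have [l lk hl] := @connect_short_touched _ E' (Ordinal sn) (Ordinal rn) q h.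
by have := min l (leq_ltn_trans lk qk); rewrite eqn0Ngt hl.
Qed.
End Step.
End Invariant.

(** * The dynamic program *)

Section SmallDomains.
Variables (m : nat) (ar : 'I_m -> nat).

Lemma def_has n0 (r : seq nat) (P : nat -> forall w : world ar, env w -> bool) :
  (forall l, definable n0 (P l)) -> definable n0 (fun w e => has (fun l => P l w e) r).
Proof.
move=> h; elim: r => [|l r IH] /=; first exact: (@def_bool _ _ n0 false).
exact: def_or.
Qed.

Lemma def_has_path l x y :
  definable 0 (fun (w : world ar) e => has_path (wE w) (e x) (e y) l).
Proof.
elim: l x y => [|l IH] x y.
  apply: def_ext (def_eq ar 0 x y) => w e _; rewrite -cnt_gt0 /=.
  exact: lt0b.
apply: (@def_ext _ _ _ _ (fun w e => fex (fun c : 'I_(dsize w) =>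
   has_path (wE w) (e x) c l && ((c, e y) \in wE w)))).
  move=> w e _; rewrite -cnt_gt0 /= lt0n sum_nat_eq0 negb_forall.
  by apply: eq_existsb => c; rewrite /= -lt0n muln_gt0 cnt_gt0 lt0b eval_edgeE.
apply: def_ex; apply: def_and; last exact: def_edge.
exact: (IH x.+1 0).
Qed.
End SmallDomains.

Lemma def_formula (m : nat) (ar : 'I_m -> nat) n0 P (k : nat) : definable n0 P ->
  exists phi : formula ar k.+1, forall w (v : k.+1.-tuple 'I_(dsize w)), n0 <= dsize w ->
    holds (wE w) (wA w) phi v = P w (fun i => nth (thead v) v (minn i k)).
Proof.
move=> dP; have hs i : minn i k < k.+1 by rewrite ltnS geq_minr.
have [phi hphi] := dP (minn^~ k) k.+1 hs; exists phi => w v hw.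
have vE : v = etup k.+1 (fun i => nth (thead v) v i).
  by apply: eq_from_tnth => i; rewrite tnth_mktuple -tnth_nth.
by rewrite [in LHS]vE hphi.
Qed.

(** On a domain of size at most n0 a shortest path is shorter than n0, so finitely many path
    formulas suffice. The answers then depend on the current graph alone, and the tables stay
    empty. *)
Definition small_ans n0 (R : nat) (w : world par) (s : seq nat) : bool :=
  let cnt l := npow (dsize w) (eval_edge (wE w)) l (nth 0 s 0) (nth 0 s 1) in
  match R with
  | 4 => bex n0 (fun l => 0 < cnt l)
  | 5 => bex n0 (fun l => (nth 0 s 2 == l) && ((0 < cnt l) && ~~ bex l (fun l' => 0 < cnt l')))
  | _ => false
  end.

Lemma nth_min_val n k (v : k.+1.-tuple 'I_n) i : i <= k ->
  nat_of_ord (nth (thead v) v (minn i k)) = nth 0 (map val v) i.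
Proof.
by move=> ik; rewrite (minn_idPl ik) (nth_map (thead v)) // size_tuple ltnS.
Qed.

Lemma small_formula n0 (R : 'I_6) : exists phi : formula par (par R),
  forall (w : world par) (v : (par R).-tuple 'I_(dsize w)),
    holds (wE w) (wA w) phi v = small_ans n0 R w (map val v).
Proof.
have dreach : definable 0 (fun (w : world par) (e : env w) =>
    has (fun l => has_path (wE w) (e 0) (e 1) l) (iota 0 n0)).
  by apply: def_has => l; apply: def_has_path.
have ddist : definable 0 (fun (w : world par) (e : env w) =>
    has (fun l => (e 2 == l :> nat) && (has_path (wE w) (e 0) (e 1) l &&
      ~~ has (fun l' => has_path (wE w) (e 0) (e 1) l') (iota 0 l))) (iota 0 n0)).
  apply: def_has => l; apply: def_and; first exact: def_const.
  apply: def_and; first exact: def_has_path.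
  by apply: def_not; apply: def_has => l'; apply: def_has_path.
have triv k : exists phi : formula par k.+1, forall (w : world par) (v : k.+1.-tuple 'I_(dsize w)),
    holds (wE w) (wA w) phi v = false.
  have [phi h] := @def_formula _ _ _ _ k (@def_bool _ par 0 false).
  by exists phi => w v; rewrite h.
case: R => -[|[|[|[|[|[|//]]]]]] h; rewrite /small_ans /=.
- exact: (triv pdig.-1).
- exact: (triv (3 * pdig).-1).
- exact: (triv (4 * pdig).-1).
- exact: (triv (5 * pdig).-1).
- have [phi hphi] := @def_formula _ _ _ _ 1 dreach; exists phi => w v; rewrite hphi //.
  by apply: eq_has => l; rewrite -cnt_gt0 !nth_min_val.
- have [phi hphi] := @def_formula _ _ _ _ 2 ddist; exists phi => w v; rewrite hphi //.
  apply: eq_has => l; rewrite -cnt_gt0 !nth_min_val //; congr (_ && (_ && ~~ _)).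
  by apply: eq_has => l'; rewrite -cnt_gt0 !nth_min_val.
Qed.

Lemma small_reach n0 (w : world par) (v : 2.-tuple 'I_(dsize w)) : dsize w <= n0 ->
  small_ans n0 4 w (map val v) = (v \in reachability (wE w)).
Proof.
move=> le; rewrite reachability_cnt; apply/bexP/bexP => -[l ln h]; last first.
  by exists l => //; apply: leq_trans le.
have [sn rn] : nth 0 (map val v) 0 < dsize w /\ nth 0 (map val v) 1 < dsize w.
  by split; apply: nth_val_lt.
apply/bexP; rewrite -(connect_cnt (wE w) (Ordinal sn) (Ordinal rn)).
move: h; rewrite -[nth 0 _ 0]/(val (Ordinal sn)) -[nth 0 _ 1]/(val (Ordinal rn)) cnt_gt0.
by case/existsP=> p /andP[hp /eqP hr]; apply/connectP; exists p.
Qed.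

Lemma small_dist n0 (w : world par) (v : 3.-tuple 'I_(dsize w)) : dsize w <= n0 ->
  small_ans n0 5 w (map val v) = (v \in distance (wE w)).
Proof.
move=> le; rewrite distance_cnt; have qn : nth 0 (map val v) 2 < dsize w by apply: nth_val_lt.
have ballE l (c : nat -> nat) : ball l (fun l' => c l' == 0) = ~~ bex l (fun l' => 0 < c l').
  by rewrite /ball /bex -all_predC; apply: eq_all => i /=; rewrite eqn0Ngt.
rewrite ballE; apply/bexP/andP => [[l ln /andP[/eqP<- /andP[]]]//|[h1 h2]].
by exists (nth 0 (map val v) 2); [apply: leq_trans le|rewrite eqxx h1].
Qed.

Lemma big_formula n0 k : 0 < n0 -> exists phi : formula par k.+1,
  forall (w : world par) (v : k.+1.-tuple 'I_(dsize w)),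
    holds (wE w) (wA w) phi v = (n0 <= dsize w).
Proof.
move=> n00; have d : definable 0 (fun (w : world par) (e : env w) => n0 <= dsize w).
  apply: (@def_ext _ _ _ _ (fun w e => fex (fun a : 'I_(dsize w) => a == n0.-1 :> nat))).
    move=> w e _; apply/idP/existsP => [h|[a /eqP ha]].
      have h' : n0.-1 < dsize w by rewrite prednK.
      by exists (Ordinal h').
    by rewrite -(prednK n00) -ha.
  by apply: def_ex; apply: def_const.
by have [phi h] := @def_formula _ _ _ _ k d; exists phi => w v; rewrite h.
Qed.

Lemma par_gt0 R : 0 < par R.
Proof. by case: R => -[|[|[|[|[|[|//]]]]]]. Qed.

(** One formula serves all domain sizes by testing whether n reaches the threshold n0. The threshold
    can be raised at will, so that it can meet all other requirements on large n. *)
Lemma program_exists J : exists n1, forall n0, n1 <= n0 -> 0 < n0 ->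
  exists phi : forall R, formula par (par R),
  forall (w : world par) R (v : (par R).-tuple 'I_(dsize w)),
    holds (wE w) (wA w) (phi R) v =
    if n0 <= dsize w then 0 < upd J R w (nth 0 (map val v))
    else small_ans n0 R w (map val v).
Proof.
have H (R : 'I_6) : exists n1 (phi : formula par (par R)),
    forall (w : world par) (v : (par R).-tuple 'I_(dsize w)), n1 <= dsize w ->
    holds (wE w) (wA w) phi v = (0 < upd J R w (nth 0 (map val v))).
  have [t ht] := tm_upd J R.
  have := compile_formula t (par R).-1; rewrite prednK ?par_gt0 //.
  by case=> n1 [phi h]; exists n1, phi => w v hw; rewrite h // ht.
have [nf hnf] := fin_all_exists H.
exists (\max_R nf R) => n0 hn0 n00.
have H2 (R : 'I_6) : exists phi : formula par (par R),
    forall (w : world par) (v : (par R).-tuple 'I_(dsize w)),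
    holds (wE w) (wA w) phi v = if n0 <= dsize w then 0 < upd J R w (nth 0 (map val v))
      else small_ans n0 R w (map val v).
  have [phi1 h1] := hnf R; have [phi2 h2] := small_formula n0 R.
  have := @big_formula n0 (par R).-1 n00; rewrite prednK ?par_gt0 // => -[b hb].
  exists (FOr (FAnd b phi1) (FAnd (FNot b) phi2)) => w v /=; rewrite hb h2.
  case: ifP => hw; rewrite ?orbF //= h1 //.
  by apply: leq_trans hw; apply: leq_trans hn0; apply: leq_bigmax.
by have [phi hphi] := fin_all_exists H2; exists phi => w R v; apply: hphi.
Qed.

Lemma wid_large b0 n : 2 ^ (b0 * b0) <= n -> b0 <= wid n.
Proof.
move=> h; have n0 : 0 < n by apply: leq_trans h; rewrite expn_gt0.
have /andP[_ h2] := wid_bounds n0.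
have := trunc_log_max (isT : 1 < 2) h; nia.
Qed.

(** Let L be the rounded-down logarithm of n. The startup time plus one is 7 (L + 1) + 2 <= 9 (L +
    1), f n <= C (L + 1)^c, and L + 1 <= (wid + 1)^2. So the product has degree 2 c + 2 in wid, and
    one more factor wid absorbs the constants. *)
Lemma polylog_bounds c (f : nat -> nat) : O_log_pow c f -> exists n1, forall n, n1 <= n ->
  [/\ 1 < n, 0 < wid n, (startup n).+1 * f n <= 2 ^ wid n
    & (startup n).+1 * f n < wid n ^ (2 * c + 2).+1].
Proof.
case=> C [N hf]; have [b0 hb0] := exp_dominates (9 * C) 1 (2 * c.+1).
pose b1 := maxn b0 (9 * C * 2 ^ (2 * c.+1)).+1.
exists (maxn N (maxn 2 (2 ^ (b1 * b1)))) => n; rewrite !geq_max.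
case/and3P=> /hf hn n1 /wid_large hw.
have b0w : b0 <= wid n by apply: leq_trans hw; apply: leq_maxl.
have b1w : 9 * C * 2 ^ (2 * c.+1) < wid n by apply: leq_trans hw; apply: leq_maxr.
have w0 : 0 < wid n by apply: leq_trans b1w.
set L := trunc_log 2 n.
have /andP[_ Lw] := wid_bounds (ltnW n1); rewrite -/L in Lw.
have main : (startup n).+1 * f n <= 9 * C * (wid n + 1) ^ (2 * c.+1).
  apply: (@leq_trans (9 * L.+1 * (C * L.+1 ^ c))).
    apply: leq_mul; first by rewrite /startup nlog2E ?(ltnW n1) // -/L /pdig; lia.
    apply: leq_trans hn _; rewrite leq_mul2l; apply/orP; right.
    case: (c) => // c'; rewrite leq_exp2r // up_log_trunc_log // ltnS.
    exact/leq_trunc_log/leq_pred.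
  have -> : 9 * L.+1 * (C * L.+1 ^ c) = 9 * C * L.+1 ^ c.+1 by rewrite expnS; lia.
  by rewrite leq_mul2l expnM leq_exp2r ?addn1 ?Lw ?orbT.
split=> //.
  by apply: leq_trans main (ltnW (hb0 _ b0w)).
apply: leq_ltn_trans main _.
have h1 : (wid n + 1) ^ (2 * c.+1) <= 2 ^ (2 * c.+1) * wid n ^ (2 * c.+1).
  by rewrite -expnMn leq_exp2r //; lia.
apply: (@leq_ltn_trans (9 * C * 2 ^ (2 * c.+1) * wid n ^ (2 * c.+1))).
  by rewrite -[X in _ <= X]mulnA leq_mul2l h1 orbT.
have -> : (2 * c + 2).+1 = (2 * c.+1).+1 by lia.
by rewrite [X in _ < X]expnS ltn_mul2r expn_gt0 w0.
Qed.

Theorem theorem2 (c : nat) (f : nat -> nat) (hf : O_log_pow c f) :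
  in_DynFOMaj reachability f /\ in_DynFOMaj distance f.
Proof.
pose J := 2 * c + 2.
have [n1 hn1] := polylog_bounds hf; have [n2 hn2] := good_prime_exists.
have [n3 hn3] := program_exists J.
pose n0 := maxn (maxn n1 n2) (maxn n3 1).
have [phi hphi] := hn3 n0 ltac:(by rewrite !leq_max leqnn ?orbT)
  ltac:(by rewrite !leq_max leqnn ?orbT).
pose P := @DynProg 6 par phi.
have stepE n (st : state P n) (d : change n) R (v : (par R).-tuple 'I_n) :
    n0 <= n -> (v \in (step st d).2 R) =
    (0 < upd J R (@World _ par n (step st d).1 st.2) (nth 0 (map val v))).
  move=> hn; rewrite inE.
  by have := hphi (@World _ par n (step st d).1 st.2) R v; rewrite /= hn.
have smallE n (st : state P n) (d : change n) R (v : (par R).-tuple 'I_n) :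
    n < n0 -> (v \in (step st d).2 R) =
    small_ans n0 R (@World _ par n (step st d).1 st.2) (map val v).
  move=> hn; rewrite inE.
  by have := hphi (@World _ par n (step st d).1 st.2) R v; rewrite /= leqNgt hn.
have cond n : n0 <= n -> [/\ 1 < n, 0 < wid n, (startup n).+1 * f n <= 2 ^ wid n,
    (startup n).+1 * f n < wid n ^ J.+1 &
    forall N, 0 < N -> N <= n ^ n ->
      exists p, [/\ p < n ^ pdig, good_prime n p & ~~ (p %| N)]].
  rewrite !geq_max => /andP[/andP[/hn1[? ? ? ?] h2] _]; split=> // N.
  exact: hn2.
have invE n (ds : seq (change n)) : n0 <= n -> all (fun d => #|affected d| <= f n) ds ->
    Inv (f n) (size ds) (run P ds).1 (run P ds).2.
  move=> hn; have [c1 c2 c3 c4 c5] := cond n hn.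
  elim/last_ind: ds => [|ds d IH] hds; first exact: Inv0.
  move: hds; rewrite all_rcons => /andP[hd /IH inv].
  rewrite size_rcons /run foldl_rcons -/(run P ds).
  by apply: (step_Inv c1 c2 c3 c4 inv (erefl _) hd) => R v; apply: stepE.
split; [exists P, Rreach, (erefl 2) | exists P, Rdist, (erefl 3)].
  (* A nonempty sequence has a last change; the invariant before it makes the answers after it
     correct. *)
  move=> n; case/lastP=> [//|ds d] _; rewrite all_rcons => /andP[hd hds] v.
  rewrite tcast_id /run foldl_rcons -/(run P ds).
  case: (leqP n0 n) => hn; last first.
    by rewrite (@smallE n _ d Rreach) //; apply: small_reach; apply: ltnW.
  have [c1 c2 c3 c4 c5] := cond n hn.
  apply: (reach_correct c1 c2 c3 c4 c5 (invE n ds hn hds) (erefl _) hd) => R u.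
  exact: stepE.
move=> n; case/lastP=> [//|ds d] _; rewrite all_rcons => /andP[hd hds] v.
rewrite tcast_id /run foldl_rcons -/(run P ds).
case: (leqP n0 n) => hn; last first.
  by rewrite (@smallE n _ d Rdist) //; apply: small_dist; apply: ltnW.
have [c1 c2 c3 c4 c5] := cond n hn.
apply: (dist_correct c1 c2 c3 c4 c5 (invE n ds hn hds) (erefl _) hd) => R u.
exact: stepE.
Qed.
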